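(* For $\tau\in\mathbb{R}$ let $E_\tau:=x\partial_x+\tau y\partial_y$ and $E:=E_1$. For $\tau\in(0,1]$ let $\pi_\tau=E_\tau\wedge\partial_z$ on $\mathbb{R}^3$. The Poisson cohomology of $(\mathbb{R}^3,\pi_\tau)$ is described as follows: - the Casimir functions are the constants, $H^0(\mathbb{R}^3,\pi_\tau)=\mathbb{R}$; - $H^1(\mathbb{R}^3,\pi_\tau)$ is a free module over the Casimir functions (i.e. a real vector space) with generators (basis) the classes of: $y\partial_x,\ x\partial_y,\ E_{-1},\ \partial_z$ if $\tau=1$; $y^n\partial_x,\ E_{-1},\ \partial_z$ if $\tau=\frac1n$ with $n\in\mathbb{N}$, $n\ge2$; $E_{-1},\ \partial_z$ if $\tau\in(0,1]\setminus\{\frac1n\}_{n\in\mathbb{N}}$; - $H^2(\mathbb{R}^3,\pi_\tau)$ is a free module over the Casimir functions with generators the classes of: $y\partial_x\wedge\partial_z,\ x\partial_y\wedge\partial_z,\ E_{-1}\wedge\partial_z$ if $\tau=1$; $y^n\partial_x\wedge\partial_z,\ E_{-1}\wedge\partial_z$ if $\tau=\frac1n$ with $n\ge2$; $E_{-1}\wedge\partial_z$ if $\tau\in(0,1]\setminus\{\frac1n\}_{n\in\mathbb{N}}$; - $H^3(\mathbb{R}^3,\pi_\tau)=0$. The algebraic structure (wedge product and Schouten–Nijenhuis bracket) is determined by the operations on representatives together with the relations $$[E\wedge\partial_z]=0\ \text{ and }\ [p(x,y)\partial_x\wedge\partial_y]=0\ \text{ in } H^2(\mathbb{R}^3,\pi_1),\qquad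 [y^{n+1}\partial_x\wedge\partial_y]=0\ \text{ in } H^2(\mathbb{R}^3,\pi_{1/n})\ (n\ge 2),$$ for any homogeneous polynomial $p$ of degree $2$. In particular, for $\tau\in(0,1]\setminus\{\frac1n\}_{n\in\mathbb{N}}$ the wedge product and the induced bracket preserve the representatives.
   Context: For a Poisson structure $\pi$ on a manifold $M$ (a bivector field with $[\pi,\pi]=0$, where $[\cdot,\cdot]$ is the Schouten–Nijenhuis bracket), the Poisson cohomology $H^\bullet(M,\pi)$ is the cohomology of the complex $(\mathfrak{X}^\bullet(M),d_\pi:=[\pi,\cdot])$ of smooth multivector fields. The wedge product and Schouten–Nijenhuis bracket descend to $H^\bullet(M,\pi)$. Coordinates on $\mathbb{R}^3$ are $(x,y,z)$; $\mathbb{N}=\{1,2,\dots\}$. *)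

(* Defs.v *)
From HB Require Import structures.
From mathcomp Require Import all_boot all_order all_algebra ring_quotient.
From mathcomp Require Import ring.
From mathcomp Require Import all_classical all_reals all_analysis.

Set Implicit Arguments.
Unset Strict Implicit.
Unset Printing Implicit Defensive.

Import Order.TTheory GRing.Theory Num.Theory.
Import numFieldNormedType.Exports.

Local Open Scope ring_scope.

Section LmodQuotient.
Variables (K : pzRingType) (V : lmodType K) (S : submodClosed V).
Local Open Scope quotient_scope.

(* [submodClosed] does not inherit from [zmodClosed], which [Quotient.quot]
   requires. *)
Definition zmod_of_submod : {pred V} := S.

Fact zmod_of_submodP : zmod_closed zmod_of_submod.
Proof.
split=> [|u v uS vS]; first exact: (rpred0 S).
by rewrite -scaleN1r; apply: (@rpredD _ S) => //; apply: (@rpredZ _ _ S).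
Qed.
HB.instance Definition _ :=
  GRing.isZmodClosed.Build V zmod_of_submod zmod_of_submodP.

Definition lquot : Type := {ideal_quot zmod_of_submod}.
HB.instance Definition _ := GRing.Zmodule.on lquot.

Definition lquot_pi (v : V) : lquot := \pi_({ideal_quot zmod_of_submod}) v.

Definition lquot_scale (a : K) (u : lquot) : lquot :=
  lquot_pi (a *: repr (u : {ideal_quot zmod_of_submod})).

Lemma lquot_piE (v w : V) : (lquot_pi v = lquot_pi w) <-> (v - w \in S).
Proof.
rewrite -[v - w \in S]/(v - w \in zmod_of_submod).
rewrite (@Quotient.idealrBE _ zmod_of_submod).
by split=> [e|/eqP//]; apply/eqP.
Qed.

Lemma lquot_pi_repr (u : lquot) : lquot_pi (repr (u : {ideal_quot zmod_of_submod})) = u.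
Proof. exact: reprK. Qed.

Lemma lquot_piZ (a : K) (v : V) :
  lquot_scale a (lquot_pi v) = lquot_pi (a *: v).
Proof.
apply/lquot_piE; rewrite -scalerBr rpredZ//.
by apply/lquot_piE; rewrite lquot_pi_repr.
Qed.

Lemma lquot_piD (v w : V) : lquot_pi (v + w) = lquot_pi v + lquot_pi w.
Proof. exact: (raddfD (\pi_({ideal_quot zmod_of_submod}))). Qed.

Fact lquot_scaleA (a b : K) (u : lquot) :
  lquot_scale a (lquot_scale b u) = lquot_scale (a * b) u.
Proof. by rewrite -(lquot_pi_repr u) !lquot_piZ scalerA. Qed.

Fact lquot_scale1 : left_id 1 lquot_scale.
Proof. by move=> u; rewrite -(lquot_pi_repr u) lquot_piZ scale1r. Qed.

Fact lquot_scaleDr : right_distributive lquot_scale +%R.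
Proof.
move=> a u v; rewrite -(lquot_pi_repr u) -(lquot_pi_repr v).
by rewrite -lquot_piD !lquot_piZ -lquot_piD scalerDr.
Qed.

Fact lquot_scaleDl (u : lquot) : {morph lquot_scale^~ u : a b / a + b}.
Proof.
by move=> a b; rewrite -(lquot_pi_repr u) !lquot_piZ -lquot_piD scalerDl.
Qed.

HB.instance Definition _ := GRing.Zmodule_isLmodule.Build K lquot
  lquot_scaleA lquot_scale1 lquot_scaleDr lquot_scaleDl.

End LmodQuotient.

(* MathComp's [basis_of] only applies to finite-dimensional [vectType]s. *)
Definition is_basis (K : pzRingType) (V : lmodType K) (s : seq V) : Prop :=
  forall v : V, exists! c : {ffun 'I_(size s) -> K},
    v = \sum_i c i *: tnth (in_tuple s) i.

Definition in_span (K : pzRingType) (V : lmodType K) (s : seq V) (v : V) :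
  Prop := exists c : {ffun 'I_(size s) -> K},
    v = \sum_i c i *: tnth (in_tuple s) i.

Section Multivectors.
Variable R : realType.

Definition fld : Type := 'rV[R]_3 -> R^o.
HB.instance Definition _ := GRing.Lmodule.on fld.

Definition pd (i : 'I_3) (f : fld) : fld := fun p => 'D_(delta_mx 0 i) f p.

Definition pds (s : seq 'I_3) (f : fld) : fld := foldr pd f s.

Definition smooth (f : fld) : Prop :=
  forall s : seq 'I_3, continuous (pds s f) /\
    forall (i : 'I_3) (p : 'rV[R]_3), derivable (pds s f) p (delta_mx 0 i).

(* [A I] is the coefficient of the wedge of the d/dx_i, i in I, taken in
   increasing order of i; fields of all degrees live in the same type. *)
Definition mvect : Type := {ffun {set 'I_3} -> fld}.
HB.instance Definition _ := GRing.Lmodule.on mvect.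

Definition is_mvfield (k : nat) (A : mvect) : Prop :=
  (forall I, smooth (A I)) /\ (forall I : {set 'I_3}, #|I| != k -> A I = 0).

(* The sign such that e_I /\ e_J = wsign I J * e_(I u J) for disjoint I and J. *)
Definition wsign (I J : {set 'I_3}) : R :=
  (-1) ^+ #|[pred p : 'I_3 * 'I_3 | [&& p.1 \in I, p.2 \in J & (p.2 < p.1)%N]]|.

Definition wedge (A B : mvect) : mvect := [ffun K : {set 'I_3} =>
  fun p => \sum_(I : {set 'I_3} | I \subset K)
    wsign I (K :\: I) * (A I p * B (K :\: I) p)].

Definition pdm (i : 'I_3) (A : mvect) : mvect := [ffun I => pd i (A I)].

Definition dleft (i : 'I_3) (A : mvect) : mvect := [ffun I : {set 'I_3} =>
  if i \in I then 0 else wsign [set i] I *: A (i |: I)].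

Definition dright (i : 'I_3) (A : mvect) : mvect := [ffun I : {set 'I_3} =>
  if i \in I then 0 else wsign I [set i] *: A (i |: I)].

(* The i-th basis field d/dx_i is treated as an odd variable xi_i; [dleft] and
   [dright] are the left and right derivatives in xi_i.  The Schouten-Nijenhuis
   bracket is then
     [A, B] = sum_i (A <-d/dxi_i) /\ dB/dx_i - dA/dx_i /\ (d/dxi_i-> B).
   It is the Lie bracket on vector fields, [X, f] = X f, and
     [A, B /\ C] = [A, B] /\ C + (-1)^((a - 1) b) B /\ [A, C]
   for A, B of degrees a, b. *)
Definition schouten (A B : mvect) : mvect :=
  \sum_(i < 3) (wedge (dright i A) (pdm i B) - wedge (pdm i A) (dleft i B)).

Fact pds_lin (s : seq 'I_3) (a : R) (f g : fld) : smooth f -> smooth g ->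
  pds s (a *: f + g) = a *: pds s f + pds s g.
Proof.
move=> sf sg; elim: s => //= i s ->; apply/funext => p.
have [[_ df] [_ dg]] := (sf s, sg s); rewrite /pd.
by rewrite deriveD ?deriveZ//; apply: derivableZ.
Qed.

Fact smooth_lin (a : R) (f g : fld) :
  smooth f -> smooth g -> smooth (a *: f + g).
Proof.
move=> sf sg s; rewrite pds_lin//.
have [[cf df] [cg dg]] := (sf s, sg s); split=> [p|i p].
  exact: (cvgD (cvgZl_tmp (k := a) (cf p)) (cg p)).
by apply: derivableD; [apply: derivableZ|].
Qed.

Fact smooth0 : smooth 0.
Proof.
have pds0 s : pds s 0 = 0.
  by elim: s => //= i s ->; apply/funext => p; apply: derive_cst.
move=> s; rewrite pds0; split=> [|i p].
  exact: (@cst_continuous _ _ (0 : R^o)).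
exact: (derivable_cst (0 : R^o)).
Qed.

Fact is_mvfield0 k : is_mvfield k 0.
Proof. by split=> I; rewrite ffunE//; exact: smooth0. Qed.

Fact is_mvfield_lin k (a : R) (A B : mvect) :
  is_mvfield k A -> is_mvfield k B -> is_mvfield k (a *: A + B).
Proof.
move=> [sA hA] [sB hB]; split=> I => [|kI]; rewrite !ffunE.
  exact: smooth_lin.
by rewrite hA// hB// scaler0 addr0.
Qed.

Fact pdm_lin i k (a : R) (A B : mvect) : is_mvfield k A -> is_mvfield k B ->
  pdm i (a *: A + B) = a *: pdm i A + pdm i B.
Proof.
move=> [sA _] [sB _]; apply/ffunP => I; rewrite !ffunE.
exact: (pds_lin [:: i]).
Qed.

Fact dleft_lin i (a : R) (A B : mvect) :
  dleft i (a *: A + B) = a *: dleft i A + dleft i B.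
Proof.
apply/ffunP => I; rewrite !ffunE; case: ifP => _; first by rewrite scaler0 addr0.
by rewrite scalerDr !scalerA mulrC.
Qed.

Fact wedgeE (A B : mvect) (K : {set 'I_3}) (p : 'rV[R]_3) :
  wedge A B K p = \sum_(I : {set 'I_3} | I \subset K)
    wsign I (K :\: I) * (A I p * B (K :\: I) p).
Proof. by rewrite ffunE. Qed.

Fact mvect_linE (a : R) (A B : mvect) (I : {set 'I_3}) (p : 'rV[R]_3) :
  (a *: A + B) I p = a * A I p + B I p.
Proof. by rewrite !ffunE. Qed.

Fact wedge_lin (a : R) (A B C : mvect) :
  wedge A (a *: B + C) = a *: wedge A B + wedge A C.
Proof.
apply/ffunP => K; apply/funext => p.
rewrite mvect_linE !wedgeE mulr_sumr -big_split /=; apply: eq_bigr => I _.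
by rewrite mvect_linE; ring.
Qed.

Fact schouten_lin k (a : R) (P A B : mvect) :
  is_mvfield k A -> is_mvfield k B ->
  schouten P (a *: A + B) = a *: schouten P A + schouten P B.
Proof.
move=> mA mB; rewrite scaler_sumr -big_split; apply: eq_bigr => i _.
rewrite (pdm_lin _ _ mA mB) dleft_lin !wedge_lin /= scalerBr.
by rewrite opprD addrACA.
Qed.

Fact schouten0 (P : mvect) : schouten P 0 = 0.
Proof.
have := schouten_lin (-1) P (is_mvfield0 0) (is_mvfield0 0).
by rewrite scaler0 addr0 scaleN1r addNr.
Qed.

(* In degree 0 only the zero field is a coboundary. *)
Definition is_coboundary (P : mvect) (k : nat) (A : mvect) : Prop :=
  if k is j.+1 then exists2 B, is_mvfield j B & A = schouten P B else A = 0.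

Fact is_coboundary0 (P : mvect) k : is_coboundary P k 0.
Proof.
case: k => [//|j]; exists 0; first exact: is_mvfield0.
by rewrite schouten0.
Qed.

Fact is_coboundary_lin (P : mvect) k (a : R) (A B : mvect) :
  is_coboundary P k A -> is_coboundary P k B -> is_coboundary P k (a *: A + B).
Proof.
case: k => [-> ->|j [C mC ->] [D mD ->]]; first by rewrite /= scaler0 addr0.
exists (a *: C + D); first exact: is_mvfield_lin.
by rewrite (schouten_lin _ _ mC mD).
Qed.

Section Cohomology.
Variables (P : mvect) (k : nat).

Definition cocycles : {pred mvect} :=
  [pred A | `[< is_mvfield k A /\ schouten P A = 0 >]].

Fact cocycles_submod : GRing.submod_closed cocycles.
Proof.
split=> [|a A B].
  by apply/asboolP; split; [exact: is_mvfield0|exact: schouten0].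
move=> /asboolP[mA A0] /asboolP[mB B0]; apply/asboolP.
split; first exact: is_mvfield_lin.
by rewrite (schouten_lin _ _ mA mB) A0 B0 scaler0 addr0.
Qed.
HB.instance Definition _ :=
  GRing.isSubmodClosed.Build R mvect cocycles cocycles_submod.

Record cocycle : Type :=
  Cocycle { cocycle_val : mvect; _ : cocycle_val \in cocycles }.
HB.instance Definition _ := [isSub for cocycle_val].
HB.instance Definition _ := [Choice of cocycle by <:].
HB.instance Definition _ := [SubChoice_isSubLmodule of cocycle by <:].

(* When [P] is Poisson these are all the coboundaries, as then every one of them
   is a cocycle. *)
Definition coboundaries : {pred cocycle} :=
  [pred A : cocycle | `[< is_coboundary P k (val A) >]].

Fact coboundaries_submod : GRing.submod_closed coboundaries.
Proof.
split=> [|a A B]; first by apply/asboolP; exact: is_coboundary0.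
by move=> /asboolP hA /asboolP hB; apply/asboolP; exact: is_coboundary_lin.
Qed.
HB.instance Definition _ :=
  GRing.isSubmodClosed.Build R cocycle coboundaries coboundaries_submod.

Definition cohomology : Type := lquot coboundaries.
HB.instance Definition _ := GRing.Lmodule.on cohomology.

Definition class (A : cocycle) : cohomology := lquot_pi coboundaries A.

(* This includes that [A] is a cocycle. *)
Definition represents (A : mvect) (h : cohomology) : Prop :=
  exists2 c : cocycle, val c = A & class c = h.

Definition basis_of_classes (s : seq mvect) : Prop :=
  exists2 c : seq cocycle, [seq val A | A <- c] = s
    & is_basis [seq class A | A <- c].
End Cohomology.

Definition is_poisson (P : mvect) : Prop :=
  is_mvfield 2 P /\ schouten P P = 0.

(* [deg k l] is the degree of [op A B] for A, B of degrees k, l. *)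
Definition induces_op (P : mvect) (op : mvect -> mvect -> mvect)
    (deg : nat -> nat -> nat) : Prop :=
  forall k l, exists hop : cohomology P k -> cohomology P l ->
                           cohomology P (deg k l),
    forall (A B : mvect) (a : cohomology P k) (b : cohomology P l),
      represents A a -> represents B b -> represents (op A B) (hop a b).

Definition monom (I : {set 'I_3}) (f : fld) : mvect :=
  [ffun J => if J == I then f else 0].

Definition scal (f : fld) : mvect := monom finset.set0 f.

Definition casimir (P : mvect) (f : fld) : Prop :=
  smooth f /\ schouten P (scal f) = 0.

Definition ix : 'I_3 := @Ordinal 3 0 isT.
Definition iy : 'I_3 := @Ordinal 3 1 isT.
Definition iz : 'I_3 := @Ordinal 3 2 isT.

Definition cx : fld := fun p => p 0 ix.
Definition cy : fld := fun p => p 0 iy.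

(* The fields f d/dx, f d/dy and f d/dz. *)
Definition ddx (f : fld) : mvect := monom [set ix] f.
Definition ddy (f : fld) : mvect := monom [set iy] f.
Definition ddz (f : fld) : mvect := monom [set iz] f.
Definition dz : mvect := ddz (cst 1).

Definition ypow (n : nat) : fld := fun p => cy p ^+ n.

Definition hpoly (d : nat) (a : 'I_d.+1 -> R) : fld :=
  fun p => \sum_(i < d.+1) a i * cx p ^+ i * cy p ^+ (d - i).

Definition euler (tau : R) : mvect := ddx cx + tau *: ddy cy.

Definition pi_tau (tau : R) : mvect := wedge (euler tau) dz.

(* The generators as functions of the degree k, from the list [s] of those in
   degree 1 other than d/dz. *)
Definition reps (s : seq mvect) (k : nat) : seq mvect :=
  match k with
  | 0 => [:: scal (cst 1)]
  | 1 => rcons s dz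
  | 2 => [seq wedge A dz | A <- s]
  | _ => [::]
  end.

Definition rel_in_degree (rel : mvect -> Prop) (k : nat) (A : mvect) : Prop :=
  if k == 2 then rel A else A = 0.

(* On the span of the representatives, the wedge product and the bracket land
   again in this span, up to the space [rel] of bivector fields declared to be
   zero.  Degree 3 is left out since all classes vanish there.  The bracket has
   degree [(k + l).-1]: for k = l = 0 it is zero. *)
Definition determined_modulo (rel : mvect -> Prop) (s : seq mvect) : Prop :=
  forall k l A B, in_span (reps s k) A -> in_span (reps s l) B ->
    ((k + l < 3)%N -> exists2 C, in_span (reps s (k + l)) C
       & rel_in_degree rel (k + l) (wedge A B - C)) /\
    (((k + l).-1 < 3)%N -> exists2 C, in_span (reps s (k + l).-1) C
       & rel_in_degree rel (k + l).-1 (schouten A B - C)).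

Definition preserved (s : seq mvect) : Prop :=
  forall k l A B, in_span (reps s k) A -> in_span (reps s l) B ->
    in_span (reps s (k + l)) (wedge A B) /\
    in_span (reps s (k + l).-1) (schouten A B).

End Multivectors.

(* Main.v *)
Require Import Defs.
From HB Require Import structures.
From mathcomp Require Import all_boot all_order all_algebra.
From mathcomp Require Import ring.
From mathcomp Require Import all_classical all_reals all_analysis.

(** Write a multivector field as U + V /\ d/dz with U, V tangent to the planes
    z = const.  The differential is, up to signs, E /\ U_z + (L_E U) /\ d/dz +
    E /\ V_z /\ d/dz.  Integrating in z and dividing by x and y (Hadamard's lemma)
    reduces H^1 and H^2 to the kernel and the cokernel of L_E on planar vector
    fields modulo multiples of E, and H^3 to Hadamard's lemma alone.

    On components L_E acts as E - 1 and E - tau.  For mu > 0 the operator E + mu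
    is bijective on smooth functions: its inverse averages f over the contracting
    flow, f |-> mu^-1 \int_0^1 f (s^(1/mu) x, s^(tau/mu) y, z) ds.  For lambda <= 1
    the operator E - lambda is reduced to this case by Hadamard's lemma
    g = g(0) + x g1 + y g2, because (E - lambda)(x f) = x (E - (lambda - 1)) f and
    (E - lambda)(y f) = y (E - (lambda - tau)) f; the obstructions that remain are
    the resonant monomials x (for lambda = 1) and y^k (for lambda = k tau).

    The operations descend to cohomology by the Jacobi and Leibniz identities,
    checked on components; classes of degree 0 are constants and those of degree 3
    vanish, so only the degrees (1,1), (1,2) and (2,1) matter. *)

Set Implicit Arguments.
Unset Strict Implicit.
Unset Printing Implicit Defensive.
Import Order.TTheory GRing.Theory Num.Theory.
Import numFieldNormedType.Exports.
Local Open Scope ring_scope.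

(** * Smooth functions *)

(** [smooth] speaks only of iterated derivatives along the axes, so the chain rule and the symmetry
    of second derivatives have to be derived. The analysis is concentrated in averages over s in
    [0, 1] of w(s) g(a_1(s) x, a_2(s) y, a_3(s) z), whose weight w absorbs the factors that
    differentiation produces. Restriction to x_i = 0, the quotient in Hadamard's lemma and the
    inverse of E + mu are three choices of the a_i. From there on smooth functions form a
    commutative ring with derivations and the arguments are algebraic; averaging acts on smooth
    functions directly, flat ones included.

    The resonant fields x d/dx and y d/dy occur for every tau, yet only one diagonal class survives:
    E is the differential of z, and E /\ d/dz is that of z d/dz. The field E_{-1} complements E
    because 1 + tau is nonzero. The other generators come from the resonances 1 = n tau and tau = 1;
    two boolean flags record them, so that the three cases share one proof. *)

Section Smooth.
Local Open Scope classical_set_scope.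
Local Open Scope ring_scope.
Variable R : realType.
Implicit Types (f g : fld R) (i j : 'I_3) (p : 'rV[R]_3).

Lemma smooth_continuous f : smooth f -> continuous f.
Proof. by move=> /(_ [::])[]. Qed.

Lemma smooth_derivable f i p : smooth f -> derivable f p (delta_mx 0 i).
Proof. by move=> /(_ [::])[_]; exact. Qed.

Lemma smooth_pd f i : smooth f -> smooth (pd i f).
Proof.
move=> sf s; have := sf (rcons s i).
by rewrite /pds -cats1 foldr_cat.
Qed.

(** Smoothness is a greatest fixed point: any class closed under partial derivatives will do. It
    serves for products, coordinates and averages, whose derivatives have the same shape as the
    function itself. *)
Lemma smooth_coind (S : fld R -> Prop) :
    (forall f, S f -> [/\ continuous f,
        forall i p, derivable f p (delta_mx 0 i) & forall i, S (pd i f)]) ->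
  forall f, S f -> smooth f.
Proof.
move=> HS f Sf s; have {Sf} : S (pds s f).
  by elim: s => //= i s /HS[_ _]; exact.
by case/HS.
Qed.

Definition fmul f g : fld R := fun p => f p * g p.

Lemma derivable_fmul f g i p : smooth f -> smooth g ->
  derivable (fmul f g) p (delta_mx 0 i).
Proof. by move=> sf sg; apply: derivableM; exact: smooth_derivable. Qed.

Lemma pd_fmul f g i : smooth f -> smooth g ->
  pd i (fmul f g) = fmul (pd i f) g + fmul f (pd i g).
Proof.
move=> sf sg; apply/funext => p.
rewrite /pd deriveM; [|exact: smooth_derivable..].
by rewrite addrC; congr (_ + _); rewrite /fmul [RHS]mulrC.
Qed.

(** Products alone are not closed under differentiation; by the Leibniz rule their finite sums
    are. *)
Inductive sum_prod : fld R -> Prop :=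
| SumProd1 f g : smooth f -> smooth g -> sum_prod (fmul f g)
| SumProdD f g : sum_prod f -> sum_prod g -> sum_prod (f + g).

Lemma smooth_fmul f g : smooth f -> smooth g -> smooth (fmul f g).
Proof.
move=> sf sg; apply: (smooth_coind (S := sum_prod)); last exact: SumProd1.
move=> h; elim=> {f g sf sg h}[f g sf sg|f g _ [cf df Sf] _ [cg dg Sg]].
  split=> [p|i p|i].
  - exact: (cvgM (@smooth_continuous _ sf p) (@smooth_continuous _ sg p)).
  - exact: derivable_fmul.
  - rewrite (pd_fmul i sf sg).
    exact: (SumProdD (SumProd1 (smooth_pd i sf) sg) (SumProd1 sf (smooth_pd i sg))).
split=> [p|i p|i].
- exact: (cvgD (cf p) (cg p)).
- exact: derivableD.
have -> : pd i (f + g) = pd i f + pd i g.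
  by apply/funext => p; rewrite /pd deriveD.
exact: SumProdD.
Qed.

Lemma pd_cst i (a : R) : pd i (cst a : fld R) = 0.
Proof. by apply/funext => p; exact: derive_cst. Qed.

Lemma smooth_cst (a : R) : smooth (cst a : fld R).
Proof.
apply: (smooth_coind (S := fun f => exists a : R, f = cst a)); last by exists a.
move=> f [b ->]; split=> [p|i p|i].
- exact: (@cst_continuous _ R^o).
- exact: (derivable_cst (b : R^o)).
- by exists 0; rewrite pd_cst.
Qed.

Definition coordf i : fld R := fun p => p 0 i.

Lemma is_derive_coord i j p :
  is_derive p (delta_mx 0 j) (coordf i) ((i == j)%:R : R^o).
Proof.
suff H : h^-1 *: (coordf i (h *: delta_mx 0 j + p) - coordf i p) @[h --> 0^'] -->
    ((i == j)%:R : R^o).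
  split; first by apply/cvg_ex; eexists; exact: H.
  exact: (cvg_lim _ H).
apply: cvg_near_cst; near=> h.
rewrite /coordf !mxE addrK eqxx /= /GRing.scale /= mulrA mulVf ?mul1r//.
by near: h; exact: nbhs_dnbhs_neq.
Unshelve. all: by end_near. Qed.

Lemma pd_coordf i j : pd j (coordf i) = cst (i == j)%:R.
Proof. by apply/funext => p; apply: derive_val; exact: is_derive_coord. Qed.

Lemma smooth_coordf i : smooth (coordf i).
Proof.
apply: (smooth_coind (S := fun f => smooth f \/ exists i, f = coordf i)).
  move=> f [sf|[j ->]]; split=> [|k p|k].
  - exact: smooth_continuous.
  - exact: smooth_derivable.
  - by left; exact: smooth_pd.
  - exact: coord_continuous.
  - by apply: ex_derive; exact: is_derive_coord.
  - by left; rewrite pd_coordf; exact: smooth_cst.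
by right; exists i.
Qed.

Lemma cvg_row (I : Type) (F : set_system I) (FF : Filter F) n
    (u : 'I_n -> I -> R) (l : 'I_n -> R) :
    (forall k : 'I_n, u k x @[x --> F] --> l k) ->
  (\row_k u k x) @[x --> F] --> (\row_k l k).
Proof.
move=> ul; apply/cvgrPdist_le => e e0; near=> x.
rewrite /Num.Def.normr/= mx_normrE (bigmax_le _ (ltW e0))//= => -[k i] _.
rewrite !mxE/=; move: i; near: x; apply: filter_forall => i.
by move/cvgrPdist_le: (ul i); exact.
Unshelve. all: by end_near. Qed.

Lemma is_derive_line f p v (t : R) : derivable f (t *: v + p) v ->
  is_derive t 1 (fun h : R => f (h *: v + p)) ('D_v f (t *: v + p)).
Proof.
move=> df; have E : (fun h : R => h^-1 *: (f ((h *: 1 + t) *: v + p) -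
    f (t *: v + p))) = (fun h => h^-1 *: (f (h *: v + (t *: v + p)) -
    f (t *: v + p))).
  by apply/funext => h; rewrite scalerDl /GRing.scale /= mulr1 addrA.
by split; rewrite /derivable /derive E.
Qed.

(** The classical C^1 condition in terms of partial derivatives, which is what [smooth] provides and
    all that the chain rule below uses. *)
Definition partC1 f := continuous f /\
  forall i, continuous (pd i f) /\ forall p, derivable f p (delta_mx 0 i).

Lemma smooth_partC1 f : smooth f -> partC1 f.
Proof.
move=> sf; split; first exact: smooth_continuous.
move=> i; split; first exact/smooth_continuous/smooth_pd.
by move=> p; exact: smooth_derivable.
Qed.

(** The mean value theorem is applied on [0, 1] to s |-> f(t s e_i + p), which treats both signs of
    t at once and gives xi = t c. *)
Lemma mean_value_pd f i p (t : R) : partC1 f -> exists2 xi : R, `|xi| <= `|t| &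
  f (t *: delta_mx 0 i + p) - f p = t * pd i f (xi *: delta_mx 0 i + p).
Proof.
move=> [cf dcf]; have [_ df] := dcf i.
pose u (s : R) : R := f ((t * s) *: delta_mx 0 i + p).
have du (s : R) : is_derive s 1 u
    (t * pd i f ((t * s) *: delta_mx 0 i + p)).
  rewrite mulrC; apply: (@is_derive1_comp _ (fun h => f (h *: delta_mx 0 i + p))
    ( *%R t)); first exact: is_derive_line.
  have := is_deriveZ t (is_derive_id s (1 : R)).
  by rewrite [t *: 1]mulr1.
have [|c c01] := @MVT_segment _ u _ 0 1 ler01 (fun x _ => du x).
  apply/continuous_subspaceT => s.
  by apply/differentiable_continuous/derivable1_diffP; exact: (@ex_derive _ _ _ _ _ _ _ (du s)).
rewrite /u !mulr1 mulr0 scale0r add0r subr0 mulr1 => ->.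
exists (t * c) => //; rewrite normrM ler_piMr//.
by move: c01; rewrite in_itv /= => /andP[c0 c1]; rewrite ger0_norm.
Qed.

End Smooth.

(** * Chain rule along curves *)

Section Chain.
Local Open Scope classical_set_scope.
Local Open Scope ring_scope.
Variable R : realType.
Implicit Types (f g : fld R) (i j : 'I_3) (p : 'rV[R]_3).

(* The coordinates are changed one at a time, with the mean value theorem for
   each increment. *)
Lemma is_derive_curve f (c : 'I_3 -> R -> R) (t : R) (dc : 'I_3 -> R) :
    partC1 f -> (forall i, is_derive t 1 (c i) (dc i)) ->
  is_derive t (1 : R) (fun s => f (\row_i c i s))
    (\sum_i dc i * pd i f (\row_i c i t)).
Proof.
move=> C1f dcP; set p := \row_i c i t.
pose d k (h : R) := c k (h + t) - c k t.
have cvd k : h^-1 * d k h @[h --> 0^'] --> dc k.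
  have /derivable1P := @ex_derive _ _ _ _ _ _ _ (dcP k).
  have := @derive_val _ _ _ _ _ _ _ (dcP k).
  rewrite /derive => <- _.
  have := @ex_derive _ _ _ _ _ _ _ (dcP k); rewrite /derivable.
  suff -> : (fun h => h^-1 * d k h) = (fun h => h^-1 *: (c k (h *: 1 + t) - c k t)).
    by [].
  by apply/funext => h; rewrite /d [h *: 1]mulr1.
have d0 k : d k h @[h --> 0^'] --> 0.
  have c0 : h @[h --> 0^'] --> (0 : R) by exact: (@cvg_within_filter _ _ _ _ _ _ _ (@cvg_id _ _)).
  have := cvgM c0 (cvd k).
  rewrite mul0r => H; apply: cvg_trans; last exact: H. apply: near_eq_cvg; near=> h.
  rewrite /= [LHS]mulrA mulfV ?mul1r//; near: h; exact: nbhs_dnbhs_neq.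
(* The first k coordinates are at time h + t, the others still at time t; the increments from [q k]
   to [q k.+1] telescope. *)
pose q (k : nat) h : 'rV[R]_3 := \row_i (if (i < k)%N then c i (h + t) else c i t).
have qS (k : 'I_3) h : q k.+1 h = d k h *: delta_mx 0 k + q k h.
  apply/rowP => i; rewrite !mxE eqxx /= ltnS leq_eqVlt.
  case: ltngtP => [||/val_inj ->]/=; rewrite ?eqxx ?mulr1 ?subrK// => ik.
    by rewrite -val_eqE (ltn_eqF ik) mulr0 add0r.
  by rewrite -val_eqE (gtn_eqF ik) mulr0 add0r.
have key (k : 'I_3) : h^-1 * (f (q k.+1 h) - f (q k h)) @[h --> 0^'] -->
    dc k * pd k f p.
  have /choice[xi xiP] : forall h, exists xi : R, `|xi| <= `|d k h| /\
      f (q k.+1 h) - f (q k h) = d k h * pd k f (xi *: delta_mx 0 k + q k h).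
    by move=> h; rewrite qS; have [xi ? ?] := mean_value_pd k (q k h) (d k h) C1f;
      exists xi.
  (* The intermediate points are squeezed towards p, so continuity of the partial derivative at p
     gives the limit. *)
  have xi0 : xi h @[h --> 0^'] --> 0.
    apply/norm_cvg0P.
    apply: (@squeeze_cvgr _ _ _ _ (cst 0) (fun h => `|d k h|)).
    - by near=> h; rewrite normr_ge0 /=; have [] := xiP h.
    - exact: cvg_cst.
    - by rewrite -[X in _ --> X](@normr0 _ R); exact: (cvg_norm (d0 k)).
  have qp : xi h *: delta_mx 0 k + q k h @[h --> 0^'] --> p.
    have -> : (fun h => xi h *: delta_mx 0 k + q k h) = (fun h => \row_i
        (xi h * (i == k)%:R + if (i < k)%N then d i h + c i t else c i t)).
      by apply/funext => h; apply/rowP => i; rewrite !mxE eqxx /d subrK.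
    apply: cvg_row => i; rewrite -[X in _ --> X]add0r; apply: cvgD.
      by rewrite -[X in _ --> X](mul0r (i == k)%:R); exact: (cvgM xi0 (cvg_cst _)).
    case: (i < k)%N; last exact: cvg_cst.
    by rewrite -[X in _ --> X]add0r; exact: (cvgD (d0 i) (cvg_cst _)).
  have -> : (fun h => h^-1 * (f (q k.+1 h) - f (q k h))) =
    (fun h => (h^-1 * d k h) * pd k f (xi h *: delta_mx 0 k + q k h)).
    by apply/funext => h; have [_ ->] := xiP h; rewrite mulrA.
  apply: cvgM => //; have [_ /(_ k)[cpd _]] := C1f.
  exact: (cvg_comp _ _ qp (cpd p)).
have H : h^-1 *: (f (\row_i c i (h *: 1 + t)) - f (\row_i c i t))
    @[h --> 0^'] --> \sum_i dc i * pd i f p.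
  have -> : (fun h => h^-1 *: (f (\row_i c i (h *: 1 + t)) - f (\row_i c i t))) =
      (fun h => \sum_(k < 3) h^-1 * (f (q k.+1 h) - f (q k h))).
    apply/funext => h; rewrite -mulr_sumr.
    rewrite -(big_mkord xpredT (fun k => f (q k.+1 h) - f (q k h))).
    rewrite telescope_sumr//; congr (_ * (f _ - f _)); apply/rowP => i; rewrite !mxE.
    by rewrite ltn_ord [h *: 1]mulr1.
  apply: (@cvg_big _ _ +%R) => [|k _]; [exact: add_continuous|exact: key].
by split; [apply/cvg_ex; eexists; exact: H|exact: cvg_lim H].
Unshelve. all: by end_near. Qed.

End Chain.

(** * Averages over dilations *)

Section Average.
Local Open Scope classical_set_scope.
Local Open Scope ring_scope.
Variable R : realType.
Implicit Types (f g : fld R) (i j : 'I_3) (p : 'rV[R]_3) (w : R -> R)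
  (a : 'I_3 -> R -> R).
Notation mu := (@lebesgue_measure R).
Notation I01 := (`[(0:R), (1:R)]%classic).

Definition scale_row a (s : R) p : 'rV[R]_3 := \row_i (a i s * p 0 i).

(** The weight w is arbitrary so that averages are closed under differentiation: the i-th derivative
    replaces w by w a_i and g by its i-th derivative. *)
Definition avg w a g : fld R := fun p =>
  \int[mu]_(s in `[0, 1]) (w s * g (scale_row a s p)).

Section Fixed.
Variables (w : R -> R) (a : 'I_3 -> R -> R) (g : fld R).
Hypotheses (cw : continuous w) (ca : forall i, continuous (a i))
  (cg : continuous g).
Let G p s := w s * g (scale_row a s p).

Lemma cvg_avg_integrand (s : R) p :
  G z.1 z.2 @[z --> (p, s)] --> G p s.
Proof.
have c2 : z.2 @[z --> (p, s)] --> s by exact: cvg_snd.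
have c1 : z.1 @[z --> (p, s)] --> p by exact: cvg_fst.
apply: cvgM; first exact: (cvg_comp _ _ c2 (@cw s)).
suff H : scale_row a z.2 z.1 @[z --> (p, s)] --> scale_row a s p.
  exact: (cvg_comp _ _ H (@cg _)).
apply: cvg_row => k; apply: cvgM.
  exact: (cvg_comp _ _ c2 (@ca k s)).
exact: (cvg_comp _ _ c1 (@coord_continuous R 1 3 0 k p)).
Qed.

Lemma continuous_avg_integrand p : continuous (G p).
Proof.
move=> s; apply: cvgM; first exact: cw.
suff H : scale_row a z p @[z --> s] --> scale_row a s p.
  exact: (cvg_comp _ _ H (@cg _)).
by apply: cvg_row => k; apply: cvgM; [exact: ca|exact: cvg_cst].
Qed.

Lemma integrable_avg p : mu.-integrable `[0, 1] (EFin \o G p).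
Proof.
apply: continuous_compact_integrable; first exact: segment_compact.
by apply: continuous_subspaceT; exact: continuous_avg_integrand.
Qed.

(** Joint continuity of the integrand in (p, s), made uniform in s by compactness of [0, 1]. *)
Lemma avg_integrand_unif p (e : R) : 0 < e ->
  \forall q \near p, forall s, I01 s -> `|G q s - G p s| <= e.
Proof.
move=> e0; have /compact_near_coveringP := @segment_compact R 0 1.
move=> /(_ _ (nbhs p) (fun q s => `|G q s - G p s| <= e) _); apply => s _.
have := @cvg_avg_integrand s p => /cvgrPdist_le /(_ (e / 2)).
rewrite divr_gt0// => /(_ isT)[[A B] /= [pA sB] AB].
exists (B `&` [set t | `|G p s - G p t| <= e / 2], A).
  split => //=; apply: filterI => //.
  have := @continuous_avg_integrand p s => /cvgrPdist_le; apply.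
  by rewrite divr_gt0.
move=> [t q] /= [[Bt Gt] Aq].
rewrite -(subrKA (G p s)) (le_trans (ler_normD _ _))// (splitr e) lerD//.
by rewrite distrC; exact: (AB (q, t)).
Qed.

(** Provides the constant dominating function for differentiation under the integral sign. *)
Lemma avg_integrand_bounded p : exists M : R, 0 <= M /\
  \forall q \near p, forall s, I01 s -> `|G q s| <= M.
Proof.
have /compact_bounded[M [_ HM]] : compact (G p @` `[0, 1]).
  apply: continuous_compact; last exact: segment_compact.
  by apply: continuous_subspaceT; exact: continuous_avg_integrand.
exists (`|M| + 2); split; first by rewrite addr_ge0.
near=> q => s s01; rewrite -(subrK (G p s) (G q s)).
rewrite (le_trans (ler_normD _ _))//.
have -> : `|M| + 2 = 1 + (`|M| + 1) by ring.
apply: lerD; first by move: s s01; near: q; exact: (avg_integrand_unif p ltr01).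
apply: (HM (`|M| + 1)); last by exists s.
by rewrite (le_lt_trans (ler_norm _))// ltrDl.
Unshelve. all: by end_near. Qed.

Lemma continuous_avg : continuous (avg w a g).
Proof.
suff H p : avg w a g q @[q --> p] --> avg w a g p by move=> p; exact: H.
apply/(@cvgrPdist_le _ _ _ _ (nbhs_filter p)) => e e0; near=> q.
rewrite distrC /avg -RintegralB//; [|exact: integrable_avg..].
apply: (le_trans (le_normr_Rintegral _ _)) => //.
  have := integrableB _ (integrable_avg q) (integrable_avg p).
  by apply => //.
have -> : e = \int[mu]_(s in `[0, 1]) (cst e s).
  rewrite Rintegral_cst//; have M1 := @lebesgue_measure_itv R `[0, 1].
  rewrite /= lte_fin ltr01 sube0 in M1.
  by rewrite -[e in LHS]mulr1; congr (_ * _); exact/esym/(congr1 fine M1).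
apply: le_Rintegral => //.
- have := integrableB _ (integrable_avg q) (integrable_avg p).
  by move=> H; apply: (@integrable_norm _ _ _ mu `[0, 1] (fun x => G q x - G p x)) => //; exact: H.
- apply: continuous_compact_integrable; first exact: segment_compact.
  by apply: continuous_subspaceT; exact: cst_continuous.
- by near: q; exact: (avg_integrand_unif p e0).
Unshelve. all: by end_near. Qed.

End Fixed.

(** Differentiation under the integral sign in the parameter h of the line h e_i + p: a shift of p
    by h e_i moves the dilated point by h a_i(s) e_i, whence the factor a_i(s). *)
Lemma is_derive_avg w a g i p : continuous w -> (forall i, continuous (a i)) ->
    partC1 g ->
  is_derive p (delta_mx 0 i) (avg w a g)
    (avg (fun s => w s * a i s) a (pd i g) p).
Proof.
move=> cw ca [cg C1g]; have [cpg dg] := C1g i.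
pose f (h s : R) := w s * g (scale_row a s (h *: delta_mx 0 i + p)).
have cwa : continuous (fun s => w s * a i s).
  by move=> s; apply: cvgM; [exact: cw|exact: ca].
have shiftE h s : scale_row a s (h *: delta_mx 0 i + p) =
    (h * a i s) *: delta_mx 0 i + scale_row a s p.
  by apply/rowP => k; rewrite !mxE eqxx /=; have [->|_] := eqVneq k i; rewrite ?mulr1n ?mulr0n; ring.
have df h s : is_derive h (1 : R) (f ^~ s)
    ((w s * a i s) * pd i g (scale_row a s (h *: delta_mx 0 i + p))).
  have H : is_derive h (1 : R)
      (fun h => g ((h * a i s) *: delta_mx 0 i + scale_row a s p))
      (pd i g ((h * a i s) *: delta_mx 0 i + scale_row a s p) * a i s).
    apply: (@is_derive1_comp _
      (fun h => g (h *: delta_mx 0 i + scale_row a s p)) (fun h => h * a i s)).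
      exact: is_derive_line.
    have := is_deriveZ (a i s) (is_derive_id h (1 : R)).
    rewrite [_ *: 1]mulr1; congr is_derive; apply/funext => x.
    exact: mulrC.
  have := is_deriveZ (w s) H; rewrite shiftE.
  rewrite [_ *: (_ * a i s)]mulrCA -mulrA [a i s * _]mulrC.
  have -> // : w s \*: (fun h : R => g ((h * a i s) *: delta_mx 0 i + scale_row a s p)) = f ^~ s.
    by apply/funext => x; rewrite /f shiftE.
  by move=> H'; congr is_derive: H'; ring.
(* The bound holds only near p, that is for |h| < d, which is why the interval ]-d, d[ enters. *)
have [M [M0 bM]] := avg_integrand_bounded cwa ca cpg p.
have {bM}[d /= d0 bM] : \forall h \near (0 : R), forall s, I01 s ->
   `|(w s * a i s) * pd i g (scale_row a s (h *: delta_mx 0 i + p))| <= M.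
  suff H : h *: delta_mx 0 i + p @[h --> (0 : R)] --> p by exact: (H _ bM).
  rewrite -[X in _ --> X]add0r -(scale0r (delta_mx 0 i : 'rV[R]_3)).
  by apply: cvgD; [apply: cvgZr_tmp; exact: cvg_id|exact: cvg_cst].
have I0 : [set` `]-d, d[] (0 : R) by rewrite /= in_itv/= oppr_lt0 d0.
have Id h : [set` `]-d, d[] h -> `|0 - h| < d.
  by rewrite /= in_itv/= sub0r normrN ltr_norml.
have bd h s : [set` `]-d, d[] h -> I01 s -> `|partial1of2 f h s| <= M.
  move=> Ih s01; rewrite partial1of2E (@derive_val _ _ _ _ _ _ _ (df h s)).
  exact: bM (Id _ Ih) _ s01.
have H := @cvg_differentiation_under_integral _ _ _ mu f `[0, 1]
  (measurable_itv _) 0 (- d) d I0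
  (fun h _ => integrable_avg cw ca cg _)
  (fun h s _ _ => @ex_derive _ _ _ _ _ _ _ (df h s)) (cst M) (fun=> M0) _ bd.
have {}H : h^-1 *: (avg w a g (h *: delta_mx 0 i + p) - avg w a g p)
    @[h --> 0^'] --> avg (fun s => w s * a i s) a (pd i g) p.
  have E : avg (fun s => w s * a i s) a (pd i g) p =
      \int[mu]_(s in `[0, 1]) partial1of2 f 0 s.
    apply: eq_Rintegral => s _.
    by rewrite partial1of2E (@derive_val _ _ _ _ _ _ _ (df 0 s)) scale0r add0r.
  rewrite E; have -> : (fun h => h^-1 *: (avg w a g (h *: delta_mx 0 i + p) - avg w a g p)) =
    (fun h => h^-1 *: (\int[mu]_(y in `[0, 1]) f (h + 0) y - \int[mu]_(y in `[0, 1]) f 0 y)).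
    apply/funext => h; rewrite addr0; congr (_ *: (_ - _)).
    by apply: eq_Rintegral => s _; rewrite /f scale0r add0r.
  apply: H.
  apply: continuous_compact_integrable; first exact: segment_compact.
  by apply: continuous_subspaceT; exact: cst_continuous.
by split; [apply/cvg_ex; eexists; exact: H|exact: cvg_lim H].
Qed.

Lemma smooth_avg w a g : continuous w -> (forall i, continuous (a i)) ->
  smooth g -> smooth (avg w a g).
Proof.
move=> cw ca sg; apply: (smooth_coind (S := fun f => exists w g,
  [/\ continuous w, smooth g & f = avg w a g])); last by exists w, g.
move=> _ {w g cw sg}[w [g [cw sg ->]]]; split=> [|i p|i].
- exact/(continuous_avg cw ca)/smooth_continuous.
- apply: ex_derive; apply: is_derive_avg => //; exact: smooth_partC1.
- exists (fun s => w s * a i s), (pd i g); split.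
  + by move=> s; apply: cvgM; [exact: cw|exact: ca].
  + exact: smooth_pd.
  + apply/funext => p; apply: derive_val; apply: is_derive_avg => //.
    exact: smooth_partC1.
Qed.

Lemma pd_avg w a g i : continuous w -> (forall i, continuous (a i)) ->
  smooth g -> pd i (avg w a g) = avg (fun s => w s * a i s) a (pd i g).
Proof.
move=> cw ca sg; apply/funext => p; apply: derive_val.
by apply: is_derive_avg => //; exact: smooth_partC1.
Qed.

End Average.

(** * Power dilations and integration in the dilation parameter *)

Section Dilation.
Local Open Scope classical_set_scope.
Local Open Scope ring_scope.
Variable R : realType.
Implicit Types (f g : fld R) (i j : 'I_3) (p : 'rV[R]_3) (w : R -> R)
  (a : 'I_3 -> R -> R) (k : R).
Notation mu := (@lebesgue_measure R).

(** The absolute value makes s^k continuous on the whole line for k >= 0, as averages require of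
    their scalings; for k = 0 it is the constant 1, also at s = 0. *)
Definition npow k (s : R) : R := `|s| `^ k.

Lemma continuous_npow k : 0 <= k -> continuous (npow k).
Proof.
rewrite le_eqVlt => /predU1P[<-|k0] s.
  have -> : npow 0 = cst 1 by apply/funext => t; exact: powRr0.
  exact: cst_continuous.
have [->|s0] := eqVneq s 0.
  apply/cvgrPdist_le => e e0; near=> t.
  rewrite /npow normr0 powR0 ?gt_eqF// sub0r normrN ger0_norm ?powR_ge0//.
  (* Writing e as (e^(1/k))^k reduces the bound to |t| <= e^(1/k), by monotonicity of the power. *)
  rewrite -[leRHS](powRr1 (ltW e0)) -(mulVf (lt0r_neq0 k0)) powRrM.
  apply: ge0_ler_powR; rewrite ?nnegrE ?powR_ge0 ?(ltW k0)//.
  have : `|0 - t| <= e `^ k^-1.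
    near: t; apply: cvgr_dist_le; first exact: cvg_id.
    by rewrite powR_gt0.
  by rewrite sub0r normrN.
have H : {for `|s|, continuous (fun x : R => x `^ k)}.
  apply/differentiable_continuous/derivable1_diffP.
  by apply: ex_derive; apply: is_derive1_powR; rewrite normr_gt0.
have cn : `|t| @[t --> s] --> `|s| by apply: cvg_norm; exact: cvg_id.
exact: (cvg_comp _ _ cn H).
Unshelve. all: by end_near. Qed.

Lemma npow_derive k (s : R) : 0 < s ->
  is_derive s (1 : R) (npow k) (k * s `^ (k - 1)).
Proof.
move=> s0; have H := is_derive1_powR k s0.
apply: near_eq_is_derive H; near=> t.
by rewrite /npow gtr0_norm//; near: t; exact: lt_nbhsr.
Unshelve. all: by end_near. Qed.

(** Differentiability is asked for in the open interval only: for k < 1 the power s^k has no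
    derivative at 0. *)
Lemma ftc01 (u du : R -> R) : continuous u -> continuous du ->
    (forall s : R, 0 < s < 1 -> is_derive s (1 : R) u (du s)) ->
  \int[mu]_(s in `[0, 1]) du s = u 1 - u 0.
Proof.
move=> cu cdu dP; have uP (x : R) : x \in `]0, 1[%R -> is_derive x (1 : R) u (du x).
  by move=> x01; apply: dP; move: x01; rewrite in_itv.
rewrite /Rintegral (@continuous_FTC2 _ du u 0 1 ltr01)//.
- exact: continuous_subspaceT.
- split=> [x /uP [//]||].
  + apply: cvg_at_right_filter; exact: cu.
  + apply: cvg_at_left_filter; exact: cu.
- by move=> x /uP H; rewrite derive1E (@derive_val _ _ _ _ _ _ _ H).
Qed.

Lemma avgD w a f g : continuous w -> (forall i, continuous (a i)) ->
  continuous f -> continuous g -> avg w a (f + g) = avg w a f + avg w a g.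
Proof.
move=> cw ca cf cg; apply/funext => p.
rewrite [RHS]/= -[RHS](@RintegralD _ _ _ mu) //; [|exact: integrable_avg..].
by apply: eq_Rintegral => s _; rewrite -mulrDr.
Qed.

Lemma avgZ w a (c : R) f : continuous w -> (forall i, continuous (a i)) ->
  continuous f -> avg w a (c *: f) = c *: avg w a f.
Proof.
move=> cw ca cf; apply/funext => p.
rewrite [RHS]/= -[RHS](@RintegralZl _ _ _ mu) //; last exact: integrable_avg.
by apply: eq_Rintegral => s _; rewrite mulrCA.
Qed.

Lemma avg_coord w a i g : continuous w -> (forall i, continuous (a i)) ->
  continuous g ->
  avg w a (fmul (coordf i) g) = fmul (coordf i) (avg (fun s => w s * a i s) a g).
Proof.
move=> cw ca cg; apply/funext => p.
rewrite [RHS]/fmul -[RHS](@RintegralZl _ _ _ mu) //; last first.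
  apply: integrable_avg => // s.
  by apply: cvgM; [exact: cw|exact: ca].
by apply: eq_Rintegral => s _; rewrite /fmul /coordf !mxE; ring.
Qed.

(** Integrates the s-derivative of b(s) f(a(s) p). The functions m_i extend b a_i' continuously to
    the endpoints: with b(s) = s and a_i(s) = s^k one gets k s^k although a_i' may be unbounded. The
    case b = s yields the inverse of E + mu, the case b = 1 yields Taylor's formula. *)
Lemma avg_ftc a (b db : R -> R) (m : 'I_3 -> R -> R) f p :
    (forall i, continuous (a i)) -> continuous b -> continuous db ->
    (forall i, continuous (m i)) -> smooth f ->
    (forall s : R, 0 < s < 1 -> is_derive s (1 : R) b (db s) /\
      forall i, exists2 d, is_derive s (1 : R) (a i) d & b s * d = m i s) ->
  b 1 * f (scale_row a 1 p) - b 0 * f (scale_row a 0 p) =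
    avg db a f p + \sum_i p 0 i * avg (m i) a (pd i f) p.
Proof.
move=> ca cb cdb cm sf dP.
have cf := @smooth_continuous _ _ sf.
have cpf i : continuous (pd i f) by exact/smooth_continuous/smooth_pd.
pose g : R -> R := fun s => db s * f (scale_row a s p) +
  \sum_i p 0 i * (m i s * pd i f (scale_row a s p)).
have cg : continuous g.
  move=> s; apply: cvgD; first exact: continuous_avg_integrand.
  apply: (@cvg_big _ _ +%R) => [|i _]; first exact: add_continuous.
  by apply: cvgM; [exact: cvg_cst|exact: continuous_avg_integrand].
rewrite -[LHS](@ftc01 (fun s => b s * f (scale_row a s p)) g)//; first last.
- move=> s /dP[bs das].
  have [d dP1 dP2] : exists2 d : 'I_3 -> R, forall i, is_derive s (1 : R) (a i) (d i) &
      forall i, b s * d i = m i s.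
    have /choice[d dP'] : forall i, exists d, is_derive s (1 : R) (a i) d /\ b s * d = m i s.
      by move=> i; have [d ? ?] := das i; exists d.
    by exists d => i; have [] := dP' i.
  have dc i : is_derive s (1 : R) (fun s => a i s * p 0 i) (d i * p 0 i).
    have := is_deriveZ (p 0 i) (dP1 i).
    rewrite [_ *: d i]mulrC; congr is_derive; apply/funext => x; exact: mulrC.
  have := is_deriveM bs (is_derive_curve (smooth_partC1 sf) dc).
  congr is_derive.
  rewrite addrC /g; congr (_ + _); first exact: mulrC.
  rewrite [LHS]mulr_sumr; apply: eq_bigr => i _; rewrite -dP2.
  by rewrite /scale_row; ring.
- exact: continuous_avg_integrand.
rewrite /g (@RintegralD _ _ _ mu)//; [|exact: integrable_avg|]; last first.
  apply: continuous_compact_integrable; first exact: segment_compact.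
  apply: continuous_subspaceT => s.
  apply: (@cvg_big _ _ +%R) => [|i _]; first exact: add_continuous.
  by apply: cvgM; [exact: cvg_cst|exact: continuous_avg_integrand].
congr (_ + _).
have I3 (h : 'I_3 -> R) : \sum_i h i = h ord0 + (h (inord 1) + h (inord 2)).
  rewrite !big_ord_recl big_ord0 addr0; congr (_ + (h _ + h _));
  by apply/val_inj; rewrite /= inordK.
rewrite I3; under eq_Rintegral => s _ do rewrite I3.
have In i : mu.-integrable `[0, 1] (EFin \o (fun s =>
   p 0 i * (m i s * pd i f (scale_row a s p)))).
  apply: continuous_compact_integrable; first exact: segment_compact.
  apply: continuous_subspaceT => s.
  by apply: cvgM; [exact: cvg_cst|exact: continuous_avg_integrand].
rewrite (@RintegralD _ _ _ mu)//; last first.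
  by have := integrableD _ (In (inord 1)) (In (inord 2)); exact.
rewrite (@RintegralD _ _ _ mu)//.
by congr (_ + (_ + _)); rewrite (@RintegralZl _ _ _ mu)//;
  exact: integrable_avg.
Qed.

End Dilation.

(** * The ring of smooth functions *)

Section SmoothRing.
Local Open Scope classical_set_scope.
Local Open Scope ring_scope.
Variable R : realType.
Implicit Types (f g : fld R) (i j : 'I_3) (p : 'rV[R]_3).

Definition smoothb : {pred fld R} := [pred f | `[< smooth f >]].

Fact smoothb_subring : GRing.subring_closed smoothb.
Proof.
split=> [|f g /asboolP sf /asboolP sg|f g /asboolP sf /asboolP sg].
- by apply/asboolP; exact: (@smooth_cst R 1).
- apply/asboolP; have := @smooth_lin R (-1) _ _ sg sf.
  by rewrite scaleN1r addrC.
- by apply/asboolP; exact: (smooth_fmul sf sg).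
Qed.
HB.instance Definition _ :=
  GRing.isSubringClosed.Build _ smoothb smoothb_subring.

(** As a commutative ring with derivations, smooth functions make every identity between
    coefficients a matter for [ring]; real constants enter through the ring morphism [cstS]. *)
Record smfun : Type := Smfun { smfun_val : fld R; _ : smfun_val \in smoothb }.
HB.instance Definition _ := [isSub for smfun_val].
HB.instance Definition _ := [Choice of smfun by <:].
HB.instance Definition _ := [SubChoice_isSubComNzRing of smfun by <:].

Lemma smfunP (F : smfun) : smooth (val F).
Proof. exact/asboolP/(valP F). Qed.

Definition mksmfun f (sf : smooth f) : smfun := Smfun (asboolT sf).

Lemma smfun_eqP (F G : smfun) : (forall p, val F p = val G p) <-> F = G.
Proof. by split=> [H|->//]; apply/val_inj/funext. Qed.

Definition cstS (c : R) : smfun := mksmfun (smooth_cst c).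

Fact K_additive : zmod_morphism cstS.
Proof. by move=> a b; exact/val_inj. Qed.
Fact K_multiplicative : monoid_morphism cstS.
Proof. by split=> [|a b]; exact/val_inj. Qed.
HB.instance Definition _ := GRing.isZmodMorphism.Build R smfun cstS K_additive.
HB.instance Definition _ := GRing.isMonoidMorphism.Build R smfun cstS K_multiplicative.

Definition varS i : smfun := mksmfun (smooth_coordf R i).

(* Locked, as otherwise unification would compare partial derivatives by
   unfolding them down to limits. *)
Definition pdS : 'I_3 -> smfun -> smfun :=
  locked (fun i F => mksmfun (smooth_pd i (smfunP F))).

Lemma val_pdS i F : val (pdS i F) = pd i (val F).
Proof. by rewrite /pdS -lock. Qed.

Fact D_additive i : zmod_morphism (pdS i).
Proof.
move=> F G; apply/val_inj; rewrite val_pdS [RHS](_ : _ = val (pdS i F) - val (pdS i G))//.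
rewrite !val_pdS; apply/funext => p /=.
by rewrite /pd deriveB//; exact/smooth_derivable/smfunP.
Qed.
HB.instance Definition _ i := GRing.isZmodMorphism.Build smfun smfun (pdS i) (D_additive i).

Lemma DM i F G : pdS i (F * G) = pdS i F * G + F * pdS i G.
Proof.
apply/val_inj; rewrite val_pdS.
rewrite [RHS](_ : _ = fmul (val (pdS i F)) (val G) + fmul (val F) (val (pdS i G)))//.
by rewrite !val_pdS; exact: (pd_fmul i (smfunP F) (smfunP G)).
Qed.

Lemma DK i c : pdS i (cstS c) = 0.
Proof. by apply/val_inj; rewrite val_pdS; exact: pd_cst. Qed.

Lemma DX i j : pdS j (varS i) = (i == j)%:R.
Proof. by apply/val_inj; rewrite val_pdS /= pd_coordf; case: (i == j). Qed.

Lemma D1 i : pdS i 1 = 0.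
Proof. by have := DK i 1; rewrite rmorph1. Qed.

(* Where x_i vanishes, F is the i-th derivative of x_i F. *)
Lemma X_reg i F : varS i * F = 0 -> F = 0.
Proof.
move=> XF; apply/smfun_eqP => p.
have /smfun_eqP/(_ p) := XF; have /(congr1 (pdS i))/smfun_eqP/(_ p) := XF.
rewrite DM DX eqxx raddf0 /= mul1r.
rewrite [Z in Z = _ -> _](_ : _ = val F p + p 0 i * val (pdS i F) p)// => H1.
rewrite [Z in Z = _ -> _](_ : _ = p 0 i * val F p)// => /eqP.
rewrite mulf_eq0 => /orP[/eqP p0|/eqP//].
by move: H1; rewrite p0 mul0r addr0.
Qed.

Lemma npow_row (k : 'I_3 -> R) p : scale_row (fun i => npow (k i)) 1 p = p.
Proof. by apply/rowP => i; rewrite mxE /npow normr1 powR1 mul1r. Qed.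

Lemma continuous_cst1 : continuous (cst 1 : R -> R).
Proof. exact: cst_continuous. Qed.

Section Dilate.
Variables (k : 'I_3 -> R) (k0 : forall i, 0 <= k i).
Let a i := npow (k i).
Let ca i : continuous (a i) := continuous_npow (k0 i).

Definition Dil (F : smfun) : smfun :=
  mksmfun (smooth_avg (continuous_cst1) ca (smfunP F)).

Fact Dil_additive : zmod_morphism Dil.
Proof.
move=> F G; apply/val_inj; rewrite /= -[- val G]scaleN1r -[- _ in RHS]scaleN1r.
have cF := @smooth_continuous _ _ (smfunP F).
have cG := @smooth_continuous _ _ (smfunP G).
have c1 := continuous_cst1.
rewrite (avgD c1 ca cF) ?(avgZ _ c1 ca cG)// => p.
exact: (cvgZl_tmp (k := -1) (@cG p)).
Qed.
HB.instance Definition _ := GRing.isZmodMorphism.Build smfun smfun Dil Dil_additive.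

Lemma DilXD i F : Dil (varS i * pdS i F) = varS i * pdS i (Dil F).
Proof.
have cF := @smooth_continuous _ _ (smooth_pd i (smfunP F)).
have c1 := continuous_cst1.
apply/val_inj.
rewrite [LHS](_ : _ = avg (cst 1) a (fmul (coordf i) (val (pdS i F))))//.
rewrite [RHS](_ : _ = fmul (coordf i) (val (pdS i (Dil F))))//.
rewrite !val_pdS [val (Dil F)]/= (pd_avg _ c1 ca (smfunP F)).
exact: (avg_coord i c1 ca cF).
Qed.

(** The integral over [0, 1] of the derivative of s F(s^k p), so [Dil] is a right inverse of 1 +
    sum_i k_i x_i D_i. *)
Lemma Dil_ode F : Dil F + \sum_i cstS (k i) * (varS i * pdS i (Dil F)) = F.
Proof.
apply/smfun_eqP => p; have cid : continuous (fun s : R => s) by move=> s; exact: cvg_id.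
have c1 := continuous_cst1.
have cm i : continuous (fun s => k i * a i s).
  by move=> s; apply: cvgM; [exact: cvg_cst|exact: ca].
have := @avg_ftc R a (fun s => s) (cst 1) (fun i s => k i * a i s) (val F) p
  ca cid c1 cm (smfunP F).
rewrite mul0r subr0 mul1r npow_row => -> //; last first.
  move=> s /andP[s0 _]; split; first exact: is_derive_id.
  move=> i; exists (k i * s `^ (k i - 1)); first exact: npow_derive.
  rewrite mulrCA; congr (_ * _); rewrite /a /npow gtr0_norm//.
  rewrite -{1}(powRr1 (ltW s0)) -powRD; last by rewrite (gt_eqF s0) implybT.
  by rewrite addrC subrK.
have E i : val (cstS (k i) * (varS i * pdS i (Dil F))) p =
    p 0 i * avg (fun s => k i * a i s) a (pd i (val F)) p.
  rewrite [LHS](_ : _ = k i * (p 0 i * val (pdS i (Dil F)) p))// val_pdS.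
  rewrite [LHS]/= (pd_avg _ c1 ca (smfunP F)) mulrCA; congr (_ * _).
  have cG := @smooth_continuous _ _ (smooth_pd i (smfunP F)).
  rewrite [LHS]/= -[LHS](@RintegralZl _ _ _ (@lebesgue_measure R)) //; last first.
    by apply: (@integrable_avg R (fun s => 1 * a i s)) => // s;
      apply: cvgM; [exact: cvg_cst|exact: ca].
  by apply: eq_Rintegral => s _; rewrite mul1r mulrA.
rewrite [LHS]/=; congr (_ + _); rewrite !big_ord_recl !big_ord0 /=.
by rewrite [LHS]/= -!E.
Qed.

(** Dilations commute with each x_i D_i, so the right inverse is a left inverse too; this is the
    source of all injectivity statements for E + mu. *)
Lemma Dil_inv F : Dil (F + \sum_i cstS (k i) * (varS i * pdS i F)) = F.
Proof.
rewrite raddfD raddf_sum /= -[RHS]Dil_ode; congr (_ + _); apply: eq_bigr => i _.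
rewrite -DilXD; apply/val_inj => /=.
have cF := @smooth_continuous _ _ (smfunP (varS i * pdS i F)).
have c1 := continuous_cst1.
exact: (avgZ (k i) c1 ca cF).
Qed.

(** An undilated variable is a mere parameter. With the exponent of z equal to 0, averaging
    therefore keeps functions independent of z. *)
Lemma D_Dil0 i F : k i = 0 -> pdS i (Dil F) = Dil (pdS i F).
Proof.
move=> ki; have c1 := continuous_cst1.
apply/val_inj; rewrite [RHS](_ : _ = avg (cst 1) a (val (pdS i F)))//.
rewrite !val_pdS [val (Dil F)]/= (pd_avg _ c1 ca (smfunP F)); congr avg.
by apply/funext => s; rewrite /a /npow ki powRr0 mulr1.
Qed.

End Dilate.

End SmoothRing.

(** * Restriction to coordinate planes, Taylor's formula and Hadamard's lemma *)

Section Hadamard.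
Local Open Scope classical_set_scope.
Local Open Scope ring_scope.
Variable R : realType.
Implicit Types (F G : smfun R) (i j : 'I_3) (p : 'rV[R]_3).
Notation mu := (@lebesgue_measure R).
Local Notation D := (@pdS R).
Local Notation X := (@varS R).
Local Notation K := (@cstS R).

Lemma Rintegral01_cst (u : R -> R) (c : R) : (forall s, u s = c) ->
  \int[mu]_(s in `[0, 1]) u s = c.
Proof.
move=> uE; have -> : u = cst c by apply/funext.
rewrite Rintegral_cst//; have M1 := @lebesgue_measure_itv R `[0, 1].
rewrite /= lte_fin ltr01 sube0 in M1.
by rewrite -[RHS]mulr1; congr (_ * _); exact: (congr1 fine M1).
Qed.

Lemma ord3_ind (P : 'I_3 -> Prop) : P ix -> P iy -> P iz -> forall i, P i.
Proof.
move=> Px Py Pz [[|[|[|//]]] i3].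
- by rewrite (_ : Ordinal i3 = ix)//; exact/val_inj.
- by rewrite (_ : Ordinal i3 = iy)//; exact/val_inj.
- by rewrite (_ : Ordinal i3 = iz)//; exact/val_inj.
Qed.

Definition kill i j (s : R) : R := (j != i)%:R.

Lemma continuous_kill i j : continuous (kill i j).
Proof. exact: cst_continuous. Qed.

(** Restriction to x_i = 0, extended constantly in x_i. Presenting it as an average with scalings
    constant in s gives its smoothness for free. *)
Definition Res i F : smfun R :=
  mksmfun (smooth_avg (@continuous_cst1 R) (@continuous_kill i) (smfunP F)).

Lemma Res_val i F p : val (Res i F) p = val F (scale_row (kill i) 0 p).
Proof.
by apply: Rintegral01_cst => s; exact: mul1r.
Qed.

Fact Res_additive i : zmod_morphism (Res i).
Proof. move=> F G; apply/smfun_eqP => p; rewrite Res_val.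
rewrite [RHS](_ : _ = val (Res i F) p - val (Res i G) p); last by [].
by rewrite !Res_val. Qed.
HB.instance Definition _ i := GRing.isZmodMorphism.Build (smfun R) (smfun R) (Res i) (Res_additive i).

Lemma D_Res i j F : D j (Res i F) = (j != i)%:R * Res i (D j F).
Proof.
apply/smfun_eqP => p.
rewrite val_pdS [LHS]/= (pd_avg _ (@continuous_cst1 R) (@continuous_kill i) (smfunP F)).
have -> : val ((j != i)%:R * Res i (D j F)) p = (j != i)%:R * val (Res i (D j F)) p.
  by case: (j != i).
by rewrite Res_val val_pdS; apply: Rintegral01_cst => s; rewrite mul1r.
Qed.

Lemma D_Res_id i F : D i (Res i F) = 0.
Proof. by rewrite D_Res eqxx mul0r. Qed.

Lemma D_Res_neq i j F : j != i -> D j (Res i F) = Res i (D j F).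
Proof. by move=> ji; rewrite D_Res ji mul1r. Qed.

Definition only i j : R := (j == i)%:R.

Lemma only_ge0 i j : 0 <= only i j.
Proof. exact: ler0n. Qed.

(** The integral of F over the segment from x_i = 0 to the given point, divided by x_i. It gives the
    quotient in Taylor's formula and, multiplied by x_i, an antiderivative. *)
Definition Mean i (F : smfun R) : smfun R := Dil (only_ge0 i) F.
HB.instance Definition _ i :=
  GRing.isZmodMorphism.Build (smfun R) (smfun R) (Mean i) (Dil_additive (only_ge0 i)).

Lemma Mean_ode i F : Mean i F + X i * D i (Mean i F) = F.
Proof.
rewrite -[RHS](Dil_ode (only_ge0 i)); congr (_ + _); rewrite (bigD1 i)//= big1.
  by rewrite /only eqxx rmorph1 mul1r addr0.
by move=> j ji; rewrite /only (negbTE ji) rmorph0 mul0r.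
Qed.

Lemma D_Mean i j F : j != i -> D j (Mean i F) = Mean i (D j F).
Proof. by move=> ji; apply: D_Dil0; rewrite /only (negbTE ji). Qed.

(** [avg_ftc] with b = 1, where only x_i is scaled, by s. *)
Lemma Taylor i F : F = Res i F + X i * Mean i (D i F).
Proof.
apply/smfun_eqP => p; apply/eqP; rewrite addrC -subr_eq; apply/eqP.
pose a j := npow (only i j).
have ca j : continuous (a j) by exact/continuous_npow/only_ge0.
have c1 := @continuous_cst1 R.
have c0 : continuous (cst 0 : R -> R) by exact: cst_continuous.
have cm j : continuous (fun s : R => only i j) by exact: cst_continuous.
have := @avg_ftc R a (cst 1) (cst 0) (fun j s => only i j) (val F) p
  ca c1 c0 cm (smfunP F).
rewrite !mul1r npow_row Res_val.
(* At s = 0 the powers 0^1 = 0 and 0^0 = 1 turn the dilation into the projection to x_i = 0. *)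
have -> : scale_row a 0 p = scale_row (kill i) 0 p.
  apply/rowP => j; rewrite !mxE /a /npow /only /kill; congr (_ * _).
  by case: eqP => _; rewrite normr0 ?powRr0// powR0// oner_eq0.
move=> -> //; last first.
  move=> s /andP[s0 _]; split; first exact: is_derive_cst.
  move=> j; exists (only i j * s `^ (only i j - 1)); first exact: npow_derive.
  rewrite mul1r /only; case: eqP => _; last by rewrite mul0r.
  by rewrite subrr powRr0 mulr1.
have -> : avg (cst 0) a (val F) p = 0.
  by apply: Rintegral01_cst => s; exact: mul0r.
rewrite add0r (bigD1 i)//= big1 ?addr0; last first.
  move=> j ji; rewrite [Z in _ * Z](_ : _ = 0) ?mulr0//.
  by apply: Rintegral01_cst => s; rewrite /only (negbTE ji) mul0r.
by rewrite /only eqxx -val_pdS.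
Qed.

(* Compares the j-th derivative of [Taylor i F] with [Taylor i (D j F)]. *)
Lemma DC i j F : D i (D j F) = D j (D i F).
Proof.
have [->//|ij] := eqVneq i j; rewrite eq_sym in ij.
have E1 := Taylor i (D j F).
have := congr1 (D j) (Taylor i F).
rewrite raddfD /= DM DX eq_sym (negbTE ij) mul0r add0r D_Res_neq// D_Mean//.
rewrite [LHS]E1 => /addrI /eqP; rewrite -subr_eq0 -mulrBr -raddfB => /eqP /X_reg H.
(* [Mean_ode] recovers a function from its mean, so a function with vanishing mean is 0. *)
have := Mean_ode i (D i (D j F) - D j (D i F)).
by rewrite H raddf0 mulr0 addr0 => /esym/eqP; rewrite subr_eq0 => /eqP.
Qed.

Definition ev F : R := val F 0.
Fact ev_additive : zmod_morphism ev.
Proof. by []. Qed.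
Fact ev_multiplicative : monoid_morphism ev.
Proof. by split. Qed.
HB.instance Definition _ := GRing.isZmodMorphism.Build (smfun R) R ev ev_additive.
HB.instance Definition _ := GRing.isMonoidMorphism.Build (smfun R) R ev ev_multiplicative.

Lemma evX i : ev (X i) = 0.
Proof. by rewrite /ev /= /coordf mxE. Qed.

Lemma evK c : ev (K c) = c.
Proof. by []. Qed.

Local Notation x := (X ix).
Local Notation y := (X iy).

Lemma smfun_cst F : (forall i, D i F = 0) -> F = K (ev F).
Proof.
move=> DF; have E i : F = Res i F by rewrite [LHS](Taylor i) DF raddf0 mulr0 addr0.
have V i p : val F p = val F (scale_row (kill i) 0 p).
  by rewrite -Res_val -E.
apply/smfun_eqP => p; rewrite (V ix) (V iy) (V iz) -[RHS]/(val F 0).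
congr (val F _); apply/rowP => j; rewrite !mxE /kill.
case: j => -[|[|[|//]]] j3.
all: by rewrite -?val_eqE /= ?mulrA ?(mul0r, mulr0, mul1r).
Qed.

Lemma ResM i F G : Res i (F * G) = Res i F * Res i G.
Proof.
apply/smfun_eqP => p; rewrite Res_val.
rewrite [RHS](_ : _ = val (Res i F) p * val (Res i G) p); last by [].
by rewrite !Res_val.
Qed.

Lemma ResX i j : Res i (X j) = (j != i)%:R * X j.
Proof.
apply/smfun_eqP => p; rewrite Res_val.
rewrite [RHS](_ : _ = (j != i)%:R * p 0 j); last by case: (j != i).
by rewrite /= /coordf mxE.
Qed.

Lemma Res1 i : Res i 1 = 1.
Proof. by apply/smfun_eqP => p; rewrite Res_val. Qed.

Lemma ResK i c : Res i (K c) = K c.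
Proof. by apply/smfun_eqP => p; rewrite Res_val. Qed.

(** Taylor's formula in x, followed by Taylor's formula in y for the restriction to x = 0. In
    general G0 depends on z, as needed in degrees 2 and 3; the last clause is the planar version,
    needed to solve equations for E. *)
Lemma hadamard F : exists G0 G1 G2, [/\ F = G0 + x * G1 + y * G2,
  D ix G0 = 0, D iy G0 = 0,
  G0 = Res iy (Res ix F) &
  (D iz F = 0 -> [/\ G0 = K (ev F), D iz G1 = 0 & D iz G2 = 0])].
Proof.
exists (Res iy (Res ix F)), (Mean ix (D ix F)), (Mean iy (D iy (Res ix F))).
have vG p : val (Res iy (Res ix F)) p = val F (\row_j ((j == iz)%:R * p 0 j)).
  rewrite !Res_val; congr (val F _); apply/rowP => j; rewrite !mxE /kill.
  by case: j => -[|[|[|//]]] j3; rewrite -?val_eqE /=; ring.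
split=> //.
- by rewrite addrAC -(Taylor iy) -Taylor.
- by rewrite D_Res_neq// D_Res_id raddf0.
- exact: D_Res_id.
move=> Fz; split.
- rewrite [LHS]smfun_cst => [|i].
    congr K; rewrite /ev vG; congr (val F _); apply/rowP => j.
    by rewrite !mxE mulr0.
  elim/ord3_ind: i.
  + by rewrite D_Res_neq// D_Res_id raddf0.
  + exact: D_Res_id.
  + by rewrite D_Res_neq// D_Res_neq// Fz !raddf0.
- by rewrite D_Mean// DC Fz !raddf0.
- by rewrite D_Mean// DC D_Res_neq// Fz !raddf0.
Qed.

Lemma antiderivative i F : exists G, D i G = F.
Proof.
exists (X i * Mean i F); rewrite DM DX eqxx mul1r; exact: Mean_ode.
Qed.

End Hadamard.

(** * The operators E + mu *)

Section Resonance.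
Variable R : realType.
Variable tau : R.
Hypotheses (tau0 : 0 < tau).
Implicit Types (F G : smfun R) (i j : 'I_3).
Local Notation D := (@pdS R).
Local Notation K := (@cstS R).
Local Notation x := (@varS R ix).
Local Notation y := (@varS R iy).

(* Locked, as the matching of additivity lemmas would otherwise unfold it. *)
Definition Eul : smfun R -> smfun R :=
  locked (fun F => x * D ix F + K tau * (y * D iy F)).

Lemma EulE F : Eul F = x * D ix F + K tau * (y * D iy F).
Proof. by rewrite /Eul -lock. Qed.

Lemma EulD F G : Eul (F + G) = Eul F + Eul G.
Proof. by rewrite !EulE !raddfD /=; ring. Qed.

Lemma EulN F : Eul (- F) = - Eul F.
Proof. by rewrite !EulE !raddfN /=; ring. Qed.

Fact Eul_additive : zmod_morphism Eul.
Proof. by move=> F G; rewrite !EulE !raddfB /=; ring. Qed.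
HB.instance Definition _ := GRing.isZmodMorphism.Build (smfun R) (smfun R) Eul Eul_additive.

Lemma EulM F G : Eul (F * G) = Eul F * G + F * Eul G.
Proof. by rewrite !EulE !DM; ring. Qed.

Lemma EulK c : Eul (K c) = 0.
Proof. by rewrite !EulE !DK; ring. Qed.

Lemma Eulx : Eul x = x.
Proof. by rewrite !EulE !DX /=; ring. Qed.

Lemma Euly : Eul y = K tau * y.
Proof. by rewrite !EulE !DX /=; ring. Qed.

Lemma D_Eul i F : i != ix -> i != iy -> D i (Eul F) = Eul (D i F).
Proof.
move=> ix0 iy0; rewrite !EulE raddfD /= !DM !DX DK.
rewrite [_ == i]eq_sym (negbTE ix0) [_ == i]eq_sym (negbTE iy0) !(DC i) /=; ring.
Qed.

Lemma Dz_Eul F : D iz (Eul F) = Eul (D iz F).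
Proof. exact: D_Eul. Qed.

Lemma Dx_Eul F : D ix (Eul F) = Eul (D ix F) + D ix F.
Proof. by rewrite !EulE raddfD /= !DM !DX DK /= [D ix (D iy F)]DC; ring. Qed.

Lemma Dy_Eul F : D iy (Eul F) = Eul (D iy F) + K tau * D iy F.
Proof. by rewrite !EulE raddfD /= !DM !DX DK /= [D iy (D ix F)]DC; ring. Qed.

Lemma Eul_ypow n : Eul (y ^+ n) = K (n%:R * tau) * y ^+ n.
Proof.
elim: n => [|n IH]; first by rewrite expr0 -(rmorph1 K) EulK mul0r rmorph0 mul0r.
by rewrite exprS EulM Euly IH -natr1; ring.
Qed.

Lemma ev_Eul F : ev (Eul F) = 0.
Proof. by rewrite EulE rmorphD !rmorphM /= !evX; ring. Qed.

Section Shift.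
Variable mu : R.
Hypothesis mu0 : 0 < mu.

(** Exponents for which 1 + sum_i k_i x_i D_i equals mu^-1 (E + mu). *)
Definition eul_wt i : R :=
  if i == ix then mu^-1 else if i == iy then tau / mu else 0.

Lemma eul_wt_ge0 i : 0 <= eul_wt i.
Proof.
by rewrite /eul_wt; do 2?case: eqP => // _; rewrite ?divr_ge0 ?invr_ge0 ?ltW.
Qed.

Lemma eul_wtE F :
  \sum_i K (eul_wt i) * (@varS R i * D i F) = K mu^-1 * Eul F.
Proof.
rewrite !big_ord_recl big_ord0 /eul_wt !EulE.
have -> : lift ord0 (ord0 : 'I_2) = iy by exact/val_inj.
have -> : lift ord0 (lift ord0 (ord0 : 'I_1)) = iz by exact/val_inj.
have -> : ord0 = ix by exact/val_inj.
by rewrite /= rmorphM rmorph0 /=; ring.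
Qed.

Lemma Kmu : K mu * K mu^-1 = 1.
Proof. by rewrite -rmorphM mulfV ?rmorph1// gt_eqF. Qed.

Lemma eul_shift_solve G : exists F, Eul F + K mu * F = G /\
  (D iz G = 0 -> D iz F = 0).
Proof.
have := Dil_ode eul_wt_ge0 G; rewrite eul_wtE; set H := Dil _ G => E.
exists (K mu^-1 * H); split.
  by rewrite EulM EulK mulrA Kmu mul1r -E; ring.
by move=> Gz; rewrite DM DK D_Dil0// Gz raddf0; ring.
Qed.

Lemma eul_shift_inj F : Eul F + K mu * F = 0 -> F = 0.
Proof.
move=> E; have := Dil_inv eul_wt_ge0 F; rewrite eul_wtE.
have -> : F + K mu^-1 * Eul F = K mu^-1 * (Eul F + K mu * F).
  by rewrite [RHS]mulrDr [_ * (K mu * F)]mulrA [_ * K mu]mulrC Kmu mul1r addrC.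
by rewrite E mulr0 raddf0.
Qed.

End Shift.

(** Here n bounds how often tau can be subtracted before lam becomes negative, where averaging
    applies. Since lam < 1, the x-part has positive shift 1 - lam and is solved at once; only the
    y-part recurses. *)
Lemma eul_solve_lt1 n lam G : lam < 1 -> lam < n%:R * tau -> D iz G = 0 ->
  exists F c k, [/\ Eul F - K lam * F = G - K c * y ^+ k, D iz F = 0 &
    c = 0 \/ lam = k%:R * tau].
Proof.
have neg (lam' : R) G' : lam' < 0 -> D iz G' = 0 -> exists F c k,
    [/\ Eul F - K lam' * F = G' - K c * y ^+ k, D iz F = 0 &
    c = 0 \/ lam' = k%:R * tau].
  move=> l0 Gz; have ml0 : 0 < - lam' by rewrite oppr_gt0.
  have [F [E /(_ Gz) Fz]] := eul_shift_solve ml0 G'.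
  by exists F, 0, 0; split; [rewrite -E rmorph0 rmorphN /=; ring| |left].
elim: n lam G => [|n IH] lam G l1 ln Gz; first by apply: neg => //; rewrite mul0r in ln.
have [/neg|l0] := ltP lam 0; first exact.
have [G0 [G1 [G2 [GE _ _ _ /(_ Gz)[G0E G1z G2z]]]]] := hadamard G.
move: (ev G) G0E => e G0E.
have l1' : 0 < 1 - lam by rewrite subr_gt0.
have [F1 [E1 /(_ G1z) F1z]] := eul_shift_solve l1' G1.
have [||F2 [c [k [E2 F2z ck]]]] := IH (lam - tau) G2 _ _ G2z.
- by rewrite ltrBlDr (lt_le_trans l1)// lerDl ltW.
- by rewrite ltrBlDr (lt_le_trans ln)// -natr1 mulrDl mul1r.
have {}E2 : G2 = Eul F2 - K (lam - tau) * F2 + K c * y ^+ k.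
  by rewrite E2 subrK.
(* For lam = 0 the constant term of G is itself the resonant monomial y^0, and the y-part has no
   obstruction because -tau is not of the form k tau. *)
have [lE|ln0] := eqVneq lam 0.
  have c0 : c = 0.
    case: ck => // /eqP; rewrite lE sub0r eq_sym -subr_eq0 opprK.
    by rewrite gt_eqF// ltr_wpDl// mulr_ge0// ltW.
  exists (x * F1 + y * F2), e, 0%N; split; [|by rewrite raddfD /= !DM !DX F1z F2z /=; ring|by right; rewrite lE mul0r].
  rewrite GE G0E -E1 E2 c0 lE EulD !EulM Eulx Euly; ring.
(* For lam nonzero, E - lam maps the constant -e / lam to the constant term e. A resonance y^k of
   the y-part becomes y^(k+1). *)
exists (K (- e / lam) + (x * F1 + y * F2)), c, k.+1; split.
- have lE : K lam * K (- e / lam) = - K e.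
    by rewrite -rmorphM mulrC divfK// rmorphN.
  rewrite !EulD mulrDr lE GE G0E -E1 E2 !EulM EulK Eulx Euly exprS; ring.
- by rewrite !raddfD /= !DM !DX DK F1z F2z /=; ring.
- case: ck => [->|/eqP]; [by left|right]; apply/eqP.
  by rewrite -natr1 mulrDl mul1r -subr_eq.
Qed.

Lemma archi_tau lam : exists n : nat, lam < n%:R * tau.
Proof.
exists (Num.Def.archi_bound `|lam / tau|); rewrite -ltr_pdivrMr//.
by rewrite (le_lt_trans (ler_norm _))// archi_boundP.
Qed.

(** At lam = 0 the resonance 0 = k tau forces k = 0, so the only obstruction is a constant. *)
Lemma eul_solve0 G : D iz G = 0 ->
  exists F c, Eul F = G - K c /\ D iz F = 0.
Proof.
move=> Gz; have [n n0] := archi_tau 0.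
have [F [c [k [E Fz ck]]]] := eul_solve_lt1 ltr01 n0 Gz.
exists F, c; split=> //; move: E; rewrite rmorph0 mul0r subr0 => ->.
case: ck => [->|/esym/eqP]; first by rewrite rmorph0 mul0r.
rewrite mulf_eq0 (gt_eqF tau0) orbF pnatr_eq0 => /eqP ->.
by rewrite expr0 mulr1.
Qed.

Lemma eul_solve lam G : lam <= 1 -> D iz G = 0 ->
  exists F c1 c2 k, [/\ Eul F - K lam * F = G - K c1 * x - K c2 * y ^+ k,
    D iz F = 0, c1 = 0 \/ lam = 1 & c2 = 0 \/ lam = k%:R * tau].
Proof.
rewrite le_eqVlt => /predU1P[->{lam}|l1] Gz; last first.
  have [n ln] := archi_tau lam.
  have [F [c [k [E Fz ck]]]] := eul_solve_lt1 l1 ln Gz.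
  exists F, 0, c, k; split=> //; last by left.
  by rewrite E rmorph0; ring.
have [G0 [G1 [G2 [GE _ _ _ /(_ Gz)[G0E G1z G2z]]]]] := hadamard G.
move: (ev G) G0E => e G0E.
have [F1 [c1 [E1 F1z]]] := eul_solve0 G1z.
have [n ln] := archi_tau (1 - tau).
have l1 : 1 - tau < 1 by rewrite ltrBlDr ltrDl.
have [F2 [c [k [E2 F2z ck]]]] := eul_solve_lt1 l1 ln G2z.
have {}E2 : G2 = Eul F2 - K (1 - tau) * F2 + K c * y ^+ k by rewrite E2 subrK.
have {}E1 : G1 = Eul F1 + K c1 by rewrite E1 subrK.
(* E - 1 maps -e to e; the constant obstruction for G1 becomes a multiple of x, and y^k at level 1 -
   tau becomes y^(k+1). *)
exists (- K e + (x * F1 + y * F2)), c1, c, k.+1; split.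
- rewrite !EulD EulN GE G0E E1 E2 !EulM EulK Eulx Euly exprS; ring.
- by rewrite !raddfD raddfN /= !DM !DX DK F1z F2z /=; ring.
- by right.
- case: ck => [->|/eqP]; [by left|right]; apply/eqP.
  by rewrite -natr1 mulrDl mul1r -subr_eq.
Qed.

(** The derivatives F_x and F_y are killed by the injective operators E + 1 and E + tau. *)
Lemma eul_ker0 F : D iz F = 0 -> Eul F = 0 -> F = K (ev F).
Proof.
move=> Fz EF; apply: smfun_cst => i.
have Fx : D ix F = 0.
  apply: (@eul_shift_inj 1) => //; rewrite rmorph1 mul1r.
  by rewrite -Dx_Eul EF raddf0.
have Fy : D iy F = 0.
  by apply: (@eul_shift_inj tau) => //; rewrite -Dy_Eul EF raddf0.
by elim/ord3_ind: i.
Qed.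

(** Differentiation lowers eigenvalues: F_x has eigenvalue lam - 1 < 0 and vanishes, while F_y has
    eigenvalue lam - tau, to which induction applies. *)
Lemma eul_ker_lt1 n lam F : lam < 1 -> lam < n%:R * tau -> D iz F = 0 ->
  Eul F = K lam * F ->
  exists c k, F = K c * y ^+ k /\ (c = 0 \/ lam = k%:R * tau).
Proof.
have neg (lam' : R) F' : lam' < 0 -> Eul F' = K lam' * F' ->
    exists c k, F' = K c * y ^+ k /\ (c = 0 \/ lam' = k%:R * tau).
  move=> l0 EF; exists 0, 0%N; split; last by left.
  rewrite rmorph0 mul0r; have ml0 : 0 < - lam' by rewrite oppr_gt0.
  by apply: (eul_shift_inj ml0); rewrite EF rmorphN /=; ring.
elim: n lam F => [|n IH] lam F l1 ln Fz EF; first by apply: neg => //; rewrite mul0r in ln.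
have [/neg|l0] := ltP lam 0; first exact.
have Fx : D ix F = 0.
  apply: (@eul_shift_inj (1 - lam)); first by rewrite subr_gt0.
  have := Dx_Eul F; rewrite EF DM DK mul0r add0r => H.
  rewrite rmorphB rmorph1 /= mulrBl mul1r H; ring.
have EFy : Eul (D iy F) = K (lam - tau) * D iy F.
  have := Dy_Eul F; rewrite EF DM DK mul0r add0r rmorphB /= mulrBl => ->; ring.
have [lE|ln0] := eqVneq lam 0.
  exists (ev F), 0%N; split; last by right; rewrite lE mul0r.
  by rewrite expr0 mulr1; apply: eul_ker0 => //; rewrite EF lE rmorph0 mul0r.
have [|||c [k [FE ck]]] := IH (lam - tau) _ _ _ _ EFy.
- by rewrite ltrBlDr (lt_le_trans l1)// lerDl ltW.
- by rewrite ltrBlDr (lt_le_trans ln)// -natr1 mulrDl mul1r.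
- by rewrite DC Fz raddf0.
(* The coefficient is read off from lam F = Eul F = tau y F_y. *)
exists (tau * c / lam), k.+1; split; last first.
  case: ck => [->|/eqP]; [by left; rewrite mulr0 mul0r|right]; apply/eqP.
  by rewrite -natr1 mulrDl mul1r -subr_eq.
have LK : K lam^-1 * K lam = 1 by rewrite -rmorphM mulVf// rmorph1.
rewrite -[LHS]mul1r -LK -mulrA -EF !EulE Fx FE exprS !rmorphM /=; ring.
Qed.

(** At lam = 1 the derivative F_x lies in the kernel of E and is constant; then F = Eul F = x F_x +
    tau y F_y determines F. *)
Lemma eul_ker lam F : lam <= 1 -> D iz F = 0 -> Eul F = K lam * F ->
  exists c1 c2 k, [/\ F = K c1 * x + K c2 * y ^+ k,
    c1 = 0 \/ lam = 1 & c2 = 0 \/ lam = k%:R * tau].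
Proof.
rewrite le_eqVlt => /predU1P[->{lam}|l1] Fz EF; last first.
  have [n ln] := archi_tau lam.
  have [c [k [FE ck]]] := eul_ker_lt1 l1 ln Fz EF.
  by exists 0, c, k; split=> //; [rewrite FE rmorph0; ring|left].
rewrite rmorph1 mul1r in EF.
have Fx : D ix F = K (ev (D ix F)).
  apply: eul_ker0; first by rewrite DC Fz raddf0.
  have := Dx_Eul F; rewrite EF => H; apply: (addIr (D ix F)).
  by rewrite add0r -H.
have EFy : Eul (D iy F) = K (1 - tau) * D iy F.
  have := Dy_Eul F; rewrite EF rmorphB rmorph1 /= mulrBl mul1r => H.
  by apply: (addIr (K tau * D iy F)); rewrite -H; ring.
have [n ln] := archi_tau (1 - tau).
have l1 : 1 - tau < 1 by rewrite ltrBlDr ltrDl.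
have [|c [k [FE ck]]] := eul_ker_lt1 l1 ln _ EFy; first by rewrite DC Fz raddf0.
exists (ev (D ix F)), (tau * c), k.+1; split; [|by right|]; last first.
  case: ck => [->|/eqP]; [by left; rewrite mulr0|right]; apply/eqP.
  by rewrite -natr1 mulrDl mul1r -subr_eq.
by rewrite -[LHS]EF !EulE FE Fx exprS rmorphM /=; ring.
Qed.

End Resonance.

(** * Multivector fields in components *)

Section Components.
Variable R : realType.
Implicit Types (F G : smfun R) (i j : 'I_3) (I J : {set 'I_3}) (A B : mvect R).
Local Notation D := (@pdS R).
Local Notation K := (@cstS R).

(** Subsets of the three indices as triples of membership bits, so that identities of multivector
    fields split into eight ring identities. *)
Definition comps : Type := bool -> bool -> bool -> smfun R.
Implicit Types (c d : comps).

Definition mv c : mvect R :=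
  [ffun I : {set 'I_3} => val (c (ix \in I) (iy \in I) (iz \in I))].

Lemma mvE c I : mv c I = val (c (ix \in I) (iy \in I) (iz \in I)).
Proof. by rewrite ffunE. Qed.

Definition bset (t : bool * bool * bool) : {set 'I_3} :=
  [set i | [|| t.1.1 && (i == ix), t.1.2 && (i == iy) | t.2 && (i == iz)]].

Lemma bsetP t : (ix \in bset t, iy \in bset t, iz \in bset t) = t.
Proof.
by case: t => -[a b] e; rewrite !inE /= !andbT !andbF ?orbF ?orbT.
Qed.

Lemma set3_eq I J : (ix \in I) = (ix \in J) -> (iy \in I) = (iy \in J) ->
  (iz \in I) = (iz \in J) -> I = J.
Proof. by move=> ? ? ?; apply/setP; exact: ord3_ind. Qed.

Lemma set3_sub I J : (I \subset J) =
  [&& (ix \in I) ==> (ix \in J), (iy \in I) ==> (iy \in J)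
    & (iz \in I) ==> (iz \in J)].
Proof.
apply/fintype.subsetP/and3P => [H|[/implyP H1 /implyP H2 /implyP H3]].
  by split; apply/implyP; exact: H.
exact: ord3_ind.
Qed.

Lemma sum_ord3 (V : nmodType) (f : 'I_3 -> V) : \sum_i f i = f ix + f iy + f iz.
Proof.
rewrite !big_ord_recl big_ord0 addr0 addrA.
by congr (f _ + f _ + f _); exact/val_inj.
Qed.

Lemma card_set3 I : #|I| = ((ix \in I) + (iy \in I) + (iz \in I))%N.
Proof.
rewrite -sum1_card big_mkcond /= (sum_ord3 (fun i => if i \in I then 1%N else 0%N)).
by do 3!case: (_ \in I).
Qed.

Lemma wsign3 I J : wsign R I J = (-1) ^+
  (((iy \in I) && (ix \in J)) + ((iz \in I) && (ix \in J))
   + ((iz \in I) && (iy \in J)))%N.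
Proof.
rewrite /wsign; congr (_ ^+ _); rewrite -sum1_card big_mkcond /=.
rewrite -(pair_bigA _ (fun i j : 'I_3 => if (i, j) \in
  [pred p : 'I_3 * 'I_3 | [&& p.1 \in I, p.2 \in J & (p.2 < p.1)%N]] then 1%N else 0%N)) /=.
rewrite (sum_ord3 (fun i : 'I_3 => \sum_(j < 3) _ )%N) !(sum_ord3 (fun j : 'I_3 => if (_, j) \in _ then 1%N else 0%N)) !inE /=.
by do 3!case: (_ \in I); do 3!case: (_ \in J).
Qed.

Lemma bset_bij : bijective bset.
Proof.
exists (fun I => (ix \in I, iy \in I, iz \in I)); first exact: bsetP.
by move=> I; have [] := bsetP (ix \in I, iy \in I, iz \in I) => *; exact: set3_eq.
Qed.

(** The sum over bits a' <= a. Nested three times it runs over the subsets of a set, which makes the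
    sum in [wedge] compute. *)
Definition sum_le (V : nmodType) (a : bool) (f : bool -> V) : V :=
  if a then f true + f false else f false.

Lemma sum_set3 (V : nmodType) J (f : {set 'I_3} -> V) :
  \sum_(I : {set 'I_3} | I \subset J) f I =
  sum_le (ix \in J) (fun a => sum_le (iy \in J) (fun b =>
    sum_le (iz \in J) (fun e => f (bset (a, b, e))))).
Proof.
rewrite big_mkcond (reindex bset) /=; last exact/onW_bij/bset_bij.
rewrite -(pair_bigA _ (fun s e => if bset (s, e) \subset J then f (bset (s, e)) else 0)) /=.
rewrite -(pair_bigA _ (fun a b => \sum_e if bset (a, b, e) \subset J then f (bset (a, b, e)) else 0)) /=.
rewrite !big_bool /= !set3_sub.
have E a b e : [/\ ix \in bset (a, b, e) = a, iy \in bset (a, b, e) = b & iz \in bset (a, b, e) = e].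
  by case: (bsetP (a, b, e)).
have Ex a b e : ix \in bset (a, b, e) = a by case: (E a b e).
have Ey a b e : iy \in bset (a, b, e) = b by case: (E a b e).
have Ez a b e : iz \in bset (a, b, e) = e by case: (E a b e).
rewrite !Ex !Ey !Ez /sum_le.
by case: (ix \in J); case: (iy \in J); case: (iz \in J); rewrite /= ?addr0 ?add0r.
Qed.

Definition wedgeS c d : comps := fun a b e =>
  sum_le a (fun a' => sum_le b (fun b' => sum_le e (fun e' =>
    (-1) ^+ ((b' && (a && ~~ a')) + (e' && (a && ~~ a')) + (e' && (b && ~~ b')))%N
    * (c a' b' e' * d (a && ~~ a') (b && ~~ b') (e && ~~ e'))))).

Definition vals p (F : smfun R) : R := val F p.
Fact vals_additive p : zmod_morphism (vals p).
Proof. by []. Qed.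
Fact vals_multiplicative p : monoid_morphism (vals p).
Proof. by split. Qed.
HB.instance Definition _ p := GRing.isZmodMorphism.Build (smfun R) R (vals p) (vals_additive p).
HB.instance Definition _ p := GRing.isMonoidMorphism.Build (smfun R) R (vals p) (vals_multiplicative p).

Lemma sum_le_vals p a (f : bool -> smfun R) :
  vals p (sum_le a f) = sum_le a (fun b => vals p (f b)).
Proof. by case: a. Qed.

Lemma eq_sum_le (V : nmodType) a (f g : bool -> V) : f =1 g -> sum_le a f = sum_le a g.
Proof. by move=> fg; rewrite /sum_le !fg. Qed.

Lemma wedge_mv c d : wedge (mv c) (mv d) = mv (wedgeS c d).
Proof.
apply/ffunP => J; apply/funext => p; rewrite wedgeE sum_set3 mvE.
rewrite -[RHS]/(vals p _) /wedgeS sum_le_vals; apply: eq_sum_le => a.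
rewrite sum_le_vals; apply: eq_sum_le => b.
rewrite sum_le_vals; apply: eq_sum_le => e.
case: (bsetP (a, b, e)) => Ex Ey Ez.
rewrite wsign3 !mvE !finset.in_setD Ex Ey Ez !rmorphM rmorphXn rmorphN1 /=.
by rewrite !(andbC (~~ _)).
Qed.

Definition drightS i c : comps :=
  if i == ix then fun a b e : bool => if a then 0 else (-1) ^+ (b + e)%N * c true b e
  else if i == iy then fun a b e : bool => if b then 0 else (-1) ^+ e * c a true e
  else fun a b e : bool => if e then 0 else c a b true.

Definition dleftS i c : comps :=
  if i == ix then fun a b e : bool => if a then 0 else c true b e
  else if i == iy then fun a b e : bool => if b then 0 else (-1) ^+ a * c a true e
  else fun a b e : bool => if e then 0 else (-1) ^+ (a + b)%N * c a b true.

Lemma val_signM n F : val ((-1) ^+ n * F) = (-1) ^+ n *: val F.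
Proof.
rewrite -[in LHS]signr_odd -[in RHS]signr_odd; case: (odd n).
  by rewrite !expr1 mulN1r scaleN1r.
by rewrite !expr0 mul1r scale1r.
Qed.

Lemma dright_mv i c : dright i (mv c) = mv (drightS i c).
Proof.
apply/ffunP => J; apply/funext => p; rewrite ffunE !mvE.
elim/ord3_ind: i; rewrite /drightS /= wsign3 !inE /=.
- case: (ix \in J) => //.
  by rewrite val_signM ?andbT ?andbF ?addn0.
- case: (iy \in J) => //.
  by rewrite val_signM ?andbT ?andbF ?addn0.
- case: (iz \in J) => //.
  by rewrite ?andbF expr0 scale1r.
Qed.

Lemma dleft_mv i c : dleft i (mv c) = mv (dleftS i c).
Proof.
apply/ffunP => J; apply/funext => p; rewrite ffunE !mvE.
elim/ord3_ind: i; rewrite /dleftS /= wsign3 !inE /=.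
- case: (ix \in J) => //.
  by rewrite expr0 scale1r.
- case: (iy \in J) => //.
  by rewrite val_signM ?addn0.
- case: (iz \in J) => //.
  by rewrite val_signM.
Qed.

Definition DcS i c : comps := fun a b e => D i (c a b e).

Lemma pdm_mv i c : pdm i (mv c) = mv (DcS i c).
Proof. by apply/ffunP => J; rewrite ffunE !mvE val_pdS. Qed.

Definition schoutenS c d : comps := fun a b e =>
  (wedgeS (drightS ix c) (DcS ix d) a b e - wedgeS (DcS ix c) (dleftS ix d) a b e) +
  (wedgeS (drightS iy c) (DcS iy d) a b e - wedgeS (DcS iy c) (dleftS iy d) a b e) +
  (wedgeS (drightS iz c) (DcS iz d) a b e - wedgeS (DcS iz c) (dleftS iz d) a b e).

Lemma schouten_mv c d : schouten (mv c) (mv d) = mv (schoutenS c d).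
Proof.
rewrite /schouten (sum_ord3 (fun i => wedge _ _ - wedge _ _)).
rewrite !dright_mv !dleft_mv !pdm_mv !wedge_mv.
by apply/ffunP => J; rewrite !ffunE.
Qed.

Lemma mv_eq c d : (forall a b e, c a b e = d a b e) -> mv c = mv d.
Proof. by move=> cd; apply/ffunP => J; rewrite !mvE cd. Qed.

Lemma mv_inj c d : mv c = mv d -> forall a b e, c a b e = d a b e.
Proof.
move=> /ffunP E a b e; have := E (bset (a, b, e)); rewrite !mvE.
by case: (bsetP (a, b, e)) => -> -> -> /val_inj.
Qed.

Lemma mv_surj A : (forall I, smooth (A I)) -> exists c, A = mv c.
Proof.
move=> sA; exists (fun a b e => mksmfun (sA (bset (a, b, e)))).
apply/ffunP => J; rewrite mvE /=; congr (A _).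
by case: (bsetP (ix \in J, iy \in J, iz \in J)) => *; exact: set3_eq.
Qed.

Lemma smooth_mv c I : smooth (mv c I).
Proof. by rewrite mvE; exact: smfunP. Qed.

End Components.

(** * Wedge and bracket formulas degree by degree *)

Section Graded.
Variable R : realType.
Implicit Types (F G : smfun R) (i j : 'I_3) (I J : {set 'I_3}) (A B : mvect R).
Local Notation D := (@pdS R).
Local Notation K := (@cstS R).
Local Notation x := (@varS R ix).
Local Notation y := (@varS R iy).

Definition M0 F : mvect R := mv (fun a b e => match a, b, e with
  false, false, false => F | _, _, _ => 0 end).
Definition M1 F G H : mvect R := mv (fun a b e => match a, b, e with
  true, false, false => F | false, true, false => G | false, false, true => H
  | _, _, _ => 0 end).
Definition M2 F G H : mvect R := mv (fun a b e => match a, b, e with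
  true, true, false => F | true, false, true => G | false, true, true => H
  | _, _, _ => 0 end).
Definition M3 F : mvect R := mv (fun a b e => match a, b, e with
  true, true, true => F | _, _, _ => 0 end).

Definition vd (a b c : smfun R) F : smfun R := a * D ix F + b * D iy F + c * D iz F.

Ltac component_cases := let a := fresh in let b := fresh in let e := fresh in
  apply: mv_eq => a b e; case: a; case: b; case: e;
  rewrite /schoutenS /wedgeS /drightS /dleftS /DcS /sum_le /= ?raddf0.

Lemma mv0 : mv (fun _ _ _ => 0 : smfun R) = 0.
Proof. by apply/ffunP => J; rewrite [RHS]ffunE mvE. Qed.

Lemma wedge11 a b c a' b' c' : wedge (M1 a b c) (M1 a' b' c') =
  M2 (a * b' - b * a') (a * c' - c * a') (b * c' - c * b').
Proof. by rewrite wedge_mv; component_cases; ring. Qed.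

Lemma wedge0l F A c : A = mv c -> wedge (M0 F) A = mv (fun a b e => F * c a b e).
Proof. by move=> ->; rewrite wedge_mv; component_cases; ring. Qed.

Lemma wedge0r F A c : A = mv c -> wedge A (M0 F) = mv (fun a b e => F * c a b e).
Proof. by move=> ->; rewrite wedge_mv; component_cases; ring. Qed.

Lemma wedge12 a b c u v w : wedge (M1 a b c) (M2 u v w) =
  M3 (a * w - b * v + c * u).
Proof. by rewrite wedge_mv; component_cases; ring. Qed.

Lemma wedge21 a b c u v w : wedge (M2 u v w) (M1 a b c) =
  M3 (a * w - b * v + c * u).
Proof. by rewrite wedge_mv; component_cases; ring. Qed.

Lemma schouten11 a b c a' b' c' : schouten (M1 a b c) (M1 a' b' c') =
  M1 (vd a b c a' - vd a' b' c' a) (vd a b c b' - vd a' b' c' b)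
     (vd a b c c' - vd a' b' c' c).
Proof. by rewrite schouten_mv; component_cases; rewrite ?/vd; ring. Qed.

Lemma schouten12 a b c u v w : schouten (M1 a b c) (M2 u v w) =
  M2 (vd a b c u - (u * D ix a - w * D iz a + u * D iy b + v * D iz b))
     (vd a b c v - (v * D ix a + w * D iy a + u * D iy c + v * D iz c))
     (vd a b c w - (v * D ix b + w * D iy b - u * D ix c + w * D iz c)).
Proof. by rewrite schouten_mv; component_cases; rewrite ?/vd; ring. Qed.

Lemma schouten21 a b c u v w : schouten (M2 u v w) (M1 a b c) =
  M2 (- vd a b c u + (u * D ix a - w * D iz a + u * D iy b + v * D iz b))
     (- vd a b c v + (v * D ix a + w * D iy a + u * D iy c + v * D iz c))
     (- vd a b c w + (v * D ix b + w * D iy b - u * D ix c + w * D iz c)).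
Proof. by rewrite schouten_mv; component_cases; rewrite ?/vd; ring. Qed.

Lemma schouten20 F u v w : schouten (M2 u v w) (M0 F) =
  M1 (u * D iy F + v * D iz F) (- u * D ix F + w * D iz F) (- v * D ix F - w * D iy F).
Proof. by rewrite schouten_mv; component_cases; ring. Qed.

Lemma schouten02 F u v w : schouten (M0 F) (M2 u v w) =
  M1 (u * D iy F + v * D iz F) (- u * D ix F + w * D iz F) (- v * D ix F - w * D iy F).
Proof. by rewrite schouten_mv; component_cases; ring. Qed.

Lemma schouten22 u v w u' v' w' : schouten (M2 u v w) (M2 u' v' w') =
  M3 (u * D ix v' - v * D ix u' - (D ix u * v' - D ix v * u')
    + u * D iy w' - w * D iy u' - (D iy u * w' - D iy w * u')
    + v * D iz w' - w * D iz v' - (D iz v * w' - D iz w * v')).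
Proof. by rewrite schouten_mv; component_cases; ring. Qed.

Lemma schouten10 F a b c : schouten (M1 a b c) (M0 F) = M0 (vd a b c F).
Proof. by rewrite schouten_mv; component_cases; rewrite ?/vd; ring. Qed.

Lemma schouten_cstl r (c : comps R) : schouten (M0 (K r)) (mv c) = 0.
Proof. by rewrite -mv0 schouten_mv; component_cases; rewrite ?DK; ring. Qed.

Lemma schouten_cstr r (c : comps R) : schouten (mv c) (M0 (K r)) = 0.
Proof. by rewrite -mv0 schouten_mv; component_cases; rewrite ?DK; ring. Qed.

Lemma mvfield0P A : is_mvfield 0 A -> exists F, A = M0 F.
Proof.
move=> [/mv_surj[c ->] H]; exists (c false false false); apply: mv_eq => a b e.
have := H (bset (a, b, e)); rewrite mvE card_set3.
case: (bsetP (a, b, e)) => -> -> -> => {}H; apply/val_inj.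
by case: a b e H => -[] [] H //; rewrite H.
Qed.

Lemma mvfield1P A : is_mvfield 1 A -> exists F G H, A = M1 F G H.
Proof.
move=> [/mv_surj[c ->] H]; exists (c true false false), (c false true false),
  (c false false true); apply: mv_eq => a b e.
have := H (bset (a, b, e)); rewrite mvE card_set3.
case: (bsetP (a, b, e)) => -> -> -> => {}H; apply/val_inj.
by case: a b e H => -[] [] H //; rewrite H.
Qed.

Lemma mvfield2P A : is_mvfield 2 A -> exists F G H, A = M2 F G H.
Proof.
move=> [/mv_surj[c ->] H]; exists (c true true false), (c true false true),
  (c false true true); apply: mv_eq => a b e.
have := H (bset (a, b, e)); rewrite mvE card_set3.
case: (bsetP (a, b, e)) => -> -> -> => {}H; apply/val_inj.
by case: a b e H => -[] [] H //; rewrite H.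
Qed.

Lemma mvfield3P A : is_mvfield 3 A -> exists F, A = M3 F.
Proof.
move=> [/mv_surj[c ->] H]; exists (c true true true); apply: mv_eq => a b e.
have := H (bset (a, b, e)); rewrite mvE card_set3.
case: (bsetP (a, b, e)) => -> -> -> => {}H; apply/val_inj.
by case: a b e H => -[] [] H //; rewrite H.
Qed.

Lemma mvfield_gt3 k A : (3 < k)%N -> is_mvfield k A -> A = 0.
Proof.
move=> k3 [_ H]; apply/ffunP => I; rewrite H ?ffunE//.
by rewrite neq_ltn (leq_ltn_trans _ k3)// (leq_trans (max_card _))// card_ord.
Qed.

Lemma mv_mvfield k (c : comps R) :
  (forall a b e : bool, (a + b + e)%N != k -> c a b e = 0) -> is_mvfield k (mv c).
Proof.
move=> H; split=> I; first exact: smooth_mv.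
by rewrite card_set3 mvE => /H ->.
Qed.

Lemma M0_mvfield F : is_mvfield 0 (M0 F).
Proof. by apply: mv_mvfield => -[] [] []. Qed.

Lemma M1_mvfield F G H : is_mvfield 1 (M1 F G H).
Proof. by apply: mv_mvfield => -[] [] []. Qed.

Lemma M2_mvfield F G H : is_mvfield 2 (M2 F G H).
Proof. by apply: mv_mvfield => -[] [] []. Qed.

Lemma M0_inj F F' : M0 F = M0 F' -> F = F'.
Proof. by move=> /mv_inj/(_ false false false). Qed.

Lemma M1_inj F G H F' G' H' : M1 F G H = M1 F' G' H' ->
  [/\ F = F', G = G' & H = H'].
Proof.
move=> /mv_inj E; split; [exact: (E true false false)|
  exact: (E false true false)|exact: (E false false true)].
Qed.

Lemma M2_inj F G H F' G' H' : M2 F G H = M2 F' G' H' ->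
  [/\ F = F', G = G' & H = H'].
Proof.
move=> /mv_inj E; split; [exact: (E true true false)|
  exact: (E true false true)|exact: (E false true true)].
Qed.

Lemma M3_inj F F' : M3 F = M3 F' -> F = F'.
Proof. by move=> /mv_inj/(_ true true true). Qed.

Lemma M0_0 : M0 0 = 0. Proof. by rewrite -mv0; apply: mv_eq => -[] [] []. Qed.
Lemma M1_0 : M1 0 0 0 = 0. Proof. by rewrite -mv0; apply: mv_eq => -[] [] []. Qed.
Lemma M2_0 : M2 0 0 0 = 0. Proof. by rewrite -mv0; apply: mv_eq => -[] [] []. Qed.
Lemma M3_0 : M3 0 = 0. Proof. by rewrite -mv0; apply: mv_eq => -[] [] []. Qed.

Lemma mv_lin r (c d : comps R) :
  r *: mv c + mv d = mv (fun a b e => K r * c a b e + d a b e).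
Proof. by apply/ffunP => J; apply/funext => p; rewrite mvect_linE !mvE. Qed.

Lemma M0_lin r F F' : r *: M0 F + M0 F' = M0 (K r * F + F').
Proof. by rewrite mv_lin; apply: mv_eq => -[] [] [] //; rewrite mulr0 addr0. Qed.

Lemma M1_lin r F G H F' G' H' : r *: M1 F G H + M1 F' G' H' =
  M1 (K r * F + F') (K r * G + G') (K r * H + H').
Proof. by rewrite mv_lin; apply: mv_eq => -[] [] [] //; rewrite mulr0 addr0. Qed.

Lemma M2_lin r F G H F' G' H' : r *: M2 F G H + M2 F' G' H' =
  M2 (K r * F + F') (K r * G + G') (K r * H + H').
Proof. by rewrite mv_lin; apply: mv_eq => -[] [] [] //; rewrite mulr0 addr0. Qed.

End Graded.

(** * Cohomology classes *)

Section Degrees.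
Variable R : realType.
Implicit Types (A B : mvect R) (I J : {set 'I_3}).

Lemma wedge_mvfield k l A B : is_mvfield k A -> is_mvfield l B ->
  is_mvfield (k + l) (wedge A B).
Proof.
move=> [sA dA] [sB dB]; split=> [I|J Jkl].
  have [c ->] := mv_surj sA; have [d ->] := mv_surj sB.
  rewrite wedge_mv; exact: smooth_mv.
apply/funext => p; rewrite wedgeE big1// => I IJ.
have JE : (#|I| + #|J :\: I| = #|J|)%N.
  by rewrite -(cardsID I J) (finset.setIidPr IJ).
have [Ik|Ik] := eqVneq #|I| k; last by rewrite dA// mul0r mulr0.
rewrite dB ?mulr0// -(eqn_add2l #|I|) JE Ik; exact: Jkl.
Qed.

Lemma mvfield_sub k A B : is_mvfield k A -> is_mvfield k B -> is_mvfield k (A - B).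
Proof. by move=> mA mB; rewrite -scaleN1r addrC; exact: is_mvfield_lin. Qed.

Lemma mvfield_add k A B : is_mvfield k A -> is_mvfield k B -> is_mvfield k (A + B).
Proof. by move=> mA mB; rewrite -[A]scale1r; exact: is_mvfield_lin. Qed.

Lemma pdm_mvfield i k A : is_mvfield k A -> is_mvfield k (pdm i A).
Proof.
move=> [sA dA]; split=> I => [|kI]; rewrite ffunE; first exact: smooth_pd.
by rewrite dA//; apply/funext => p; exact: derive_cst.
Qed.

Lemma dright_mvfield i k A : is_mvfield k.+1 A -> is_mvfield k (dright i A).
Proof.
move=> [sA dA]; split=> I => [|kI].
  have [c ->] := mv_surj sA; rewrite dright_mv; exact: smooth_mv.
rewrite ffunE; case: ifPn => // iI.
by rewrite dA ?scaler0// cardsU1 iI add1n eqSS.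
Qed.

Lemma dleft_mvfield i k A : is_mvfield k.+1 A -> is_mvfield k (dleft i A).
Proof.
move=> [sA dA]; split=> I => [|kI].
  have [c ->] := mv_surj sA; rewrite dleft_mv; exact: smooth_mv.
rewrite ffunE; case: ifPn => // iI.
by rewrite dA ?scaler0// cardsU1 iI add1n eqSS.
Qed.

Lemma dright_mvfield0 i A : is_mvfield 0 A -> dright i A = 0.
Proof.
move=> [_ dA]; apply/ffunP => I; rewrite !ffunE; case: ifPn => // iI.
by rewrite dA ?scaler0// cardsU1 iI.
Qed.

Lemma dleft_mvfield0 i A : is_mvfield 0 A -> dleft i A = 0.
Proof.
move=> [_ dA]; apply/ffunP => I; rewrite !ffunE; case: ifPn => // iI.
by rewrite dA ?scaler0// cardsU1 iI.
Qed.

Lemma wedge0mv A : wedge 0 A = 0.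
Proof.
apply/ffunP => J; apply/funext => p; rewrite wedgeE big1 ?ffunE// => I _.
by rewrite ffunE mul0r mulr0.
Qed.

Lemma wedgemv0 A : wedge A 0 = 0.
Proof.
apply/ffunP => J; apply/funext => p; rewrite wedgeE big1 ?ffunE// => I _.
by rewrite ffunE !mulr0.
Qed.

Lemma schouten_mvfield k l A B : is_mvfield k A -> is_mvfield l B ->
  is_mvfield (k + l).-1 (schouten A B).
Proof.
move=> mA mB; rewrite /schouten.
apply: (big_ind (is_mvfield (k + l).-1)); first exact: is_mvfield0.
  exact: mvfield_add.
move=> i _; apply: mvfield_sub.
  (* In degree 0 the derivative in an odd variable vanishes, so the truncated predecessor in the
     degree does no harm. *)
  case: k mA => [|k] mA.
    by rewrite dright_mvfield0// wedge0mv; exact: is_mvfield0.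
  by apply: wedge_mvfield; [exact: dright_mvfield|exact: pdm_mvfield].
case: l mB => [|l] mB.
  by rewrite dleft_mvfield0// wedgemv0; exact: is_mvfield0.
by rewrite addnS; apply: wedge_mvfield; [exact: pdm_mvfield|exact: dleft_mvfield].
Qed.

End Degrees.

(** * Cohomology classes through representatives *)

Section Classes.
Variables (R : realType) (P : mvect R).
Implicit Types (A B : mvect R) (k l : nat).

Definition is_cocycle k A : Prop := is_mvfield k A /\ schouten P A = 0.

Lemma cocycleP k A : reflect (is_cocycle k A) (A \in cocycles P k).
Proof. exact: asboolP. Qed.

Lemma cocycle_valP k (c : cocycle P k) : is_cocycle k (val c).
Proof. exact/cocycleP/(valP c). Qed.

Definition mkcocycle k A (cA : is_cocycle k A) : cocycle P k :=
  Cocycle (introT (cocycleP k A) cA).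

Lemma class_eq k (c c' : cocycle P k) :
  class c = class c' <-> is_coboundary P k (val c - val c').
Proof.
rewrite /class; split=> [/lquot_piE/asboolP|H]; first by rewrite raddfB.
by apply/lquot_piE/asboolP; rewrite raddfB.
Qed.

Lemma class_surj k (h : cohomology P k) : exists c : cocycle P k, class c = h.
Proof. by eexists; exact: lquot_pi_repr. Qed.

Lemma classD k (c c' : cocycle P k) : class (c + c') = class c + class c'.
Proof. exact: lquot_piD. Qed.

Lemma classZ k r (c : cocycle P k) : class (r *: c) = r *: class c.
Proof. by rewrite /class -lquot_piZ. Qed.

Lemma class0 k : class (0 : cocycle P k) = 0.
Proof. by apply: (addrI (class 0)); rewrite -classD !addr0. Qed.

Lemma class_sum k n (F : 'I_n -> cocycle P k) :
  class (\sum_i F i) = \sum_i class (F i).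
Proof. exact: (big_morph _ (@classD k) (class0 k)). Qed.

Lemma represents0 k A : is_mvfield k A -> schouten P A = 0 ->
  is_coboundary P k A -> represents A (0 : cohomology P k).
Proof.
move=> mA cA bA; exists (mkcocycle (conj mA cA)) => //.
by rewrite -class0; apply/class_eq; rewrite /= subr0.
Qed.

(** Moves generation and independence from the quotient to representatives modulo coboundaries.
    Coefficients are functions on [nat], free of the dependent index type of [is_basis]. *)
Lemma basis_criterion k (s : seq (mvect R)) :
    (forall A, A \in s -> is_cocycle k A) ->
    (forall A, is_cocycle k A -> exists c : nat -> R,
      is_coboundary P k (A - \sum_(i < size s) c i *: nth 0 s i)) ->
    (forall c : nat -> R,
      is_coboundary P k (\sum_(i < size s) c i *: nth 0 s i) ->
      forall i, (i < size s)%N -> c i = 0) ->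
  basis_of_classes P k s.
Proof.
move=> coc gen ind.
have [cs csE] : exists cs : seq (cocycle P k), [seq val w | w <- cs] = s.
  elim: s coc {gen ind} => [|A s IH] coc; first by exists [::].
  have [|cs <-] := IH; first by move=> B Bs; apply: coc; rewrite inE Bs orbT.
  by exists (mkcocycle (coc A (mem_head _ _)) :: cs).
exists cs => // v.
have sz : size [seq class w | w <- cs] = size s by rewrite size_map -csE size_map.
pose lift (c : nat -> R) : cocycle P k := \sum_(i < size s) c i *: nth 0 cs i.
have liftE c : val (lift c) = \sum_(i < size s) c i *: nth 0 s i.
  rewrite /lift raddf_sum /=; apply: eq_bigr => i _.
  have icS : (i < size cs)%N by rewrite -(size_map val cs) csE ltn_ord.
  by move: (nat_of_ord i) icS => j jcs; rewrite -csE (nth_map 0).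
have sumE (c : nat -> R) :
    \sum_(i < size [seq class w | w <- cs]) c i *: tnth (in_tuple [seq class w | w <- cs]) i =
    class (lift c).
  rewrite class_sum -(big_mkord xpredT (fun i => class (c i *: nth 0 cs i))) -sz big_mkord.
  apply: eq_bigr => i _; rewrite classZ (tnth_nth 0) (nth_map 0)//.
  by rewrite -(size_map (@class _ _ _) cs) ltn_ord.
have [w wv] := class_surj v.
have [c cP] := gen _ (cocycle_valP w).
have ext n (f : {ffun 'I_n -> R}) : exists g : nat -> R, forall i : 'I_n, f i = g i.
  by exists (fun i => if insub i is Some j then f j else 0) => i; rewrite valK.
exists [ffun i => c (nat_of_ord i)]; split.
  under eq_bigr => i _ do rewrite ffunE.
  by rewrite sumE -wv; apply/class_eq; rewrite liftE.
move=> f; have [g fg] := ext _ f.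
under eq_bigr => i _ do rewrite fg.
rewrite sumE -wv => /class_eq; rewrite liftE => gP.
(* Two expansions of the same class differ by a combination that is a coboundary, so independence
   applies to the difference of their coefficients. *)
apply/ffunP => i; rewrite ffunE fg; apply/eqP; rewrite -subr_eq0.
apply/eqP/(ind (fun i => c i - g i)); last by rewrite -sz.
have diffE (W Y Z : mvect R) : -1 *: (W - Y) + (W - Z) = Y - Z.
  by rewrite scaleN1r opprB addrA subrK.
have sumB : \sum_(j < size s) c j *: nth 0 s j - \sum_(j < size s) g j *: nth 0 s j
  = \sum_(j < size s) (c j - g j) *: nth 0 s j.
  by rewrite -sumrB; apply: eq_bigr => j _; rewrite scalerBl.
by have := is_coboundary_lin (-1) cP gP; rewrite diffE sumB.
Qed.

(** The operation on classes is defined by chosen representatives; the choice is changed in one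
    argument at a time, and the two changes add up. *)
Lemma induces_op_criterion (op : mvect R -> mvect R -> mvect R) deg :
    (forall k l A B, is_cocycle k A -> is_cocycle l B ->
      is_cocycle (deg k l) (op A B)) ->
    (forall k l A A' B, is_cocycle k A -> is_cocycle k A' -> is_cocycle l B ->
      is_coboundary P k (A - A') ->
      is_coboundary P (deg k l) (op A B - op A' B)) ->
    (forall k l A B B', is_cocycle k A -> is_cocycle l B -> is_cocycle l B' ->
      is_coboundary P l (B - B') ->
      is_coboundary P (deg k l) (op A B - op A B')) ->
  induces_op P op deg.
Proof.
move=> opC opL opR k l.
pose rep m (h : cohomology P m) := sval (cid (class_surj h)).
have repE m (h : cohomology P m) : class (rep m h) = h by exact: (svalP (cid (class_surj h))).
exists (fun a b => class (mkcocycle (opC k l _ _ (cocycle_valP (rep k a))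
  (cocycle_valP (rep l b))))).
move=> _ _ a b [A <- Aa] [B <- Bb].
exists (mkcocycle (opC _ _ _ _ (cocycle_valP A) (cocycle_valP B))) => //.
apply/class_eq => /=.
have cA : is_coboundary P k (val A - val (rep k a)).
  by apply/class_eq; rewrite repE.
have cB : is_coboundary P l (val B - val (rep l b)).
  by apply/class_eq; rewrite repE.
have L := opL k l _ _ _ (cocycle_valP A) (cocycle_valP (rep k a)) (cocycle_valP B) cA.
have Rr := opR k l _ _ _ (cocycle_valP (rep k a)) (cocycle_valP B) (cocycle_valP (rep l b)) cB.
by have := is_coboundary_lin 1 L Rr; rewrite scale1r subrKA.
Qed.

End Classes.

(** * The Poisson complex *)

Section Complex.
Variable R : realType.
Variable tau : R.
Implicit Types (F G : smfun R) (i j : 'I_3) (I J : {set 'I_3}) (A B : mvect R).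
Local Notation D := (@pdS R).
Local Notation K := (@cstS R).
Local Notation x := (@varS R ix).
Local Notation y := (@varS R iy).
Local Notation z := (@varS R iz).
Local Notation P := (pi_tau tau).
Local Notation Eul := (@Eul R tau).

Lemma set3_eq1 J i : (J == [set i]) =
  [&& (ix \in J) == (ix == i), (iy \in J) == (iy == i) & (iz \in J) == (iz == i)].
Proof.
apply/eqP/and3P => [->|[/eqP Jx /eqP Jy /eqP Jz]]; first by rewrite !inE !eqxx.
by apply: set3_eq; rewrite !inE ?Jx ?Jy ?Jz.
Qed.

Lemma ddxE F : ddx (val F) = M1 F 0 0.
Proof.
apply/ffunP => J; rewrite ffunE mvE set3_eq1 /=.
by case: (ix \in J); case: (iy \in J); case: (iz \in J).
Qed.

Lemma ddyE F : ddy (val F) = M1 0 F 0.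
Proof.
apply/ffunP => J; rewrite ffunE mvE set3_eq1 /=.
by case: (ix \in J); case: (iy \in J); case: (iz \in J).
Qed.

Lemma ddzE F : ddz (val F) = M1 0 0 F.
Proof.
apply/ffunP => J; rewrite ffunE mvE set3_eq1 /=.
by case: (ix \in J); case: (iy \in J); case: (iz \in J).
Qed.

Lemma scalE F : scal (val F) = M0 F.
Proof.
apply/ffunP => J; rewrite ffunE mvE.
have -> : (J == finset.set0) = [&& ~~ (ix \in J), ~~ (iy \in J) & ~~ (iz \in J)].
  apply/eqP/and3P => [->|[/negbTE Jx /negbTE Jy /negbTE Jz]]; first by rewrite !inE.
  by apply: set3_eq; rewrite !inE.
by case: (ix \in J); case: (iy \in J); case: (iz \in J).
Qed.

Lemma M1Z r F G H : r *: M1 F G H = M1 (K r * F) (K r * G) (K r * H).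
Proof. by rewrite -[LHS]addr0 -M1_0 M1_lin !addr0. Qed.

Lemma M1D F G H F' G' H' : M1 F G H + M1 F' G' H' = M1 (F + F') (G + G') (H + H').
Proof. by rewrite -[M1 F G H]scale1r M1_lin rmorph1 !mul1r. Qed.

Lemma M1B F G H F' G' H' : M1 F G H - M1 F' G' H' = M1 (F - F') (G - G') (H - H').
Proof.
by rewrite addrC -scaleN1r M1_lin rmorphN1; congr M1; rewrite mulN1r addrC.
Qed.

Lemma M2Z r F G H : r *: M2 F G H = M2 (K r * F) (K r * G) (K r * H).
Proof. by rewrite -[LHS]addr0 -M2_0 M2_lin !addr0. Qed.

Lemma M2D F G H F' G' H' : M2 F G H + M2 F' G' H' = M2 (F + F') (G + G') (H + H').
Proof. by rewrite -[M2 F G H]scale1r M2_lin rmorph1 !mul1r. Qed.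

Lemma M2B F G H F' G' H' : M2 F G H - M2 F' G' H' = M2 (F - F') (G - G') (H - H').
Proof.
by rewrite addrC -scaleN1r M2_lin rmorphN1; congr M2; rewrite mulN1r addrC.
Qed.

Lemma M0Z r F : r *: M0 F = M0 (K r * F).
Proof. by rewrite -[LHS]addr0 -M0_0 M0_lin !addr0. Qed.

Lemma eulerE t : euler t = M1 x (K t * y) 0.
Proof.
rewrite /euler -[@cx R]/(val x) -[@cy R]/(val y) ddxE ddyE M1Z M1D.
by rewrite !mulr0 !addr0 add0r.
Qed.

Lemma dzE : dz R = M1 0 0 1.
Proof. by rewrite /dz -[cst 1]/(val (1 : smfun R)) ddzE. Qed.

Lemma wedge_dz F G H : wedge (M1 F G H) (dz R) = M2 0 F G.
Proof. by rewrite dzE wedge11; congr M2; ring. Qed.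

Lemma pi_tauE : P = M2 0 x (K tau * y).
Proof. by rewrite /pi_tau eulerE wedge_dz. Qed.

Lemma d0E F : schouten P (M0 F) = M1 (x * D iz F) (K tau * y * D iz F) (- Eul F).
Proof. by rewrite pi_tauE schouten20 !EulE; congr M1; ring. Qed.

Lemma d1E a b c : schouten P (M1 a b c) = M2 (x * D iz b - K tau * y * D iz a)
  (Eul a - a + x * D iz c) (Eul b - K tau * b + K tau * y * D iz c).
Proof.
by rewrite pi_tauE schouten21 /vd !EulE !DM !DX !DK raddf0 /=; congr M2; ring.
Qed.

Lemma d2E u v w : schouten P (M2 u v w) = M3 (- Eul u + K (1 + tau) * u
  + x * D iz w - K tau * y * D iz v).
Proof.
rewrite pi_tauE schouten22 !EulE !DM !DX !DK raddf0 /=; congr M3; ring.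
Qed.

Lemma pi_mvfield : is_mvfield 2 P.
Proof. by rewrite pi_tauE; exact: M2_mvfield. Qed.

Lemma d3E k A : (2 < k)%N -> is_mvfield k A -> schouten P A = 0.
Proof.
move=> k2 mA; apply: (@mvfield_gt3 _ (2 + k).-1); first by case: k k2 {mA} => //= k.
exact: schouten_mvfield pi_mvfield mA.
Qed.

Lemma pi_poisson : is_poisson P.
Proof.
split; first exact: pi_mvfield.
rewrite {2}pi_tauE d2E -M3_0 !EulE !DM !DX !DK raddf0 /=; congr M3; ring.
Qed.

Lemma cocycle1P a b c : is_cocycle P 1 (M1 a b c) <->
  [/\ x * D iz b = K tau * y * D iz a, Eul a - a + x * D iz c = 0 &
    Eul b - K tau * b + K tau * y * D iz c = 0].
Proof.
rewrite /is_cocycle d1E -M2_0; split=> [[_ /M2_inj[/eqP]]|[E1 E2 E3]].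
  by rewrite subr_eq0 => /eqP.
by split; [exact: M1_mvfield|rewrite E1 E2 E3 subrr].
Qed.

Lemma cocycle2P u v w : is_cocycle P 2 (M2 u v w) <->
  - Eul u + K (1 + tau) * u + x * D iz w - K tau * y * D iz v = 0.
Proof.
rewrite /is_cocycle d2E -M3_0; split=> [[_ /M3_inj]//|->].
by split => //; exact: M2_mvfield.
Qed.

Lemma coboundary1P A : is_coboundary P 1 A <->
  exists F, A = M1 (x * D iz F) (K tau * y * D iz F) (- Eul F).
Proof.
split=> [[B mB ->]|[F ->]].
  by have [F ->] := mvfield0P mB; exists F; rewrite d0E.
by exists (M0 F); [exact: M0_mvfield|rewrite d0E].
Qed.

Lemma coboundary2P A : is_coboundary P 2 A <-> exists a b c,
  A = M2 (x * D iz b - K tau * y * D iz a)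
    (Eul a - a + x * D iz c) (Eul b - K tau * b + K tau * y * D iz c).
Proof.
split=> [[B mB ->]|[a [b [c ->]]]].
  by have [a [b [c ->]]] := mvfield1P mB; exists a, b, c; rewrite d1E.
by exists (M1 a b c); [exact: M1_mvfield|rewrite d1E].
Qed.

Lemma coboundary_k3 k A : 0 < tau -> (2 < k)%N -> is_mvfield k A ->
  is_coboundary P k A.
Proof.
move=> tau0 k2 mA; have [k3|k3] := ltnP 3 k.
  by rewrite (mvfield_gt3 k3 mA); exact: is_coboundary0.
have {k2 k3} kE : k = 3 by apply/eqP; rewrite eqn_leq k2 k3.
rewrite kE in mA *; have [F ->] := mvfield3P mA.
have [G0 [G1 [G2 [FE Gx Gy _ _]]]] := hadamard F.
have [w wE] := antiderivative iz G1; have [v vE] := antiderivative iz G2.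
have t1 : K (1 + tau) * K (1 + tau)^-1 = 1.
  by rewrite -rmorphM mulfV ?rmorph1// gt_eqF// addr_gt0.
have t2 : K tau * K (- tau^-1) = -1.
  by rewrite -rmorphM mulrN mulfV ?rmorphN1// gt_eqF.
(* In [d2E] the function G0(z) is killed by E and comes from (1 + tau) u, while x G1 and y G2 come
   from x w_z and -tau y v_z. *)
exists (M2 (K (1 + tau)^-1 * G0) (K (- tau^-1) * v) w); first exact: M2_mvfield.
rewrite d2E {1}FE; congr M3; rewrite !EulE !DM !DK Gx Gy vE wE.
transitivity ((K (1 + tau) * K (1 + tau)^-1) * G0 + x * G1
  - (K tau * K (- tau^-1)) * (y * G2)); first by rewrite t1 t2; ring.
by move: (K (1 + tau)^-1) (K (- tau^-1)) => *; ring.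
Qed.

End Complex.

(** * Spanning and independence in degree 1 *)

Section Spans.
Variable R : realType.
Variable tau : R.
Hypotheses (tau0 : 0 < tau) (tau1 : tau <= 1).
Implicit Types (F G : smfun R) (i j : 'I_3) (I J : {set 'I_3}) (A B : mvect R).
Local Notation D := (@pdS R).
Local Notation K := (@cstS R).
Local Notation x := (@varS R ix).
Local Notation y := (@varS R iy).
Local Notation z := (@varS R iz).
Local Notation P := (pi_tau tau).
Local Notation Eul := (@Eul R tau).

Lemma DD i F G : D i (F + G) = D i F + D i G.
Proof. exact: raddfD. Qed.

Lemma DN i F : D i (- F) = - D i F.
Proof. exact: raddfN. Qed.

Lemma D0 i : D i 0 = 0.
Proof. exact: raddf0. Qed.

Lemma KV r : r != 0 -> K r * K r^-1 = 1.
Proof. by move=> r0; rewrite -rmorphM mulfV ?rmorph1. Qed.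

Lemma casimirP F : schouten P (M0 F) = 0 <-> exists c, F = K c.
Proof.
rewrite d0E -M1_0; split=> [/M1_inj[/X_reg Fz _ /eqP]|[c ->]].
  by rewrite oppr_eq0 => /eqP EF; exists (ev F); exact: (eul_ker0 tau0).
by rewrite EulK !DK; congr M1; ring.
Qed.

(** x and y form a regular sequence: on x = 0 the equation gives y u = 0, so u vanishes there and is
    divisible by x; then x cancels. *)
Lemma division u v : x * v = K tau * y * u ->
  exists g, u = x * g /\ v = K tau * y * g.
Proof.
move=> E; have uR : Res ix u = 0.
  apply: (@X_reg R iy); apply: (@X_reg R ix).
  have := congr1 (Res ix) E.
  rewrite !ResM ResK !ResX eqxx !mul0r /= mul1r => /esym E'.
  have tK : K tau^-1 * K tau = 1 by rewrite mulrC KV// gt_eqF.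
  by rewrite -[y * _]mul1r -tK -mulrA [K tau * _]mulrA E' !mulr0.
have uE := Taylor ix u; rewrite uR add0r in uE.
exists (Mean ix (D ix u)); split=> //.
have /eqP := E; rewrite -subr_eq0 {1}uE.
rewrite (_ : _ - _ = x * (v - K tau * y * Mean ix (D ix u))); last by ring.
by move=> /eqP /X_reg /eqP; rewrite subr_eq0 => /eqP.
Qed.

(** The diagonal field c1 x d/dx + c4 y d/dy is e E_{-1} + b E. The determinant of this change of
    basis is 1 + tau, up to sign, and the E-part is exact. *)
Lemma diag_split (c1 c4 : R) : exists e b,
  c1 = e + b /\ c4 = - e + tau * b.
Proof.
have t0 : 1 + tau != 0 by rewrite gt_eqF// addr_gt0.
exists (c1 - (c1 + c4) / (1 + tau)), ((c1 + c4) / (1 + tau)).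
by split; field.
Qed.

(** In the d/dy component the resonance tau = k tau leaves only k = 1, so the diagonal terms x d/dx
    and y d/dy can be regrouped along E_{-1} and E. *)
Lemma normal_form (a b : smfun R) c1 r n q c4 k :
  a = K c1 * x + K r * y ^+ n ->
  b = K q * x + K c4 * y ^+ k -> (c4 = 0 \/ tau = k%:R * tau) ->
  exists e d, a = K e * x + K r * y ^+ n + K d * x /\
    b = - K e * y + K q * x + K tau * y * K d.
Proof.
move=> aE bE ck; have {}bE : b = K q * x + K c4 * y.
  case: ck bE => [->|ck] ->; first by rewrite rmorph0 !mul0r.
  move/eqP: ck; rewrite -subr_eq0 -{1}[tau]mul1r -mulrBl mulf_eq0 (gt_eqF tau0) orbF.
  by rewrite subr_eq0 eq_sym pnatr_eq1 => /eqP ->; rewrite expr1.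
have [e [d [c1E c4E]]] := diag_split c1 c4; exists e, d.
by rewrite aE bE c1E c4E; split; ring.
Qed.

Lemma H1_span A : is_cocycle P 1 A -> exists e r q g n,
  [/\ is_coboundary P 1 (A - M1 (K e * x + K r * y ^+ n)
        (- K e * y + K q * x) (K g)),
    r = 0 \/ 1 = n%:R * tau & q = 0 \/ tau = 1].
Proof.
move=> cA; have [a [b [c AE]]] := mvfield1P cA.1; subst A.
have [E1 E2 E3] := (cocycle1P tau a b c).1 cA.
have [g [az bz]] := division E1.
(* The planar part of d f is (x G, tau y G), which carries all the z-dependence of (a, b). Below,
   a', b', c' are the components of the cocycle minus d f. *)
have [G Gz] := antiderivative iz g; have [f fz] := antiderivative iz G.
have Dza : D iz (a - x * G) = 0 by rewrite ?DD ?DN DM DX az Gz /=; ring.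
have Dzb : D iz (b - K tau * y * G) = 0.
  by rewrite ?DD ?DN !DM DX DK bz Gz /=; ring.
have E2' : Eul (a - x * G) - (a - x * G) + x * D iz (c + Eul f) = 0.
  rewrite ?DD ?DN Dz_Eul fz EulD EulN EulM Eulx -[RHS]E2; ring.
have E3' : Eul (b - K tau * y * G) - K tau * (b - K tau * y * G)
    + K tau * y * D iz (c + Eul f) = 0.
  rewrite ?DD ?DN Dz_Eul fz EulD EulN !EulM EulK Euly -[RHS]E3; ring.
have [a' aE] : exists a', a' = a - x * G by eexists.
have [b' bE] : exists b', b' = b - K tau * y * G by eexists.
have [c' cE] : exists c', c' = c + Eul f by eexists.
rewrite -aE -?bE -cE in Dza Dzb E2' E3'.
(* The z-derivative of the second cocycle equation leaves x c'_zz = 0. *)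
have hz : D iz (D iz c') = 0.
  apply: (@X_reg R ix); have := congr1 (D iz) E2'.
  by rewrite ?DD ?DN Dz_Eul Dza !DM DX /= !D0 => H; rewrite -[RHS]H; ring.
(* The x-coefficient at the origin of the second equation: E - 1 produces no linear term in x. Hence
   c'_z lies in the image of E. *)
have h0 : ev (D iz c') = 0.
  have := congr1 (D ix) E2'; rewrite ?DD ?DN Dx_Eul !DM DX D0.
  move=> /(congr1 (@ev R)); rewrite !rmorphD rmorphN !rmorphM /= ev_Eul evX.
  by rewrite rmorph0 rmorph1 => H; rewrite -[RHS]H; ring.
have [k [c0 [kE kz]]] := eul_solve0 tau0 hz.
have {c0}kE : Eul k = D iz c'.
  have := congr1 (@ev R) kE; rewrite ev_Eul rmorphB /= h0 evK sub0r => /eqP.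
  by rewrite eq_sym oppr_eq0 => /eqP c00; rewrite kE c00 rmorph0 subr0.
(* Since c'_z = Eul k, the terms x c'_z and tau y c'_z are absorbed by adding k E to the planar
   part, which then consists of eigenfunctions. *)
have Ea : Eul (a' + x * k) = K 1 * (a' + x * k).
  apply/eqP; rewrite -subr_eq0 -[X in _ == X]E2' EulD EulM Eulx kE; apply/eqP; ring.
have Eb : Eul (b' + K tau * y * k) = K tau * (b' + K tau * y * k).
  apply/eqP; rewrite -subr_eq0 -[X in _ == X]E3' EulD !EulM EulK Euly kE; apply/eqP; ring.
have [||c1 [r [n [aK _ rn]]]] := eul_ker tau0 _ _ Ea; first exact: lexx.
  by rewrite ?DD ?DN !DM DX Dza kz /=; ring.
have [|q [c4 [m [bK qt cm]]]] := eul_ker tau0 tau1 _ Eb.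
  by rewrite ?DD ?DN !DM DX DK Dzb kz /=; ring.
(* c' is affine in z; its constant part in z is Eul m' + g0, and g0 is the coefficient of d/dz. *)
have cz : D iz (c' - z * D iz c') = 0.
  by rewrite ?DD ?DN DM DX hz /=; ring.
have [m' [g0 [mE mz]]] := eul_solve0 tau0 cz.
have [e [d [aF bF]]] := normal_form aK bK cm.
exists e, r, q, g0, n; split=> //.
(* f removes z from the planar part, -z k undoes the addition of k E and cancels z c'_z, -m' cancels
   Eul m', and d z has differential d E. *)
apply/coboundary1P; exists (f - z * k - m' + K d * z).
rewrite M1B !raddfD !raddfN /= !EulM EulK mE kE !DM !DX DK fz kz mz /=.
have {}aE : a = a' + x * G by rewrite aE subrK.
have {}bE : b = b' + K tau * y * G by rewrite bE subrK.
have {}cE : c = c' - Eul f by rewrite cE addrK.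
have -> : Eul z = 0 by rewrite !EulE !DX /=; ring.
congr M1.
- have -> : a = (a' + x * k) + x * G - x * k by rewrite aE; ring.
  by rewrite aF; ring.
- have -> : b = (b' + K tau * y * k) + K tau * y * G - K tau * y * k by rewrite bE; ring.
  by rewrite bF; ring.
- by rewrite cE; ring.
Qed.

Lemma y_reg n r : K r * y ^+ n = 0 -> r = 0.
Proof.
elim: n => [|n IH] H; first by rewrite expr0 mulr1 in H; rewrite -[r]evK H rmorph0.
by apply/IH/(@X_reg R iy); rewrite -[RHS]H exprS; ring.
Qed.

(** E_{-1} is not proportional to E, because 1 + tau is nonzero. *)
Lemma diag_indep (e s : R) : e = s -> - e = tau * s -> e = 0.
Proof.
move=> <- /eqP; rewrite -subr_eq0 -opprD oppr_eq0 -{1}[e]mul1r -mulrDl.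
by rewrite mulf_eq0 gt_eqF ?addr_gt0//= => /eqP.
Qed.

Lemma D_ypow i n : i != iy -> D i (y ^+ n) = 0.
Proof.
move=> iy0; elim: n => [|n IH]; first by rewrite expr0 D1.
by rewrite exprS DM IH DX eq_sym (negbTE iy0) mul0r mulr0 addr0.
Qed.

Lemma Res_ypow n : Res ix (y ^+ n) = y ^+ n.
Proof.
elim: n => [|n IH]; first by rewrite expr0 Res1.
by rewrite exprS ResM IH ResX mul1r.
Qed.

(** The planar part of a coboundary is F_z E: its first component vanishes on x = 0, which isolates
    r, its second on y = 0, which isolates q, and its linear diagonal part is a multiple of E, which
    forces e = 0. *)
Lemma H1_indep e r q g n :
  is_coboundary P 1 (M1 (K e * x + K r * y ^+ n) (- K e * y + K q * x) (K g)) ->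
  [/\ e = 0, r = 0, q = 0 & g = 0].
Proof.
move=> /coboundary1P[F /M1_inj[E1 E2 E3]].
have H1 : e = ev (D iz F).
  have := congr1 (fun F => ev (D ix F)) E1.
  rewrite ?DD ?DN !DM !DK !DX D_ypow//= !rmorphD !rmorphM /= !evX evK rmorph1 !rmorph0 => H.
  by move: H; rewrite !(mul0r, mulr0, mulr1, mul1r, add0r, addr0).
have H2 : - e = tau * ev (D iz F).
  have := congr1 (fun F => ev (D iy F)) E2.
  rewrite ?DD ?DN !DM DN !DK !DX /= oppr0 !rmorphD !rmorphM rmorphN /= !evX !evK rmorph1 !rmorph0 => H.
  by move: H; rewrite !(mul0r, mulr0, mulr1, mul1r, add0r, addr0).
have e0 := diag_indep H1 H2; split=> //.
- apply: (@y_reg n); have := congr1 (Res ix) E1.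
  by rewrite e0 rmorph0 mul0r add0r !ResM ResK ResX eqxx !mul0r Res_ypow => ->.
- have := congr1 (Res iy) E2.
  rewrite e0 rmorph0 oppr0 mul0r add0r !ResM !ResK !ResX eqxx /= mul0r mulr0 mul0r mul1r => H.
  have := congr1 (fun F => ev (D ix F)) H.
  by rewrite DM DK DX D0 !rmorphD !rmorphM /= rmorph1 evK !rmorph0 mul0r add0r mulr1.
- by rewrite -[g]evK E3 rmorphN /= ev_Eul oppr0.
Qed.

End Spans.

(** * Spanning and independence in degree 2 *)

Section Spans2.
Variable R : realType.
Variable tau : R.
Hypotheses (tau0 : 0 < tau) (tau1 : tau <= 1).
Implicit Types (F G : smfun R) (i j : 'I_3) (I J : {set 'I_3}) (A B : mvect R).
Local Notation D := (@pdS R).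
Local Notation K := (@cstS R).
Local Notation x := (@varS R ix).
Local Notation y := (@varS R iy).
Local Notation z := (@varS R iz).
Local Notation P := (pi_tau tau).
Local Notation Eul := (@Eul R tau).

Lemma dd1 a b c : schouten P (schouten P (M1 a b c)) = 0.
Proof.
rewrite d1E d2E -M3_0; congr M3.
rewrite !EulD !EulN !EulM !Eulx !Euly !EulK !DD !DN !DM !Dz_Eul !DK !DX /=; ring.
Qed.

Lemma H2_span A : is_cocycle P 2 A -> exists e r q n,
  [/\ is_coboundary P 2 (A - M2 0 (K e * x + K r * y ^+ n)
        (- K e * y + K q * x)),
    r = 0 \/ 1 = n%:R * tau & q = 0 \/ tau = 1].
Proof.
move=> cA; have [u [v [w AE]]] := mvfield2P cA.1; subst A.
have E := (cocycle2P tau u v w).1 cA.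
have [G0 [G1 [G2 [uE _ _ G0E _]]]] := hadamard u.
(* On the z-axis x, y and the image of E vanish, so the cocycle equation reduces to (1 + tau) G0 =
   0. *)
have {}G0E : G0 = 0.
  have := congr1 (fun F => Res iy (Res ix F)) E.
  have RD i F G : Res i (F + G) = Res i F + Res i G by exact: raddfD.
  have RN i F : Res i (- F) = - Res i F by exact: raddfN.
  have R0 i : Res i (0 : smfun R) = 0 by exact: raddf0.
  have Rxx : Res ix x = 0 by rewrite ResX eqxx mul0r.
  have Ryy : Res iy y = 0 by rewrite ResX eqxx mul0r.
  have Rxy : Res ix y = y by rewrite ResX mul1r.
  rewrite EulE !(RD, RN, ResM, ResK, Rxx, Rxy, Ryy, R0) -G0E => H.
  have t1 : K (1 + tau) * K (1 + tau)^-1 = 1.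
    by apply: KV; rewrite gt_eqF// addr_gt0.
  rewrite -[LHS]mul1r -t1 mulrAC (_ : K (1 + tau) * G0 = 0) ?mul0r//.
  by rewrite -[RHS]H; ring.
have tK : K tau * K (- tau^-1) = -1.
  by rewrite -rmorphM mulrN mulfV ?rmorphN1// gt_eqF.
(* The vector field (a, b, 0) is chosen so that the first coefficient of its differential, x b_z -
   tau y a_z, is u = x G1 + y G2. *)
have [b bz] := antiderivative iz G1; have [a az] := antiderivative iz (K (- tau^-1) * G2).
pose v' := v - (Eul a - a); pose w' := w - (Eul b - K tau * b).
have uE' : u = x * D iz b - K tau * y * D iz a.
  rewrite uE G0E bz az add0r; congr (_ + _).
  transitivity (- (K tau * K (- tau^-1)) * (y * G2)); first by rewrite tK; ring.
  by ring.
have E' : x * D iz w' = K tau * y * D iz v'.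
  have := dd1 a b 0; rewrite d1E d2E -uE' -M3_0 => /M3_inj H.
  apply/eqP; rewrite -subr_eq0; apply/eqP.
  rewrite -[RHS](subrr 0) -{1}E -H /v' /w' ?(DD, DN, DM, DX, DK, D0) /=; ring.
(* The remaining z-dependence is that of (x G, tau y G) with G_z = g, which is the differential of c
   d/dz for c_z = G. *)
have [g [vz wz]] := division tau0 E'.
have [G Gz] := antiderivative iz g; have [c cz] := antiderivative iz G.
have Dzv : D iz (v' - x * G) = 0 by rewrite DD DN DM DX vz Gz /=; ring.
have Dzw : D iz (w' - K tau * y * G) = 0.
  by rewrite DD DN !DM DX DK wz Gz /=; ring.
have [F [c1 [r [n [FE Fz _ rn]]]]] := eul_solve tau0 (lexx 1) Dzv.
have [H [q [c4 [k [HE Hz qt ck]]]]] := eul_solve tau0 tau1 Dzw.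
have [e [d [aF bF]]] := normal_form tau0 (erefl (K c1 * x + K r * y ^+ n))
  (erefl (K q * x + K c4 * y ^+ k)) ck.
exists e, r, q, n; split=> //.
(* F and H solve the planar equations up to resonant monomials; d z d/dz has differential d E /\
   d/dz and removes their E-part. *)
apply/coboundary2P; exists (a + F), (b + H), (c + K d * z).
rewrite M2B ?(DD, DM, DX, DK) Fz Hz cz /= !EulD; congr M2.
- by rewrite uE'; ring.
- transitivity (Eul a - a + (v' - x * G) - (K c1 * x + K r * y ^+ n) + (x * G + K d * x)).
    by rewrite aF /v'; ring.
  have -> : v' - x * G = Eul F - K 1 * F + K c1 * x + K r * y ^+ n by rewrite FE; ring.
  by rewrite rmorph1; ring.
- transitivity (Eul b - K tau * b + (w' - K tau * y * G) - (K q * x + K c4 * y ^+ k) + (K tau * y * G + K tau * y * K d)).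
    by rewrite bF /w'; ring.
  have -> : w' - K tau * y * G = Eul H - K tau * H + K q * x + K c4 * y ^+ k by rewrite HE; ring.
  by ring.
Qed.

Lemma iterDD n F G : iter n (D iy) (F + G) = iter n (D iy) F + iter n (D iy) G.
Proof. by elim: n => //= n ->; exact: DD. Qed.

Lemma iterDN n F : iter n (D iy) (- F) = - iter n (D iy) F.
Proof. by elim: n => //= n ->; exact: DN. Qed.

Lemma iterDMc n c F : D iy c = 0 -> iter n (D iy) (c * F) = c * iter n (D iy) F.
Proof. by move=> c0; elim: n => //= n ->; rewrite DM c0; ring. Qed.

(** From D_y E = (E + tau) D_y. At a resonance 1 = n tau the extra term cancels the -1 of E - 1, so
    the n-th y-derivative of (E - 1) a vanishes at the origin. *)
Lemma iterD_Eul n F : iter n (D iy) (Eul F) =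
  Eul (iter n (D iy) F) + K (n%:R * tau) * iter n (D iy) F.
Proof.
elim: n => /= [|n ->]; first by rewrite mul0r rmorph0; ring.
by rewrite DD DM DK Dy_Eul -natr1; ring.
Qed.

Lemma Dy_ypow n : D iy (y ^+ n.+1) = K n.+1%:R * y ^+ n.
Proof.
elim: n => [|n IH]; first by rewrite expr1 expr0 DX /=; ring.
by rewrite exprS DM IH DX exprS -[n.+2%:R]natr1 /=; ring.
Qed.

Lemma iterD_ypow n : iter n (D iy) (y ^+ n) = K n`!%:R.
Proof.
elim: n => [|n IH]; first by rewrite expr0 fact0 rmorph1.
rewrite iterSr Dy_ypow iterDMc ?DK// IH -rmorphM -natrM factS.
by [].
Qed.

Lemma evD F G : ev (F + G) = ev F + ev G. Proof. by []. Qed.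
Lemma evN F : ev (- F) = - ev F. Proof. by []. Qed.
Lemma evM F G : ev (F * G) = ev F * ev G. Proof. by []. Qed.
Lemma ev1 : ev (1 : smfun R) = 1. Proof. by []. Qed.
Lemma ev0 : ev (0 : smfun R) = 0. Proof. by []. Qed.

Lemma H2_indep e r q n : r = 0 \/ 1 = n%:R * tau -> q = 0 \/ tau = 1 ->
  is_coboundary P 2 (M2 0 (K e * x + K r * y ^+ n) (- K e * y + K q * x)) ->
  [/\ e = 0, r = 0 & q = 0].
Proof.
move=> rn qt /coboundary2P[a [b [c /M2_inj[_ E1 E2]]]].
have H1 : e = ev (D iz c).
  have := congr1 (fun F => ev (D ix F)) E1.
  rewrite ?DD ?DN !DM Dx_Eul !DK !DX D_ypow//= !(evD, evN, evM, ev_Eul, evX, evK, ev1, ev0) => H.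
  by move: H; rewrite !(mul0r, mulr0, mulr1, mul1r, add0r, addr0, subrr, oppr0).
have H2 : - e = tau * ev (D iz c).
  have := congr1 (fun F => ev (D iy F)) E2.
  rewrite ?DD ?DN !DM DN Dy_Eul !DK !DX /= oppr0 !(evD, evN, evM, ev_Eul, evX, evK, ev1, ev0) => H.
  by move: H; rewrite !(mul0r, mulr0, mulr1, mul1r, add0r, addr0, subrr, oppr0).
have e0 := diag_indep tau0 H1 H2; split=> //.
(* The n-th y-derivative at the origin reads n! r on the left; on the right everything lies in the
   image of E or is divisible by x. *)
- case: rn => // rn; have := congr1 (fun F => ev (iter n (D iy) F)) E1.
  rewrite e0 rmorph0 mul0r add0r !iterDD iterDN iterD_Eul -rn rmorph1 mul1r.
  rewrite addrK !iterDMc ?DK ?DX// iterD_ypow !(evD, evM, ev_Eul, evX, evK) add0r mul0r => /eqP.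
  by rewrite mulf_eq0 pnatr_eq0 -[(_`! == 0)%N]leqn0 leqNgt fact_gt0 orbF => /eqP.
(* The x-derivative at the origin would contain (1 - tau) b_x, which vanishes at the resonance tau =
   1. *)
- case: qt => // t1; have := congr1 (fun F => ev (D ix F)) E2.
  rewrite e0 rmorph0 oppr0 mul0r add0r ?DD ?DN !DM Dx_Eul !DK !DX t1 /=.
  rewrite !(evD, evN, evM, ev_Eul, evX, evK, ev1, ev0) => H.
  by move: H; rewrite !(mul0r, mulr0, mulr1, mul1r, add0r, addr0, subrr, oppr0).
Qed.

End Spans2.

(** * Products and brackets on cohomology *)

Section Ops.
Variable R : realType.
Variable tau : R.
Implicit Types (F G : smfun R) (i j : 'I_3) (I J : {set 'I_3}) (A B C : mvect R).
Local Notation D := (@pdS R).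
Local Notation K := (@cstS R).
Local Notation x := (@varS R ix).
Local Notation y := (@varS R iy).
Local Notation P := (pi_tau tau).
Local Notation Eul := (@Eul R tau).

Lemma wedge_subr A B C : wedge A (B - C) = wedge A B - wedge A C.
Proof. by rewrite -scaleN1r addrC wedge_lin scaleN1r addrC. Qed.

Lemma mvect_subE A B I p : (A - B) I p = A I p - B I p.
Proof. by rewrite -scaleN1r addrC mvect_linE mulN1r addrC. Qed.

Lemma wedge_subl A B C : wedge (A - B) C = wedge A C - wedge B C.
Proof.
apply/ffunP => J; apply/funext => p.
rewrite mvect_subE !wedgeE -sumrB; apply: eq_bigr => I _.
by rewrite mvect_subE; ring.
Qed.

Lemma schouten_subr k A B C : is_mvfield k B -> is_mvfield k C ->
  schouten A (B - C) = schouten A B - schouten A C.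
Proof.
move=> mB mC; rewrite -scaleN1r addrC (schouten_lin _ _ mC mB).
by rewrite scaleN1r addrC.
Qed.

Lemma dright_sub i A B : dright i (A - B) = dright i A - dright i B.
Proof.
apply/ffunP => I; rewrite !ffunE; case: ifP => _; first by rewrite subr0.
by rewrite scalerBr.
Qed.

Lemma schouten_subl k A B C : is_mvfield k A -> is_mvfield k B ->
  schouten (A - B) C = schouten A C - schouten B C.
Proof.
move=> mA mB; rewrite -sumrB; apply: eq_bigr => i _.
rewrite dright_sub wedge_subl.
have -> : pdm i (A - B) = pdm i A - pdm i B.
  by rewrite -scaleN1r addrC (pdm_lin _ _ mB mA) scaleN1r addrC.
by rewrite wedge_subl !opprB addrACA [RHS]addrACA; congr (_ + _); rewrite addrC.
Qed.

Lemma schouten0l C : schouten 0 C = 0.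
Proof.
have := @schouten_subl 0 0 0 C (is_mvfield0 R 0) (is_mvfield0 R 0).
by rewrite !subrr.
Qed.

Lemma schouten13 a b c t : schouten (M1 a b c) (M3 t) =
  M3 (vd a b c t - t * (D ix a + D iy b + D iz c)).
Proof.
rewrite schouten_mv; apply: mv_eq => -[] [] [];
rewrite /schoutenS /wedgeS /drightS /dleftS /DcS /sum_le /= ?raddf0 ?/vd; ring.
Qed.

Lemma schouten03 F t : schouten (M0 F) (M3 t) =
  M2 (- (t * D iz F)) (t * D iy F) (- (t * D ix F)).
Proof.
rewrite schouten_mv; apply: mv_eq => -[] [] [];
rewrite /schoutenS /wedgeS /drightS /dleftS /DcS /sum_le /= ?raddf0; ring.
Qed.

Lemma M3D F G : M3 F + M3 G = M3 (F + G).
Proof.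
rewrite -[M3 F]scale1r mv_lin; apply: mv_eq => -[] [] []; rewrite rmorph1; ring.
Qed.

(** After the Leibniz rule, mixed second derivatives are put in a fixed order: [ring] takes them as
    atoms and does not know their symmetry. *)
Ltac expandD := rewrite ?/vd ?EulE; do 3!(rewrite ?DD ?DN ?DM ?DX ?DK /=);
  rewrite ?[D iy (D ix _)]DC ?[D iz (D ix _)]DC ?[D iz (D iy _)]DC.

(** This and the next three are cases of [P, [A, B]] = [[P, A], B] + (-1)^(a - 1) [A, [P, B]] for A
    of degree a, where the term in [P, P] has dropped out. *)
Lemma jacobi_10 a b c F : schouten P (schouten (M1 a b c) (M0 F)) =
  schouten (schouten P (M1 a b c)) (M0 F) +
  schouten (M1 a b c) (schouten P (M0 F)).
Proof.
rewrite schouten10 !d0E d1E schouten20 schouten11 M1D.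
by congr M1; expandD; ring.
Qed.

Lemma jacobi_11 a b c a' b' c' :
  schouten P (schouten (M1 a b c) (M1 a' b' c')) =
  schouten (schouten P (M1 a b c)) (M1 a' b' c') +
  schouten (M1 a b c) (schouten P (M1 a' b' c')).
Proof.
rewrite schouten11 !d1E schouten21 schouten12 M2D.
by congr M2; expandD; ring.
Qed.

Lemma jacobi_12 a b c u v w :
  schouten P (schouten (M1 a b c) (M2 u v w)) =
  schouten (schouten P (M1 a b c)) (M2 u v w) +
  schouten (M1 a b c) (schouten P (M2 u v w)).
Proof.
rewrite schouten12 d1E !d2E schouten22 schouten13 M3D.
by congr M3; expandD; ring.
Qed.

Lemma jacobi_02 F u v w :
  schouten P (schouten (M0 F) (M2 u v w)) =
  schouten (schouten P (M0 F)) (M2 u v w) -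
  schouten (M0 F) (schouten P (M2 u v w)).
Proof.
rewrite schouten02 d1E d0E d2E schouten12 schouten03 M2B.
by congr M2; expandD; ring.
Qed.

End Ops.

(** * Descent of the wedge product and the bracket to cohomology *)

Section Induced.
Variable R : realType.
Variable tau : R.
Hypothesis tau0 : 0 < tau.
Implicit Types (F G : smfun R) (i j : 'I_3) (I J : {set 'I_3}) (A B C : mvect R).
Local Notation D := (@pdS R).
Local Notation K := (@cstS R).
Local Notation x := (@varS R ix).
Local Notation y := (@varS R iy).
Local Notation P := (pi_tau tau).
Local Notation Eul := (@Eul R tau).

Lemma cocycle0P A : is_cocycle P 0 A -> exists r, A = M0 (K r).
Proof.
move=> [mA]; have [F ->] := mvfield0P mA.
by move=> /(casimirP tau0)[r ->]; exists r.
Qed.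

Lemma wedge_cstl k r B : is_mvfield k B -> wedge (M0 (K r)) B = r *: B.
Proof.
move=> [/mv_surj[c ->] _]; rewrite (wedge0l _ (erefl (mv c))).
rewrite -[RHS]addr0 -mv0 mv_lin; apply: mv_eq => a b e; ring.
Qed.

Lemma wedge_cstr k r B : is_mvfield k B -> wedge B (M0 (K r)) = r *: B.
Proof.
move=> [/mv_surj[c ->] _]; rewrite (wedge0r _ (erefl (mv c))).
rewrite -[RHS]addr0 -mv0 mv_lin; apply: mv_eq => a b e; ring.
Qed.

Lemma schouten_cstl0 k r B : is_mvfield k B -> schouten (M0 (K r)) B = 0.
Proof. by move=> [/mv_surj[c ->] _]; exact: schouten_cstl. Qed.

Lemma schouten_cstr0 k r B : is_mvfield k B -> schouten B (M0 (K r)) = 0.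
Proof. by move=> [/mv_surj[c ->] _]; exact: schouten_cstr. Qed.

Lemma cocycleZ k r A : is_cocycle P k A -> is_cocycle P k (r *: A).
Proof.
move=> [mA cA]; rewrite -[_ *: _]addr0; split.
  exact: (is_mvfield_lin r mA (is_mvfield0 R k)).
by rewrite (schouten_lin _ _ mA (is_mvfield0 R k)) cA schouten0 scaler0 addr0.
Qed.

Lemma coboundaryZ k r A : is_coboundary P k A -> is_coboundary P k (r *: A).
Proof.
by move=> bA; rewrite -[_ *: _]addr0; apply: is_coboundary_lin => //;
  exact: is_coboundary0.
Qed.

Lemma cocycle0 k : is_cocycle P k 0.
Proof. by split; [exact: is_mvfield0|exact: schouten0]. Qed.

Lemma cocycle_sub k A B : is_cocycle P k A -> is_cocycle P k B -> is_cocycle P k (A - B).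
Proof.
move=> [mA cA] [mB cB]; split; first exact: mvfield_sub.
by rewrite (schouten_subr _ mA mB) cA cB subrr.
Qed.

Lemma schouten21N (a b c u v w : smfun R) :
  schouten (M2 u v w) (M1 a b c) = (-1 : R) *: schouten (M1 a b c) (M2 u v w).
Proof. by rewrite schouten21 schouten12 M2Z; congr M2; ring. Qed.

Lemma wedge11N (a b c a' b' c' : smfun R) :
  wedge (M1 a' b' c') (M1 a b c) = (-1 : R) *: wedge (M1 a b c) (M1 a' b' c').
Proof. by rewrite !wedge11 M2Z; congr M2; ring. Qed.

Lemma wedge11_cocycle a b c a' b' c' : is_cocycle P 1 (M1 a b c) ->
  is_cocycle P 1 (M1 a' b' c') -> is_cocycle P 2 (wedge (M1 a b c) (M1 a' b' c')).
Proof.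
move=> cX cY; have [E1 E2 E3] := (cocycle1P tau a b c).1 cX.
have [E1' E2' E3'] := (cocycle1P tau a' b' c').1 cY.
rewrite wedge11; apply/cocycle2P.
have {}E2 : Eul a = a - x * D iz c by apply/eqP; rewrite -subr_eq0 -[X in _ == X]E2; apply/eqP; ring.
have {}E3 : Eul b = K tau * b - K tau * y * D iz c by apply/eqP; rewrite -subr_eq0 -[X in _ == X]E3; apply/eqP; ring.
have {}E2' : Eul a' = a' - x * D iz c' by apply/eqP; rewrite -subr_eq0 -[X in _ == X]E2'; apply/eqP; ring.
have {}E3' : Eul b' = K tau * b' - K tau * y * D iz c' by apply/eqP; rewrite -subr_eq0 -[X in _ == X]E3'; apply/eqP; ring.
rewrite EulD EulN !EulM E2 E3 E2' E3' !DD !DN !DM.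
(* With Eul eliminated by the second and third cocycle equations, what remains is a combination of
   the two first equations. *)
transitivity (c' * (x * D iz b - K tau * y * D iz a)
  - c * (x * D iz b' - K tau * y * D iz a')); first by ring.
by rewrite E1 E1'; ring.
Qed.

(** The primitive is F X: by the Leibniz rule d(F X) = dF /\ X + F dX, and dX = 0. *)
Lemma wedge11_exact F a b c : is_cocycle P 1 (M1 a b c) ->
  is_coboundary P 2 (wedge (schouten P (M0 F)) (M1 a b c)).
Proof.
move=> cX; have [E1 E2 E3] := (cocycle1P tau a b c).1 cX; exists (M1 (F * a) (F * b) (F * c)).
  exact: M1_mvfield.
rewrite d1E d0E wedge11 !EulM !DM.
have {}E2 : Eul a = a - x * D iz c by apply/eqP; rewrite -subr_eq0 -[X in _ == X]E2; apply/eqP; ring.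
have {}E3 : Eul b = K tau * b - K tau * y * D iz c by apply/eqP; rewrite -subr_eq0 -[X in _ == X]E3; apply/eqP; ring.
rewrite E2 E3; congr M2; [|ring|ring].
transitivity (x * D iz F * b - K tau * y * D iz F * a + F * (x * D iz b - K tau * y * D iz a)); last by ring.
by rewrite E1; ring.
Qed.

Lemma wedge_cocycle k l A B : is_cocycle P k A -> is_cocycle P l B ->
  is_cocycle P (k + l) (wedge A B).
Proof.
move=> cA cB; have [kl|kl] := ltnP 2 (k + l).
  have mAB := wedge_mvfield cA.1 cB.1.
  by split=> //; exact: (d3E tau kl).
case: k l cA cB kl => [|k] l cA cB kl.
  have [r ->] := cocycle0P cA; rewrite (wedge_cstl _ cB.1); exact: cocycleZ.
case: l cB kl => [|l] cB kl.
  have [r ->] := cocycle0P cB; rewrite (wedge_cstr _ cA.1) addn0; exact: cocycleZ.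
case: k l cA cB kl => [|k] [|l] cA cB kl //; last first.
- by rewrite !addSn !addnS in kl.
- by rewrite addn1 in kl.
have [a [b [c AE]]] := mvfield1P cA.1; have [a' [b' [c' BE]]] := mvfield1P cB.1.
by subst; exact: wedge11_cocycle.
Qed.

Lemma wedge_coboundary k l C B : is_cocycle P k C -> is_coboundary P k C ->
  is_cocycle P l B ->
  is_coboundary P (k + l) (wedge C B) /\ is_coboundary P (l + k) (wedge B C).
Proof.
move=> cC bC cB; rewrite [(l + k)%N]addnC; have [kl|kl] := ltnP 2 (k + l).
  split; apply: coboundary_k3 => //; first exact: wedge_mvfield cC.1 cB.1.
  by rewrite addnC; exact: wedge_mvfield cB.1 cC.1.
case: k cC bC kl => [|k] cC bC kl.
  rewrite /= in bC; rewrite bC wedge0mv wedgemv0.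
  by split; exact: is_coboundary0.
case: l cB kl => [|l] cB kl.
  have [r ->] := cocycle0P cB.
  by rewrite (wedge_cstr _ cC.1) (wedge_cstl _ cC.1) addn0; split; exact: coboundaryZ.
case: k l cC bC cB kl => [|k] [|l] cC bC cB kl //; last first.
- by rewrite !addSn !addnS in kl.
- by rewrite addn1 in kl.
have [a [b [c BE]]] := mvfield1P cB.1; subst B.
have [B0 mB0 CE] := bC; have [F FE] := mvfield0P mB0; subst.
have H := wedge11_exact F cB; split=> //.
by move: H; rewrite d0E [wedge (M1 a b c) _]wedge11N; exact: coboundaryZ.
Qed.

Lemma wedge_induces : induces_op P (@wedge R) addn.
Proof.
apply: induces_op_criterion => [k l A B|k l A A' B cA cA' cB bA|k l A B B' cA cB cB' bB].
- exact: wedge_cocycle.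
- rewrite -wedge_subl.
  by have [] := wedge_coboundary (cocycle_sub cA cA') bA cB.
- rewrite -wedge_subr.
  by have [] := wedge_coboundary (cocycle_sub cB cB') bB cA.
Qed.

Lemma schouten_cocycle k l A B : is_cocycle P k A -> is_cocycle P l B ->
  is_cocycle P (k + l).-1 (schouten A B).
Proof.
move=> cA cB; have mAB := schouten_mvfield cA.1 cB.1.
have [kl|kl] := ltnP 2 (k + l).-1; first by split=> //; exact: (d3E tau kl).
case: k cA mAB kl => [|k] cA mAB kl.
  have [r ->] := cocycle0P cA; rewrite (schouten_cstl0 _ cB.1); exact: cocycle0.
case: l cB mAB kl => [|l] cB mAB kl.
  have [r ->] := cocycle0P cB; rewrite (schouten_cstr0 _ cA.1); exact: cocycle0.
split=> //; rewrite addSn addnS /= in kl.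
case: k l cA cB mAB kl => [|[|k]] [|[|l]] cA cB mAB kl; rewrite ?addSn ?addnS // in kl.
- have [a [b [c AE]]] := mvfield1P cA.1; have [a' [b' [c' BE]]] := mvfield1P cB.1.
  by subst; rewrite jacobi_11 cA.2 cB.2 schouten0l schouten0 addr0.
- have [a [b [c AE]]] := mvfield1P cA.1; have [a' [b' [c' BE]]] := mvfield2P cB.1.
  by subst; rewrite jacobi_12 cA.2 cB.2 schouten0l schouten0 addr0.
- have [a [b [c AE]]] := mvfield2P cA.1; have [a' [b' [c' BE]]] := mvfield1P cB.1.
  subst; rewrite schouten21N.
  have mBA := schouten_mvfield cB.1 cA.1.
  have H : schouten P (schouten (M1 a' b' c') (M2 a b c)) = 0.
    by rewrite jacobi_12 cA.2 cB.2 schouten0l schouten0 addr0.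
  exact: (cocycleZ (-1) (conj mBA H)).2.
Qed.

(** If C = [P, B0], the Jacobi identity makes [B0, B], up to sign, a primitive of [C, B], as [P, B]
    = 0. Both orders of the arguments are treated together, for invariance in either argument. *)
Lemma schouten_coboundary k l C B : is_cocycle P k C -> is_coboundary P k C ->
  is_cocycle P l B -> is_coboundary P (k + l).-1 (schouten C B) /\
    is_coboundary P (l + k).-1 (schouten B C).
Proof.
move=> cC bC cB; rewrite [(l + k)%N]addnC; have [kl|kl] := ltnP 2 (k + l).-1.
  split; apply: coboundary_k3 => //; first exact: schouten_mvfield cC.1 cB.1.
  by rewrite addnC; exact: schouten_mvfield cB.1 cC.1.
case: k cC bC kl => [|k] cC bC kl.
  rewrite /= in bC; rewrite bC schouten0l schouten0.
  by split; exact: is_coboundary0.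
case: l cB kl => [|l] cB kl.
  have [r ->] := cocycle0P cB.
  rewrite (schouten_cstr0 _ cC.1) (schouten_cstl0 _ cC.1).
  by split; exact: is_coboundary0.
rewrite addSn addnS /= in kl *.
case: k l cC bC cB kl => [|[|k]] [|[|l]] cC bC cB kl; rewrite ?addSn ?addnS // in kl.
- have [a [b [c BE]]] := mvfield1P cB.1; subst B.
  have [B0 mB0 CE] := bC; have [F FE] := mvfield0P mB0; subst.
  have H : is_coboundary P 1 (schouten (M1 a b c) (schouten P (M0 F))).
    exists (schouten (M1 a b c) (M0 F)).
      exact: (schouten_mvfield (M1_mvfield _ _ _) (M0_mvfield _)).
    by rewrite jacobi_10 cB.2 schouten0l add0r.
  split=> //; have -> : schouten (schouten P (M0 F)) (M1 a b c) =
      -1 *: schouten (M1 a b c) (schouten P (M0 F)).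
    by rewrite d0E !schouten11 M1Z; congr M1; ring.
  exact: (coboundaryZ (-1) H).
- have [u [v [w BE]]] := mvfield2P cB.1; subst B.
  have [B0 mB0 CE] := bC; have [F FE] := mvfield0P mB0; subst.
  have H : is_coboundary P 2 (schouten (schouten P (M0 F)) (M2 u v w)).
    exists (schouten (M0 F) (M2 u v w)).
      exact: (schouten_mvfield (M0_mvfield _) (M2_mvfield _ _ _)).
    by rewrite jacobi_02 cB.2 schouten0 subr0.
  split=> //; move: H; rewrite d0E schouten21N; exact: coboundaryZ.
- have [a [b [c BE]]] := mvfield1P cB.1; subst B.
  have [B0 mB0 CE] := bC; have [a' [b' [c' FE]]] := mvfield1P mB0; subst.
  have H : is_coboundary P 2 (schouten (M1 a b c) (schouten P (M1 a' b' c'))).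
    exists (schouten (M1 a b c) (M1 a' b' c')).
      exact: (schouten_mvfield (M1_mvfield _ _ _) (M1_mvfield _ _ _)).
    by rewrite jacobi_11 cB.2 schouten0l add0r.
  split=> //; move: H; rewrite d1E schouten21N; exact: coboundaryZ.
Qed.

Lemma schouten_induces : induces_op P (@schouten R) (fun k l => (k + l).-1).
Proof.
apply: induces_op_criterion => [k l A B|k l A A' B cA cA' cB bA|k l A B B' cA cB cB' bB].
- exact: schouten_cocycle.
- rewrite -(schouten_subl _ cA.1 cA'.1).
  by have [] := schouten_coboundary (cocycle_sub cA cA') bA cB.
- rewrite -(schouten_subr _ cB.1 cB'.1).
  by have [] := schouten_coboundary (cocycle_sub cB cB') bB cA.
Qed.

End Induced.

(** * The representatives *)

Section SpanClosure.
Variable R : realType.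
Implicit Types (F G : smfun R) (A B C : mvect R) (k l : nat).
Local Notation D := (@pdS R).
Local Notation K := (@cstS R).

Lemma in_spanP (s : seq (mvect R)) A : in_span s A <->
  exists c : nat -> R, A = \sum_(i < size s) c i *: nth 0 s i.
Proof.
split=> [[c ->]|[c ->]].
  exists (fun i => if insub i is Some j then c j else 0).
  by apply: eq_bigr => i _; rewrite valK (tnth_nth 0).
exists [ffun i => c (nat_of_ord i)].
by apply: eq_bigr => i _; rewrite ffunE (tnth_nth 0).
Qed.

Variable S1 : smfun R -> smfun R -> Prop.
Hypotheses (S1_0 : S1 0 0)
  (S1_lin : forall r a b a' b', S1 a b -> S1 a' b' -> S1 (K r * a + a') (K r * b + b'))
  (S1_Dz : forall a b, S1 a b -> D iz a = 0 /\ D iz b = 0)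
  (S1_bracket : forall a b a' b', S1 a b -> S1 a' b' ->
    S1 (a * D ix a' + b * D iy a' - (a' * D ix a + b' * D iy a))
       (a * D ix b' + b * D iy b' - (a' * D ix b + b' * D iy b))).

(** For a space [S1] of z-independent planar fields X closed under the Lie bracket: constants, the
    fields X + g d/dz with g constant, and the bivectors X /\ d/dz. The three lists of generators
    are instances. *)
Definition Sp k A : Prop := match k with
  | 0 => exists r, A = M0 (K r)
  | 1 => exists a b g, S1 a b /\ A = M1 a b (K g)
  | 2 => exists a b, S1 a b /\ A = M2 0 a b
  | _ => A = 0
  end.

Lemma Sp0 k : Sp k 0.
Proof.
case: k => [|[|[|k]]] //=.
- by exists 0; rewrite rmorph0 M0_0.
- by exists 0, 0, 0; rewrite rmorph0 M1_0.
- by exists 0, 0; rewrite M2_0.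
Qed.

Lemma Sp_mvfield k A : Sp k A -> is_mvfield k A.
Proof.
case: k => [|[|[|k]]] /=.
- by move=> [r ->]; exact: M0_mvfield.
- by move=> [a [b [g [_ ->]]]]; exact: M1_mvfield.
- by move=> [a [b [_ ->]]]; exact: M2_mvfield.
- by move=> ->; exact: is_mvfield0.
Qed.

Lemma SpZ k r A : Sp k A -> Sp k (r *: A).
Proof.
case: k => [|[|[|k]]] /=.
- by move=> [s ->]; exists (r * s); rewrite M0Z -rmorphM.
- move=> [a [b [g [Sab ->]]]]; exists (K r * a), (K r * b), (r * g).
  by rewrite M1Z -rmorphM -[K r * a]addr0 -[K r * b]addr0; split=> //; exact: S1_lin.
- move=> [a [b [Sab ->]]]; exists (K r * a), (K r * b).
  by rewrite M2Z mulr0 -[K r * a]addr0 -[K r * b]addr0; split=> //; exact: S1_lin.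
- by move=> ->; rewrite scaler0.
Qed.

Lemma schouten_Sp k l A B : Sp k A -> Sp l B -> Sp (k + l).-1 (schouten A B).
Proof.
move=> SA SB; have mA := Sp_mvfield SA; have mB := Sp_mvfield SB.
have [k3|k3] := ltnP 2 k.
  have -> : A = 0 by case: k SA k3 {mA} => [|[|[|]]].
  by rewrite schouten0l; exact: Sp0.
have [l3|l3] := ltnP 2 l.
  have -> : B = 0 by case: l SB l3 {mB} => [|[|[|]]].
  by rewrite schouten0; exact: Sp0.
case: k SA k3 mA => [|k] SA k3 mA.
  by have [r ->] := SA; rewrite (schouten_cstl0 _ mB); exact: Sp0.
case: l SB l3 mB => [|l] SB l3 mB.
  by have [r ->] := SB; rewrite (schouten_cstr0 _ mA); exact: Sp0.
case: k l SA SB k3 l3 {mA mB} => [|[|//]] [|[|//]] SA SB _ _ /=.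
- have [a [b [g [Sab ->]]]] := SA; have [a' [b' [g' [Sab' ->]]]] := SB.
  have [az bz] := S1_Dz Sab; have [az' bz'] := S1_Dz Sab'.
  exists (a * D ix a' + b * D iy a' - (a' * D ix a + b' * D iy a)),
    (a * D ix b' + b * D iy b' - (a' * D ix b + b' * D iy b)), 0.
  split; first exact: S1_bracket.
  by rewrite schouten11 /vd az bz az' bz' !DK rmorph0; congr M1; ring.
- have [a [b [g [Sab ->]]]] := SA; have [a' [b' [Sab' ->]]] := SB.
  have [az bz] := S1_Dz Sab; have [az' bz'] := S1_Dz Sab'.
  exists (a * D ix a' + b * D iy a' - (a' * D ix a + b' * D iy a)),
    (a * D ix b' + b * D iy b' - (a' * D ix b + b' * D iy b)).
  split; first exact: S1_bracket.
  by rewrite schouten12 /vd az bz az' bz' !DK !D0; congr M2; ring.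
- have [a [b [Sab ->]]] := SA; have [a' [b' [g [Sab' ->]]]] := SB.
  have [az bz] := S1_Dz Sab; have [az' bz'] := S1_Dz Sab'.
  exists (a * D ix a' + b * D iy a' - (a' * D ix a + b' * D iy a)),
    (a * D ix b' + b * D iy b' - (a' * D ix b + b' * D iy b)).
  split; first exact: S1_bracket.
  by rewrite schouten21 /vd az bz az' bz' !DK !D0; congr M2; ring.
(* The bracket of X /\ d/dz and X' /\ d/dz vanishes, since no coefficient depends on z. *)
- have [a [b [Sab ->]]] := SA; have [a' [b' [Sab' ->]]] := SB.
  have [az bz] := S1_Dz Sab; have [az' bz'] := S1_Dz Sab'.
  by rewrite schouten22 az bz az' bz' !D0 -M3_0; congr M3; ring.
Qed.

(** Only the product of two vector fields can leave the span: (X + g d/dz) /\ (X' + g' d/dz) is (g'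
    X - g X') /\ d/dz plus X /\ X', a multiple of d/dx /\ d/dy. *)
Lemma wedge_Sp k l A B : Sp k A -> Sp l B -> (k + l < 3)%N ->
  exists2 C, Sp (k + l) C &
    wedge A B = C \/ (k + l = 2)%N /\ exists a b a' b',
      [/\ S1 a b, S1 a' b' & wedge A B - C = M2 (a * b' - b * a') 0 0].
Proof.
move=> SA SB kl; have mA := Sp_mvfield SA; have mB := Sp_mvfield SB.
case: k SA kl mA => [|k] SA kl mA.
  have [r ->] := SA; exists (r *: B); first exact: SpZ.
  by left; exact: wedge_cstl mB.
case: l SB kl mB => [|l] SB kl mB.
  have [r ->] := SB; exists (r *: A); first by rewrite addn0; exact: SpZ.
  by left; exact: wedge_cstr mA.
case: k l SA SB kl mA mB => [|k] [|l] SA SB kl mA mB //; last first.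
- by rewrite !addSn !addnS in kl.
- by rewrite addn1 in kl.
have [a [b [g [Sab ->]]]] := SA; have [a' [b' [g' [Sab' ->]]]] := SB.
exists (M2 0 (K (- g) * a' + (K g' * a + 0)) (K (- g) * b' + (K g' * b + 0))).
  by eexists; eexists; split; last by []; apply: S1_lin => //; exact: S1_lin.
right; split=> //; exists a, b, a', b'; split=> //.
by rewrite wedge11 M2B rmorphN; congr M2; ring.
Qed.

Lemma wedge_Sp_exact k l A B : (forall a b a' b', S1 a b -> S1 a' b' -> a * b' = b * a') ->
  Sp k A -> Sp l B -> Sp (k + l) (wedge A B).
Proof.
move=> S1_wedge SA SB; have [kl|kl] := ltnP (k + l) 3.
  have [C SC [->//|[_ [a [b [a' [b' [Sab Sab']]]]]]]] := wedge_Sp SA SB kl.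
  by rewrite (S1_wedge _ _ _ _ Sab Sab') subrr M2_0 => /eqP; rewrite subr_eq0 => /eqP ->.
have -> : wedge A B = 0; last exact: Sp0.
have [k3|k3] := ltnP 2 k.
  have -> : A = 0 by case: k SA k3 {kl} => [|[|[|]]].
  exact: wedge0mv.
have [l3|l3] := ltnP 2 l.
  have -> : B = 0 by case: l SB l3 {kl} => [|[|[|]]].
  exact: wedgemv0.
case: k l SA SB kl k3 l3 => [|[|[|//]]] [|[|[|//]]] SA SB // _ _ _.
- have [a [b [g [Sab ->]]]] := SA; have [a' [b' [Sab' ->]]] := SB.
  by rewrite wedge12 (S1_wedge _ _ _ _ Sab Sab') -M3_0; congr M3; ring.
- have [a [b [Sab ->]]] := SA; have [a' [b' [g [Sab' ->]]]] := SB.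
  rewrite wedge21 -M3_0; congr M3.
  transitivity (a' * b - b' * a); first ring.
  by rewrite (S1_wedge _ _ _ _ Sab' Sab) subrr.
- apply: (@mvfield_gt3 R 4) => //.
  exact: (wedge_mvfield (Sp_mvfield (k := 2) SA) (Sp_mvfield (k := 2) SB)).
Qed.

Variables (s : seq (mvect R)).
Hypothesis spanE : forall k A, in_span (reps s k) A <-> Sp k A.

Lemma preserved_Sp : (forall a b a' b', S1 a b -> S1 a' b' -> a * b' = b * a') ->
  preserved s.
Proof.
move=> S1_wedge k l A B /spanE SA /spanE SB; split; apply/spanE.
  exact: wedge_Sp_exact.
exact: schouten_Sp.
Qed.

Lemma determined_Sp (rel : mvect R -> Prop) :
  (forall a b a' b', S1 a b -> S1 a' b' -> rel (M2 (a * b' - b * a') 0 0)) ->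
  determined_modulo rel s.
Proof.
move=> relP; have rel0 : rel 0.
  by have := relP _ _ _ _ S1_0 S1_0; rewrite mulr0 subrr M2_0.
have rel_eq k A : A = 0 -> rel_in_degree rel k A.
  by move=> ->; rewrite /rel_in_degree; case: eqP.
move=> k l A B /spanE SA /spanE SB; split=> [kl|_].
  have [C SC H] := wedge_Sp SA SB kl; exists C; first exact/spanE.
  case: H => [->|[-> [a [b [a' [b' [Sab Sab' ->]]]]]]].
    by apply: rel_eq; rewrite subrr.
  exact: relP.
exists (schouten A B); first exact/spanE/schouten_Sp.
by apply: rel_eq; rewrite subrr.
Qed.

End SpanClosure.

(** * The lists of generators and their spans *)

Section Generators.
Variable R : realType.
Implicit Types (F G : smfun R) (A B C : mvect R) (k l n : nat).
Local Notation D := (@pdS R).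
Local Notation K := (@cstS R).
Local Notation x := (@varS R ix).
Local Notation y := (@varS R iy).
Local Notation z := (@varS R iz).

(* The flags tell whether y^n d/dx and x d/dy are among the generators. *)
Definition planar n (br bq : bool) (a b : smfun R) : Prop :=
  exists e r q, [/\ a = K e * x + K r * y ^+ n, b = - K e * y + K q * x,
    br || (r == 0) & bq || (q == 0)].

Lemma planar0 n br bq : planar n br bq 0 0.
Proof.
exists 0, 0, 0; rewrite eqxx !orbT rmorph0; split=> //; ring.
Qed.

Lemma planar_lin n br bq r a b a' b' : planar n br bq a b -> planar n br bq a' b' ->
  planar n br bq (K r * a + a') (K r * b + b').
Proof.
move=> [e [s [q [-> -> hs hq]]]] [e' [s' [q' [-> -> hs' hq']]]].
exists (r * e + e'), (r * s + s'), (r * q + q'); split; [ring|ring| |].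
- by case: br hs hs' => //= /eqP -> /eqP ->; rewrite mulr0 addr0.
- by case: bq hq hq' => //= /eqP -> /eqP ->; rewrite mulr0 addr0.
Qed.

Lemma planar_Dz n br bq a b : planar n br bq a b -> D iz a = 0 /\ D iz b = 0.
Proof.
move=> [e [r [q [-> -> _ _]]]].
by rewrite !DD !DM DN !DK !DX D_ypow//=; split; ring.
Qed.

Lemma y_Dy_ypow n : y * D iy (y ^+ n) = K n%:R * y ^+ n.
Proof.
case: n => [|n]; first by rewrite expr0 D1 rmorph0; ring.
by rewrite Dy_ypow exprS; ring.
Qed.

(** For n = 1 these are traceless linear fields, at most a copy of sl_2. For other n the bracket of
    x d/dy and y^n d/dx would leave the span, so x d/dy must be absent. *)
Lemma planar_bracket n br bq a b a' b' : n = 1%N \/ bq = false ->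
  planar n br bq a b -> planar n br bq a' b' ->
  planar n br bq (a * D ix a' + b * D iy a' - (a' * D ix a + b' * D iy a))
    (a * D ix b' + b * D iy b' - (a' * D ix b + b' * D iy b)).
Proof.
move=> nq [e [r [q [-> -> hr hq]]]] [e' [r' [q' [-> -> hr' hq']]]].
(* The structure constants: [x d/dy, y d/dx] = E_{-1}, [y^n d/dx, E_{-1}] = (n + 1) y^n d/dx and
   [E_{-1}, x d/dy] = 2 x d/dy. *)
exists (q * r' - q' * r), ((1 + n%:R) * (r * e' - r' * e)), (2%:R * (e * q' - e' * q)).
rewrite !DD !DM !DN !DK !DX !(@D_ypow R ix)//=.
have Y := y_Dy_ypow n; split.
- transitivity (K (1 + n%:R) * (K r * K e' - K r' * K e) * y ^+ n
    + (K e' * K r - K e * K r') * (y * D iy (y ^+ n) - K n%:R * y ^+ n)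
    + (K q * K r' - K q' * K r) * x * D iy (y ^+ n)); first by ring.
  rewrite Y subrr mulr0 addr0.
  case: nq hq hq' => [-> _ _|->/= /eqP -> /eqP ->]; last by rewrite !rmorph0; ring.
  by rewrite expr1 DX /=; ring.
- case: nq hq hq' => [-> _ _|->/= /eqP -> /eqP ->]; last by rewrite !rmorph0; ring.
  by rewrite expr1; ring.
- by case: br hr hr' => //= /eqP -> /eqP ->; rewrite !mul0r subrr mulr0.
- by case: bq {nq} hq hq' => //= /eqP -> /eqP ->; rewrite !mulr0 subrr mulr0.
Qed.

Lemma ypowE n : @ypow R n = val (y ^+ n).
Proof.
apply/funext => p; rewrite -[RHS]/(vals p (y ^+ n)) rmorphXn; congr (_ ^+ n).
Qed.

Lemma cxE : @cx R = val x. Proof. by []. Qed.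
Lemma cyE : @cy R = val y. Proof. by []. Qed.
Lemma cst1E : cst 1 = val (1 : smfun R). Proof. by []. Qed.

Definition gens1 : seq (mvect R) := [:: ddx (@cy R); ddy (@cx R); euler (-1)].
Definition gensn n : seq (mvect R) := [:: ddx (@ypow R n); euler (-1)].
Definition gens0 : seq (mvect R) := [:: euler (-1)].

Local Notation comb s c := (\sum_(i < size s) c (nat_of_ord i) *: nth 0 s i).

Lemma comb_reps0 s (c : nat -> R) : comb (reps s 0) c = M0 (K (c 0%N)).
Proof.
by rewrite /= !big_ord_recr big_ord0 /= add0r cst1E scalE M0Z mulr1.
Qed.

Lemma comb_gens1_1 (c : nat -> R) : comb (reps gens1 1) c =
  M1 (K (c 2%N) * x + K (c 0%N) * y ^+ 1) (- K (c 2%N) * y + K (c 1%N) * x) (K (c 3%N)).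
Proof.
rewrite /= !big_ord_recr big_ord0 /= add0r cyE cxE ddxE ddyE dzE eulerE !M1Z !M1D.
by congr M1; rewrite ?rmorphN1; ring.
Qed.

Lemma comb_gens1_2 (c : nat -> R) : comb (reps gens1 2) c =
  M2 0 (K (c 2%N) * x + K (c 0%N) * y ^+ 1) (- K (c 2%N) * y + K (c 1%N) * x).
Proof.
rewrite /= !big_ord_recr big_ord0 /= add0r cyE cxE ddxE ddyE eulerE !wedge_dz !M2Z !M2D.
by congr M2; rewrite ?rmorphN1; ring.
Qed.

Lemma comb_gensn_1 n (c : nat -> R) : comb (reps (gensn n) 1) c =
  M1 (K (c 1%N) * x + K (c 0%N) * y ^+ n) (- K (c 1%N) * y + K 0 * x) (K (c 2%N)).
Proof.
rewrite /= !big_ord_recr big_ord0 /= add0r ypowE ddxE dzE eulerE !M1Z !M1D.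
by congr M1; rewrite ?rmorphN1; ring.
Qed.

Lemma comb_gensn_2 n (c : nat -> R) : comb (reps (gensn n) 2) c =
  M2 0 (K (c 1%N) * x + K (c 0%N) * y ^+ n) (- K (c 1%N) * y + K 0 * x).
Proof.
rewrite /= !big_ord_recr big_ord0 /= add0r ypowE ddxE eulerE !wedge_dz !M2Z !M2D.
by congr M2; rewrite ?rmorphN1; ring.
Qed.

Lemma comb_gens0_1 (c : nat -> R) : comb (reps gens0 1) c =
  M1 (K (c 0%N) * x + K 0 * y ^+ 0) (- K (c 0%N) * y + K 0 * x) (K (c 1%N)).
Proof.
rewrite /= !big_ord_recr big_ord0 /= add0r dzE eulerE !M1Z !M1D.
by congr M1; rewrite ?rmorphN1; ring.
Qed.

Lemma comb_gens0_2 (c : nat -> R) : comb (reps gens0 2) c =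
  M2 0 (K (c 0%N) * x + K 0 * y ^+ 0) (- K (c 0%N) * y + K 0 * x).
Proof.
rewrite /= !big_ord_recr big_ord0 /= add0r eulerE !wedge_dz !M2Z.
by congr M2; rewrite ?rmorphN1; ring.
Qed.

Lemma span_reps s n br bq :
    (forall e r q g, br || (r == 0) -> bq || (q == 0) -> exists c : nat -> R,
      comb (reps s 1) c = M1 (K e * x + K r * y ^+ n) (- K e * y + K q * x) (K g) /\
      comb (reps s 2) c = M2 0 (K e * x + K r * y ^+ n) (- K e * y + K q * x)) ->
    (forall c : nat -> R, exists e r q g, [/\ br || (r == 0), bq || (q == 0),
      comb (reps s 1) c = M1 (K e * x + K r * y ^+ n) (- K e * y + K q * x) (K g) &
      comb (reps s 2) c = M2 0 (K e * x + K r * y ^+ n) (- K e * y + K q * x)]) ->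
  forall k A, in_span (reps s k) A <-> Sp (planar n br bq) k A.
Proof.
move=> H1 H2 [|[|[|k]]] A.
- split=> [/in_spanP[c ->]|[r ->]]; first by rewrite comb_reps0; exists (c 0%N).
  by apply/in_spanP; exists (fun=> r); rewrite comb_reps0.
- split=> [/in_spanP[c ->]|[a [b [g [[e [r [q [-> -> hr hq]]]] ->]]]]].
    have [e [r [q [g [hr hq -> _]]]]] := H2 c.
    by eexists; eexists; exists g; split=> //; exists e, r, q.
  by have [c [<- _]] := H1 e r q g hr hq; apply/in_spanP; exists c.
- split=> [/in_spanP[c ->]|[a [b [[e [r [q [-> -> hr hq]]]] ->]]]].
    have [e [r [q [g [hr hq _ ->]]]]] := H2 c.
    by eexists; eexists; split=> //; exists e, r, q.
  by have [c [_ <-]] := H1 e r q 0 hr hq; apply/in_spanP; exists c.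
- split=> [/in_spanP[c ->]|->]; first by rewrite big_ord0.
  by apply/in_spanP; exists (fun=> 0); rewrite big_ord0.
Qed.

Lemma span_gens1 k A : in_span (reps gens1 k) A <-> Sp (planar 1 true true) k A.
Proof.
move: k A; apply: span_reps => [e r q g _ _|c].
  exists (fun i => nth 0 [:: r; q; e; g] i).
  by rewrite comb_gens1_1 comb_gens1_2.
exists (c 2%N), (c 0%N), (c 1%N), (c 3%N).
by rewrite comb_gens1_1 comb_gens1_2.
Qed.

Lemma span_gensn n k A : in_span (reps (gensn n) k) A <-> Sp (planar n true false) k A.
Proof.
move: k A; apply: span_reps => [e r q g _ /eqP ->|c].
  exists (fun i => nth 0 [:: r; e; g] i).
  by rewrite comb_gensn_1 comb_gensn_2.
exists (c 1%N), (c 0%N), 0, (c 2%N).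
by rewrite eqxx comb_gensn_1 comb_gensn_2.
Qed.

Lemma span_gens0 k A : in_span (reps gens0 k) A <-> Sp (planar 0 false false) k A.
Proof.
move: k A; apply: span_reps => [e r q g /eqP -> /eqP ->|c].
  exists (fun i => nth 0 [:: e; g] i).
  by rewrite comb_gens0_1 comb_gens0_2.
exists (c 0%N), 0, 0, (c 1%N).
by rewrite !eqxx comb_gens0_1 comb_gens0_2.
Qed.

Lemma dxdyE F : wedge (ddx (val F)) (ddy (cst 1)) = M2 F 0 0.
Proof. by rewrite cst1E ddxE ddyE wedge11; congr M2; ring. Qed.

(** The indices [ix], [iy], [iz] act here as the exponents 0, 1, 2 of x in [hpoly]. *)
Definition quad (a : 'I_3 -> R) : smfun R :=
  K (a ix) * (y * y) + K (a iy) * (x * y) + K (a iz) * (x * x).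

Lemma hpolyE (a : 'I_3 -> R) : hpoly a = val (quad a).
Proof.
apply/funext => p; rewrite /hpoly (sum_ord3 (fun i : 'I_3 => a i * cx p ^+ i * cy p ^+ (2 - i))).
rewrite [LHS]/= subn0 subnn !expr0 !expr1 !mulr1 !expr2.
rewrite -[RHS]/(vals p (quad a)) !rmorphD !rmorphM -mulrA.
by [].
Qed.

End Generators.

(** * Bases of cohomology and the exact bivectors *)

Section Bases.
Variable R : realType.
Variable tau : R.
Hypotheses (tau0 : 0 < tau) (tau1 : tau <= 1).
Implicit Types (F G : smfun R) (A B C : mvect R) (k l m : nat).
Local Notation D := (@pdS R).
Local Notation K := (@cstS R).
Local Notation x := (@varS R ix).
Local Notation y := (@varS R iy).
Local Notation z := (@varS R iz).
Local Notation P := (pi_tau tau).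
Local Notation Eul := (@Eul R tau).

Lemma mem_in_span (s : seq (mvect R)) A : A \in s -> in_span s A.
Proof.
move=> As; apply/in_spanP; exists (fun i => (i == index A s)%:R).
have iA : (index A s < size s)%N by rewrite index_mem.
rewrite (bigD1 (Ordinal iA))//= eqxx scale1r big1 ?addr0 ?nth_index// => i.
by rewrite -val_eqE /= => /negbTE ->; rewrite scale0r.
Qed.

Section Resonant.
Variables (n : nat) (br bq : bool).
Hypotheses (br_res : br -> 1 = n%:R * tau) (bq_res : bq -> tau = 1)
  (res_br : forall m, 1 = m%:R * tau -> br /\ m = n) (res_bq : tau = 1 -> bq).

(** The flags admit a monomial only at its resonance, so the coefficients have the eigenvalues for
    which L_E kills the field; hence the span consists of cocycles. *)
Lemma planar_Eul a b : planar n br bq a b -> Eul a = a /\ Eul b = K tau * b.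
Proof.
move=> [e [r [q [-> -> hr hq]]]].
rewrite !EulD !EulM EulN !EulK Eulx Euly Eul_ypow; split.
  case: br hr br_res => [_ /(_ isT) <-|/= /eqP -> _]; last by rewrite rmorph0; ring.
  by rewrite rmorph1; ring.
case: bq hq bq_res => [_ /(_ isT) ->|/= /eqP -> _]; last by rewrite rmorph0; ring.
by rewrite rmorph1; ring.
Qed.

Lemma Sp_cocycle k A : Sp (planar n br bq) k A -> is_cocycle P k A.
Proof.
case: k => [|[|[|k]]] /=.
- move=> [r ->]; split; first exact: M0_mvfield.
  by apply/(casimirP tau0); exists r.
- move=> [a [b [g [Sab ->]]]]; apply/cocycle1P.
  have [az bz] := planar_Dz Sab; have [aE bE] := planar_Eul Sab.
  by rewrite az bz DK aE bE; split; ring.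
- move=> [a [b [Sab ->]]]; apply/cocycle2P.
  have [az bz] := planar_Dz Sab.
  by rewrite az bz -[Eul 0]/(Eul (0 : smfun R)) raddf0; ring.
- by move=> ->; exact: cocycle0.
Qed.

(** Conversely, every resonance left over by [H1_span] or [H2_span] is among the generators that the
    flags allow. *)
Lemma planar_res e r q m : r = 0 \/ 1 = m%:R * tau -> q = 0 \/ tau = 1 ->
  planar n br bq (K e * x + K r * y ^+ m) (- K e * y + K q * x).
Proof.
move=> rm qt; exists e, r, q; split=> //.
- case: rm => [->|/res_br[_ ->]//]; ring.
- by case: rm => [->|/res_br[->]//]; rewrite eqxx orbT.
- by case: qt => [->|/res_bq ->//]; rewrite eqxx orbT.
Qed.

Lemma cocycle1_Sp A : is_cocycle P 1 A ->
  exists2 B, Sp (planar n br bq) 1 B & is_coboundary P 1 (A - B).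
Proof.
move=> /(H1_span tau0 tau1)[e [r [q [g [m [bA rm qt]]]]]]; eexists; last exact: bA.
by eexists; eexists; exists g; split; last by []; exact: planar_res.
Qed.

Lemma cocycle2_Sp A : is_cocycle P 2 A ->
  exists2 B, Sp (planar n br bq) 2 B & is_coboundary P 2 (A - B).
Proof.
move=> /(H2_span tau0 tau1)[e [r [q [m [bA rm qt]]]]]; eexists; last exact: bA.
by eexists; eexists; split; last by []; exact: planar_res.
Qed.

Lemma basis_reps s k : (0 < k <= 2)%N ->
    (forall l A, in_span (reps s l) A <-> Sp (planar n br bq) l A) ->
    (forall c : nat -> R,
      is_coboundary P k (\sum_(i < size (reps s k)) c i *: nth 0 (reps s k) i) ->
      forall i, (i < size (reps s k))%N -> c i = 0) ->
  basis_of_classes P k (reps s k).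
Proof.
move=> k12 spanE ind; apply: basis_criterion => // [A /mem_in_span/spanE|A cA].
  exact: Sp_cocycle.
have [B /spanE/in_spanP[c BE] bA] : exists2 B, Sp (planar n br bq) k B &
    is_coboundary P k (A - B).
  case: k k12 ind cA => [|[|[|//]]] // _ _; first exact: cocycle1_Sp.
  exact: cocycle2_Sp.
by exists c; rewrite -BE.
Qed.

End Resonant.

Lemma basis0 : basis_of_classes P 0 [:: scal (cst 1)].
Proof.
rewrite cst1E scalE; apply: basis_criterion => [A|A cA|c].
- rewrite inE => /eqP ->; split; first exact: M0_mvfield.
  by apply/(casimirP tau0); exists 1; rewrite rmorph1.
- have [r ->] := cocycle0P tau0 cA; exists (fun=> r).
  by rewrite big_ord1 /= M0Z mulr1 subrr.
rewrite big_ord1 /= M0Z mulr1 -M0_0 => /M0_inj/(congr1 (@ev R)).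
by rewrite ev0 evK => c0 [].
Qed.

Lemma casimir_cst (f : fld R) : casimir P f <-> exists c : R, f = cst c.
Proof.
split=> [[sf]|[c ->]].
  rewrite -[f]/(val (mksmfun sf)) scalE => /(casimirP tau0)[c E].
  by exists c; rewrite E.
split; first exact: smooth_cst.
by rewrite -[cst c]/(val (K c)) scalE; apply/(casimirP tau0); exists c.
Qed.

Lemma H3_zero (h : cohomology P 3) : h = 0.
Proof.
have [c <-] := class_surj h; rewrite -class0; apply/class_eq.
have -> : val c - val (0 : cocycle P 3) = val c by exact: subr0.
exact: (coboundary_k3 tau0 (k := 3) isT (cocycle_valP c).1).
Qed.

Lemma res_one m : tau = 1 -> 1 = m%:R * tau -> m = 1%N.
Proof. by move=> -> /esym/eqP; rewrite mulr1 pnatr_eq1 => /eqP. Qed.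

Lemma res_inv n m : (2 <= n)%N -> tau = n%:R^-1 -> 1 = m%:R * tau -> m = n.
Proof.
move=> n2 -> /(congr1 ( *%R^~ n%:R)).
rewrite mul1r divfK ?pnatr_eq0 -?lt0n; last exact: leq_trans n2.
by move=> /eqP; rewrite eqr_nat => /eqP.
Qed.

Lemma res_inv_neq1 n : (2 <= n)%N -> tau = n%:R^-1 -> tau <> 1.
Proof.
move=> n2 -> /eqP; rewrite invr_eq1 pnatr_eq1 => /eqP n1.
by rewrite n1 in n2.
Qed.

Lemma nonres m : (forall n : nat, (0 < n)%N -> tau <> n%:R^-1) -> 1 <> m%:R * tau.
Proof.
move=> nr; case: m => [/eqP|m E]; first by rewrite mul0r oner_eq0.
by apply: (nr m.+1) => //; rewrite -[LHS](mulKf (x := m.+1%:R)) ?pnatr_eq0// -E mulr1.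
Qed.

Lemma nonres1 : (forall n : nat, (0 < n)%N -> tau <> n%:R^-1) -> tau <> 1.
Proof. by move=> /(_ 1%N isT); rewrite invr1. Qed.

Lemma bases_one k : (0 < k <= 2)%N -> tau = 1 ->
  basis_of_classes P k (reps (gens1 R) k).
Proof.
move=> k12 t1; apply: (@basis_reps 1 true true) => //.
- by rewrite t1 mulr1.
- by move=> m /(res_one t1).
- by move=> l A; exact: span_gens1.
have r1 : 1 = 1%:R * tau by rewrite t1 mulr1.
move=> c; case: k k12 => [|[|[|//]]] // _.
  rewrite comb_gens1_1 => /(H1_indep tau0)[c2 c0 c1 c3].
  by case=> [|[|[|[|]]]].
rewrite comb_gens1_2 => /(H2_indep tau0 (or_intror r1) (or_intror t1))[c2 c0 c1].
by case=> [|[|[|]]].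
Qed.

Lemma bases_inv n k : (0 < k <= 2)%N -> (2 <= n)%N -> tau = n%:R^-1 ->
  basis_of_classes P k (reps (gensn R n) k).
Proof.
move=> k12 n2 tn.
have rn : 1 = n%:R * tau.
  by rewrite tn mulfV// pnatr_eq0 -lt0n (leq_trans _ n2).
apply: (@basis_reps n true false) => //.
- by move=> m /(res_inv n2 tn).
- by move=> /(res_inv_neq1 n2 tn).
- by move=> l A; exact: span_gensn.
move=> c; case: k k12 => [|[|[|//]]] // _.
  rewrite comb_gensn_1 => /(H1_indep tau0)[c1 c0 _ c2].
  by case=> [|[|[|]]].
rewrite comb_gensn_2 => /(H2_indep tau0 (or_intror rn) (or_introl erefl))[c1 c0 _].
by case=> [|[|]].
Qed.

Lemma bases_nonres k : (0 < k <= 2)%N ->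
    (forall n : nat, (0 < n)%N -> tau <> n%:R^-1) ->
  basis_of_classes P k (reps (gens0 R) k).
Proof.
move=> k12 nr; apply: (@basis_reps 0 false false) => //.
- by move=> m /(nonres nr).
- by move=> /(nonres1 nr).
- by move=> l A; exact: span_gens0.
move=> c; case: k k12 => [|[|[|//]]] // _.
  rewrite comb_gens0_1 => /(H1_indep tau0)[c0 _ _ c1].
  by case=> [|[|]].
rewrite comb_gens0_2 => /(H2_indep tau0 (or_introl erefl) (or_introl erefl))[c0 _ _].
by case=> [|].
Qed.

Lemma pi_exact : represents P (0 : cohomology P 2).
Proof.
apply: represents0; [exact: pi_mvfield|by case: (pi_poisson tau)|].
(* The primitive is z d/dz. *)
apply/coboundary2P; exists 0, 0, z; rewrite pi_tauE !raddf0 !DX /=.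
by congr M2; ring.
Qed.

(** For coefficients with these eigenvalues L_E vanishes, so only the d/dx /\ d/dy term of the
    differential remains. *)
Lemma dxdy_exact F a b : x * D iz b - K tau * y * D iz a = F ->
  Eul a = a -> Eul b = K tau * b ->
  represents (M2 F 0 0) (0 : cohomology P 2).
Proof.
move=> FE aE bE.
have E : M2 F 0 0 = schouten P (M1 a b 0).
  by rewrite d1E FE aE bE D0; congr M2; ring.
apply: represents0; first exact: M2_mvfield.
  by rewrite E dd1.
by rewrite E; exists (M1 a b 0); first exact: M1_mvfield.
Qed.

Lemma Eulz : Eul z = 0.
Proof. by rewrite EulE !DX /=; ring. Qed.

Lemma quad_exact (a : 'I_3 -> R) : tau = 1 ->
  represents (M2 (quad a) 0 0) (0 : cohomology P 2).
Proof.
(* For tau = 1 the form is x times a linear form plus y times another. These linear forms, which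
   have eigenvalue 1, are multiplied by z, with a sign for the y-part. *)
move=> t1; apply: (@dxdy_exact _ (- (z * (K (a ix) * y)))
  (z * (K (a iy) * y + K (a iz) * x))).
- rewrite DN !DM DD !DM !DX !DK t1 rmorph1 /= /quad; ring.
- by rewrite EulN !EulM Eulz EulK Euly t1 rmorph1; ring.
- by rewrite !EulM EulD !EulM Eulz !EulK Euly Eulx t1 rmorph1; ring.
Qed.

Lemma ypow_exact n : (0 < n)%N -> tau = n%:R^-1 ->
  represents (M2 (y ^+ n.+1) 0 0) (0 : cohomology P 2).
Proof.
move=> n0 tn; have tK : K tau * K n%:R = 1.
  by rewrite -rmorphM tn mulVf ?rmorph1// pnatr_eq0 -lt0n.
(* y^n has eigenvalue n tau = 1, and the factor n compensates tau in -tau y a_z. *)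
apply: (@dxdy_exact _ (- (K n%:R * (z * y ^+ n))) 0).
- rewrite D0 DN !DM DX DK D_ypow//= exprS.
  transitivity ((K tau * K n%:R) * (y * y ^+ n)); first ring.
  by rewrite tK mul1r.
- rewrite EulN !EulM Eulz EulK Eul_ypow rmorphM /= [K _ * K tau]mulrC tK; ring.
- by rewrite -[LHS]/(Eul (0 : smfun R)) raddf0 mulr0.
Qed.

Lemma determined_one : tau = 1 -> determined_modulo
  (fun A => exists (c : R) (a : 'I_3 -> R),
     A = c *: wedge (euler 1) (dz R) + wedge (ddx (hpoly a)) (ddy (cst 1)))
  (gens1 R).
Proof.
move=> t1; apply: (@determined_Sp _ (planar 1 true true)) => //.
- exact: planar0.
- exact: planar_lin.
- exact: planar_Dz.
- by move=> a b a' b'; apply: planar_bracket; left.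
- exact: span_gens1.
move=> _ _ _ _ [e [r [q [-> -> _ _]]]] [e' [r' [q' [-> -> _ _]]]].
(* The coefficients of y^2, xy and x^2 in the determinant of the two linear fields; the E-part of
   the relation is taken to be 0. *)
exists 0, (fun i => nth 0 [:: e * r' - r * e'; r * q' - q * r'; e * q' - q * e'] i).
rewrite scale0r add0r hpolyE dxdyE /quad /= !expr1; congr M2; ring.
Qed.

Lemma determined_inv n : determined_modulo
  (fun A => exists c : R, A = c *: wedge (ddx (@ypow R n.+1)) (ddy (cst 1)))
  (gensn R n).
Proof.
apply: (@determined_Sp _ (planar n true false)) => //.
- exact: planar0.
- exact: planar_lin.
- exact: planar_Dz.
- by move=> a b a' b'; apply: planar_bracket; right.
- exact: span_gensn.
move=> _ _ _ _ [e [r [q [-> -> _ /eqP ->]]]] [e' [r' [q' [-> -> _ /eqP ->]]]].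
(* The xy terms of the determinant cancel, and only y^(n+1) is left. *)
exists (e * r' - r * e').
rewrite ypowE dxdyE M2Z exprS; congr M2; rewrite ?rmorph0; ring.
Qed.

Lemma preserved_gens0 : preserved (gens0 R).
Proof.
apply: (@preserved_Sp _ (planar 0 false false)) => //.
- exact: planar0.
- exact: planar_lin.
- exact: planar_Dz.
- by move=> a b a' b'; apply: planar_bracket; right.
- exact: span_gens0.
move=> _ _ _ _ [e [r [q [-> -> /eqP -> /eqP ->]]]] [e' [r' [q' [-> -> /eqP -> /eqP ->]]]].
rewrite ?rmorph0; ring.
Qed.

End Bases.

Theorem mainTheorem4 (R : realType) (tau : R) (tau0 : 0 < tau)
    (tau1 : tau <= 1) :
  let P := pi_tau tau in
  let x := @cx R in
  let y := @cy R in
  let dz := ddz (@cst _ R 1) in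
  let dxdy (f : fld R) := wedge (ddx f) (ddy (cst 1)) in
  let E (t : R) := euler t in
  let nonresonant := forall n : nat, (0 < n)%N -> tau <> n%:R^-1 in
  is_poisson P /\
  (* H^0 *)
  ((forall f : fld R, casimir P f <-> exists c : R, f = cst c) /\
   basis_of_classes P 0 [:: scal (cst 1)]) /\
  (* H^1 *)
  ((tau = 1 ->
      basis_of_classes P 1 [:: ddx y; ddy x; E (-1); dz]) /\
   (forall n : nat, (2 <= n)%N -> tau = n%:R^-1 ->
      basis_of_classes P 1 [:: ddx (ypow n); E (-1); dz]) /\
   (nonresonant ->
      basis_of_classes P 1 [:: E (-1); dz])) /\
  (* H^2 *)
  ((tau = 1 ->
      basis_of_classes P 2
        [:: wedge (ddx y) dz; wedge (ddy x) dz; wedge (E (-1)) dz]) /\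
   (forall n : nat, (2 <= n)%N -> tau = n%:R^-1 ->
      basis_of_classes P 2 [:: wedge (ddx (ypow n)) dz; wedge (E (-1)) dz]) /\
   (nonresonant ->
      basis_of_classes P 2 [:: wedge (E (-1)) dz])) /\
  (* H^3 *)
  (forall h : cohomology P 3, h = 0) /\
  (* wedge product and bracket *)
  (induces_op P (@wedge R) addn /\
   induces_op P (@schouten R) (fun k l => (k + l).-1)) /\
  (tau = 1 ->
     represents (wedge (E 1) dz) (0 : cohomology P 2) /\
     (forall a : 'I_3 -> R,
        represents (dxdy (hpoly a)) (0 : cohomology P 2)) /\
     determined_modulo
       (fun A => exists (c : R) (a : 'I_3 -> R),
          A = c *: wedge (E 1) dz + dxdy (hpoly a))
       [:: ddx y; ddy x; E (-1)]) /\
  (forall n : nat, (2 <= n)%N -> tau = n%:R^-1 ->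
     represents (dxdy (ypow n.+1)) (0 : cohomology P 2) /\
     determined_modulo
       (fun A => exists c : R, A = c *: dxdy (ypow n.+1))
       [:: ddx (ypow n); E (-1)]) /\
  (nonresonant -> preserved [:: E (-1)]).
Proof.
move=> P x y dz dxdy E nonresonant; split; first exact: pi_poisson.
split; first by split; [exact: casimir_cst|exact: basis0].
split.
  split; first exact: (bases_one tau0 tau1 (k := 1)).
  split; first by move=> n; exact: (bases_inv tau0 tau1 (k := 1)).
  exact: (bases_nonres tau0 tau1 (k := 1)).
split.
  split; first exact: (bases_one tau0 tau1 (k := 2)).
  split; first by move=> n; exact: (bases_inv tau0 tau1 (k := 2)).
  exact: (bases_nonres tau0 tau1 (k := 2)).
split; first exact: H3_zero.
split; first by split; [exact: wedge_induces|exact: schouten_induces].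
split.
  move=> t1; split; last split.
  - rewrite /E -t1; exact: pi_exact.
  - by move=> a; rewrite /dxdy hpolyE dxdyE; exact: quad_exact.
  - exact: determined_one.
split.
  move=> n n2 tn; split; last exact: determined_inv.
  rewrite /dxdy ypowE dxdyE; apply: ypow_exact => //.
  exact: leq_trans n2.
by move=> _; exact: preserved_gens0.
Qed.
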